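(* Let $\alpha\in(0,1)$, $T>0$, let $\Omega\subset\mathbb{R}^d$, $d\in\{1,2,3\}$, be a bounded Lipschitz domain, and let $\mathcal{L}u:=-\sum_{i,j=1}^d\partial_{x_i}(a_{ij}(x,t)\,\partial_{x_j}u)+\sum_{i=1}^d b_i(x,t)\,\partial_{x_i}u$ with symmetric positive definite $\{a_{ij}(x,t)\}$, with coefficients in $L_\infty(\Omega\times(0,T))$, and with $$C_{\mathcal{L}}:=\sup_{\Omega\times(0,T)}\frac{\sum_{i=1}^d b_i^2}{4\lambda_a}<\infty,$$ where $\lambda_a=\lambda_a(x,t)>0$ is the minimal eigenvalue of $\{a_{ij}(x,t)\}$. Let $\inf_{\Omega\times(0,T)}c\ge-\lambda$ for some constant $\lambda\ge0$. Suppose that $u(\cdot,0)\le0$ in $\Omega$ and $u(\cdot,t)\le0$ on $\partial\Omega$ for any $t\in[0,T]$, and also that $u\in C([0,T];L_\infty(\Omega))\cap W^{1,\infty}(\epsilon,t;L_\infty(\Omega))$ for any $0<\epsilon<t\le T$, while $u(\cdot,t)\in H^1(\Omega)$ for any $t>0$ (i.e. any $t\in(0,T]$). Then $(D_t^\alpha+\mathcal{L}+c)u\le0$, understood in the weak sense, implies $\sup_\Omega u(\cdot,t)\le0$ for all $t\in[0,T]$.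
   Context: $D_t^\alpha$ is the Caputo derivative in time: $D_t^\alpha u(\cdot,t):=\frac{1}{\Gamma(1-\alpha)}\int_0^t(t-s)^{-\alpha}\,\partial_s u(\cdot,s)\,ds$ for $t>0$, the integral being understood as $\lim_{\epsilon\to0^+}\int_\epsilon^t$ in $L_\infty(\Omega)$, which exists for $u$ of the stated regularity. Notation: $\langle\cdot,\cdot\rangle$ is the $L_2(\Omega)$ inner product; $w^+:=\max\{0,w\}$; inequalities between, and suprema/infima of, functions in $L_\infty(\Omega)$ are understood almost everywhere/essentially in $x$. The coefficients are regarded as functions defined for every fixed $t\in(0,T]$: for each such $t$, $a_{ij}(\cdot,t),b_i(\cdot,t)\in L_\infty(\Omega)$, and the bounds $\sum_i b_i^2\le4\lambda_aC_{\mathcal{L}}$ and $c\ge-\lambda$ hold a.e. in $\Omega$. Boundary inequality: a function $w\in H^1(\Omega)$ satisfies $w\le0$ on $\partial\Omega$ if $w^+\in H^1_0(\Omega)$ (at $t=0$ this is automatic from $u(\cdot,0)\le 0$, since then $u(\cdot,0)^+=0$). Weak inequality: $(D_t^\alpha+\mathcal{L}+c)u\le0$ in a weak sense means that for every $t\in(0,T]$ and every nonnegative $\chi\in H^1_0(\Omega)$ one has $\langle(D_t^\alpha+\mathcal{L}+c)u,\chi\rangle\le0$ at time $t$, where $\langle\mathcal{L}u,\chi\rangle:=\sum_{i,j}\int_\Omega a_{ij}(\partial_{x_j}u)(\partial_{x_i}\chi)+\sum_i\int_\Omega b_i(\partial_{x_i}u)\chi$, and all the pairings (in particular $\langle cu,\chi\rangle$)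 are assumed to be well defined. *)

(* Defs.v *)
From HB Require Import structures.
From mathcomp Require Import all_boot all_order all_algebra.
From mathcomp Require Import all_classical all_reals all_analysis.

Set Implicit Arguments.
Unset Strict Implicit.
Unset Printing Implicit Defensive.

Import Order.TTheory GRing.Theory Num.Theory.
Import numFieldNormedType.Exports.

Local Open Scope classical_set_scope.
Local Open Scope ring_scope.

Definition rV_display : measure_display.
Proof. exact: default_measure_display. Qed.

Section measurable_rV.
Context {R : realType} {n : nat}.

Definition rV_coord (i : 'I_n) (x : 'rV[R]_n) : R := x ord0 i.

Let rV_set0 : g_sigma_preimage rV_coord set0.
Proof. exact: sigma_algebra0. Qed.

Let rV_setC A : g_sigma_preimage rV_coord A ->
  g_sigma_preimage rV_coord (~` A).
Proof. exact: sigma_algebraC. Qed.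

Let rV_bigcup (F : _^nat) : (forall i, g_sigma_preimage rV_coord (F i)) ->
  g_sigma_preimage rV_coord (\bigcup_i (F i)).
Proof. exact: sigma_algebra_bigcup. Qed.

(* The product (= Borel) sigma-algebra on R^n. *)
HB.instance Definition _ := @isMeasurable.Build rV_display
  'rV[R]_n (g_sigma_preimage rV_coord) rV_set0 rV_setC rV_bigcup.

End measurable_rV.

Lemma measurable_rV_coord (R : realType) n (i : 'I_n) :
  measurable_fun [set: 'rV[R]_n] (rV_coord i).
Proof.
move=> _ Y mY; rewrite setTI; apply: sub_sigma_algebra => /=.
rewrite -bigcup_seq/=; exists i => /=; first by rewrite mem_index_enum.
by exists Y => //; rewrite setTI.
Qed.

Lemma measurable_fun_rVP (R : realType) d (T : measurableType d) n
    (f : T -> 'rV[R]_n) :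
  (forall i, measurable_fun setT (fun t => f t ord0 i)) ->
  measurable_fun setT f.
Proof.
move=> mf; have H : g_sigma_preimage (fun i => @rV_coord R n i \o f) `<=` measurable.
  apply: smallest_sub; first exact: sigma_algebra_measurable.
  move=> A; rewrite -bigcup_seq/= => -[i _ [B mB <-]].
  exact: mf.
rewrite g_sigma_preimage_comp in H.
by move=> _ A mA; apply: H; exists A.
Qed.

Definition rV_cons {R : realType} {n} (p : R * 'rV[R]_n) : 'rV[R]_n.+1 :=
  \row_i if unlift ord0 i is Some j then p.2 ord0 j else p.1.

Lemma measurable_rV_cons (R : realType) n :
  measurable_fun [set: R * 'rV[R]_n] rV_cons.
Proof.
apply: measurable_fun_rVP => i.
case: (unliftP ord0 i) => [j|] ->.
  rewrite (_ : (fun _ => _) = rV_coord j \o snd).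
    by apply: measurableT_comp => //; exact: measurable_rV_coord.
  by apply/funext => p; rewrite mxE liftK.
rewrite (_ : (fun _ => _) = fst); first exact: measurable_fst.
by apply/funext => p; rewrite mxE unlift_none.
Qed.

Section lebesgue_rV_step.
Context {R : realType} {n : nat}.
Variable m : {sigma_finite_measure set 'rV[R]_n -> \bar R}.

Definition lebesgue_rV_step : set 'rV[R]_n.+1 -> \bar R :=
  pushforward (@lebesgue_measure R \x m)%E rV_cons.

Let step0 : lebesgue_rV_step set0 = 0%E.
Proof. by rewrite /lebesgue_rV_step /pushforward preimage_set0 (measure0 (@lebesgue_measure R \x m)%E). Qed.

Let step_ge0 A : (0 <= lebesgue_rV_step A)%E.
Proof. exact: (measure_ge0 (@lebesgue_measure R \x m)%E). Qed.


Let step_sigma_additive : semi_sigma_additive lebesgue_rV_step.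
Proof.
move=> F mF tF mUF; rewrite /lebesgue_rV_step /pushforward preimage_bigcup.
have mpre A : measurable A -> measurable (@rV_cons R n @^-1` A).
  by move=> mA; rewrite -[X in measurable X]setTI; exact: measurable_rV_cons.
apply: (measure_semi_sigma_additive (s:=(@lebesgue_measure R \x m)%E)).
- by move=> k; exact: mpre.
- apply/trivIsetP => /= i j _ _ ij; rewrite -preimage_setI.
  by move/trivIsetP : tF => /(_ _ _ _ _ ij) ->//; rewrite preimage_set0.
- by rewrite -preimage_bigcup; exact: mpre.
Qed.

HB.instance Definition _ := isMeasure.Build _ _ _ lebesgue_rV_step
  step0 step_ge0 step_sigma_additive.

Let step_sigma_finite : sigma_finite setT lebesgue_rV_step.
Proof.
have /sigma_finiteP[F [TF ndF Foo]] := sigma_finiteT (@lebesgue_measure R).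
have /sigma_finiteP[G [TG ndG Goo]] := sigma_finiteT m.
pose g (x : 'rV[R]_n.+1) : R * 'rV[R]_n := (x ord0 ord0, \row_j x ord0 (lift ord0 j)).
have gK p : g (rV_cons p) = p.
  case: p => a v; congr pair; first by rewrite mxE unlift_none.
  by apply/rowP => j; rewrite !mxE liftK.
have mg : measurable_fun setT g.
  apply/measurable_fun_pairP; split => /=; first exact: (measurable_rV_coord ord0).
  apply: measurable_fun_rVP => i.
  rewrite (_ : (fun _ => _) = rV_coord (lift ord0 i)).
    exact: measurable_rV_coord.
  by apply/funext => x; rewrite /= mxE.
exists (fun k => g @^-1` (F k `*` G k)).
  apply/seteqP; split => // x _; have : setT (g x) by [].
  rewrite -setXTT TF TG => -[[i _ Fi] [j _ Gj]].
  exists (maxn i j) => //; split.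
  - by move: Fi; exact/subsetPset/ndF/leq_maxl.
  - by move: Gj; exact/subsetPset/ndG/leq_maxr.
move=> k; have [mF Fk] := Foo k; have [mG Gk] := Goo k; split.
  by rewrite -[X in measurable X]setTI; apply: mg => //; exact: measurableX.
rewrite /lebesgue_rV_step /pushforward.
rewrite (_ : _ @^-1` _ = F k `*` G k).
  by rewrite product_measure1E// lte_mul_pinfty// ge0_fin_numE.
apply/funext => p; rewrite /preimage /mkset.
by have -> := gK p.
Qed.

HB.instance Definition _ := Measure_isSigmaFinite.Build _ _ _ lebesgue_rV_step
  step_sigma_finite.

End lebesgue_rV_step.

Fixpoint lebesgue_rV (R : realType) (n : nat) :
    {sigma_finite_measure set 'rV[R]_n -> \bar R} :=
  if n is k.+1 then lebesgue_rV_step (lebesgue_rV R k) else \d_(0 : 'rV[R]_0).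

Section function_spaces_on.
Context {d : measure_display} {T : measurableType d} {R : realType}.
Variable mu : {measure set T -> \bar R}.
Implicit Types (D : set T) (f : T -> R).

(* [L_p(D)] and its norm, for functions whose values outside [D] are
   irrelevant. *)
Definition Lp_on (p : \bar R) D f : Prop := f \_ D \in Lfun mu p.

Definition Lp_norm_on (p : \bar R) D f : \bar R :=
  ('N[mu]_p [EFin \o (f \_ D)])%E.

Definition ess_sup_on D f : \bar R :=
  ereal_inf [set y | {ae mu, forall x, D x -> ((f x)%:E <= y)%E}].

Definition ess_inf_on D f : \bar R :=
  ereal_sup [set y | {ae mu, forall x, D x -> (y <= (f x)%:E)%E}].

End function_spaces_on.

Definition compactly_supported_in {R : realType} {V : topologicalType}
    (D : set V) (phi : V -> R) : Prop :=
  compact (closure [set x | phi x != 0]) /\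
  closure [set x | phi x != 0] `<=` D.

Definition bounded_lipschitz_domain {R : realType} {d : nat}
    (Omega : set 'rV[R]_d) : Prop :=
  [/\ open Omega, connected Omega, Omega !=set0, bounded_set Omega &
      (* near each boundary point, [Omega] is, after the orthogonal change of
         coordinates [x |-> x *m Q], the strict epigraph of a Lipschitz function
         of the coordinates other than the [k]-th one *)
      forall x0, (closure Omega `\` Omega) x0 ->
        exists (Q : 'M[R]_d) (k : 'I_d) (gamma : 'rV[R]_d.-1 -> R) (L : R),
          [/\ Q *m Q^T = 1%:M, (L.-lipschitz gamma)%R &
              \forall x \near x0,
                Omega x <-> gamma (col' k (x *m Q)) < (x *m Q) ord0 k]].

Section sobolev.
Context {R : realType} {d : nat}.
Local Notation mu := (lebesgue_rV R d).
Variable Omega : set 'rV[R]_d.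
Implicit Types (f g phi chi w : 'rV[R]_d -> R).

(* [C_c^oo(Omega)] *)
Definition test_function phi : Prop :=
  compactly_supported_in Omega phi /\
  forall (s : seq 'I_d) x,
    differentiable (foldr (fun i h => 'D_('e_i) h) phi s) x.

Definition is_weak_partial (i : 'I_d) f g : Prop :=
  Lp_on mu 2%:E Omega g /\
  forall phi, test_function phi ->
    \int[mu]_(x in Omega) (f x * 'D_('e_i) phi x) =
    - \int[mu]_(x in Omega) (g x * phi x).

Definition weak_partial (i : 'I_d) f : 'rV[R]_d -> R :=
  xget (fun=> 0) [set g | is_weak_partial i f g].

Definition H1 f : Prop :=
  Lp_on mu 2%:E Omega f /\ forall i, exists g, is_weak_partial i f g.

(* The closure of [C_c^oo(Omega)] in [H1]. *)
Definition H10 f : Prop :=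
  H1 f /\
  exists phi : nat -> 'rV[R]_d -> R,
    [/\ forall k, test_function (phi k),
        Lp_norm_on mu 2%:E Omega (phi k \- f) @[k --> \oo] --> 0%E &
        forall i, Lp_norm_on mu 2%:E Omega
          ('D_('e_i) (phi k) \- weak_partial i f) @[k --> \oo] --> 0%E].

Definition nonpos_on_boundary w : Prop := H10 w^\+.

(* [<L w, chi>] for the coefficients [a = (a_ij)], [b = (b_i)]. *)
Definition elliptic_form (a : 'rV[R]_d -> 'M[R]_d) (b : 'rV[R]_d -> 'rV[R]_d)
    w chi : R :=
  \sum_i \sum_j
    \int[mu]_(x in Omega) (a x i j * weak_partial j w x * weak_partial i chi x)
  + \sum_i \int[mu]_(x in Omega) (b x ord0 i * weak_partial i w x * chi x).

End sobolev.

(** Functions of time with values in [L_oo(Omega)], on an interval [(p, q)] *)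

Section bochner.
Context {R : realType} {d : nat}.
Local Notation mu := (lebesgue_rV R d).
Local Notation leb := (@lebesgue_measure R).
Variable Omega : set 'rV[R]_d.
Local Notation Loo := (Lp_on mu +oo%E Omega).
Local Notation Loo_norm := (Lp_norm_on mu +oo%E Omega).
Implicit Types (p q : R) (u v f : R -> 'rV[R]_d -> R) (F : 'rV[R]_d -> R).

(* The simple function [s |-> \sum_k 1_(A k)(s) h k]. *)
Record simple_Loo := SimpleLoo {
  simple_size : nat;
  simple_set : 'I_simple_size -> set R;
  simple_val : 'I_simple_size -> 'rV[R]_d -> R;
  simple_setP : forall k, measurable (simple_set k);
  simple_valP : forall k, Loo (simple_val k) }.

Definition simple_eval (h : simple_Loo) : R -> 'rV[R]_d -> R :=
  fun s x => \sum_k \1_(simple_set (s := h) k) s * simple_val k x.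

Definition simple_integral p q (h : simple_Loo) : 'rV[R]_d -> R :=
  fun x => \sum_k fine (leb (simple_set (s := h) k `&` `]p, q[)) * simple_val k x.

Definition approximable_by p q f (h : nat -> simple_Loo) : Prop :=
  {ae leb, forall s, s \in `]p, q[ ->
    Loo (f s) /\ Loo_norm (simple_eval (h n) s \- f s)%R @[n --> \oo] --> 0%E}.

Definition strongly_measurable p q f : Prop :=
  exists h, approximable_by p q f h.

Definition is_bochner_integral p q f F : Prop :=
  Loo F /\
  exists h, [/\ approximable_by p q f h,
    (\int[leb]_(s in `]p, q[) Loo_norm (simple_eval (h n) s \- f s)%R)%E
      @[n --> \oo] --> 0%E &
    Loo_norm (simple_integral p q (h n) \- F) @[n --> \oo] --> 0%E].

(* [L_oo(p, q; L_oo(Omega))] *)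
Definition bochner_Loo p q f : Prop :=
  strongly_measurable p q f /\
  exists M : R, {ae leb, forall s, s \in `]p, q[ -> (Loo_norm (f s) <= M%:E)%E}.

Definition is_weak_time_derivative p q u v : Prop :=
  forall phi : R -> R,
    compactly_supported_in `]p, q[ phi ->
    (forall n s, derivable (derive1n n phi) s 1) ->
    exists F, is_bochner_integral p q (fun s x => derive1 phi s * u s x) F /\
              is_bochner_integral p q (fun s x => phi s * v s x) (\- F).

Definition W1oo_derivative p q u v : Prop :=
  [/\ bochner_Loo p q u, bochner_Loo p q v & is_weak_time_derivative p q u v].

(* [W^(1,oo)(p, q; L_oo(Omega))] *)
Definition W1oo p q u : Prop := exists v, W1oo_derivative p q u v.

(* [C([0, T]; L_oo(Omega))] *)
Definition continuous_Loo (T : R) u : Prop :=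
  forall t0, t0 \in `[0, T] ->
    Loo (u t0) /\
    Loo_norm (u t \- u t0) @[t --> within `[0, T] (nbhs t0)] --> 0%E.

Definition Gamma (z : R) : R :=
  \int[leb]_(x in `]0, +oo[) (x `^ (z - 1) * expR (- x)).

(* [w] is the Caputo derivative of order [alpha] of [u] at time [t]: [J eps] is
   the part on [(eps, t)] of the defining integral. *)
Definition is_caputo_derivative (alpha : R) u (t : R) (w : 'rV[R]_d -> R) : Prop :=
  Loo w /\
  exists J : R -> 'rV[R]_d -> R,
    (forall eps, 0 < eps < t -> exists2 v, W1oo_derivative eps t u v &
       is_bochner_integral eps t (fun s x => (t - s) `^ (- alpha) * v s x) (J eps)) /\
    Loo_norm (fun x => w x - (Gamma (1 - alpha))^-1 * J eps x) @[eps --> 0^'+]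
      --> 0%E.

(* [(D_t^alpha + L + c) u <= 0] in the weak sense on [(0, T]]. *)
Definition weak_subsolution (alpha T : R) (a : R -> 'rV[R]_d -> 'M[R]_d)
    (b : R -> 'rV[R]_d -> 'rV[R]_d) (c u : R -> 'rV[R]_d -> R) : Prop :=
  forall t, 0 < t <= T ->
  exists2 w, is_caputo_derivative alpha u t w &
  forall chi, H10 Omega chi -> {ae mu, forall x, Omega x -> 0 <= chi x} ->
    mu.-integrable Omega (fun x => (c t x * u t x * chi x)%:E) /\
    \int[mu]_(x in Omega) (w x * chi x)
    + elliptic_form Omega (a t) (b t) (u t) chi
    + \int[mu]_(x in Omega) (c t x * u t x * chi x) <= 0.

End bochner.

Definition sym_posdef {R : realType} {d : nat} (A : 'M[R]_d) : Prop :=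
  A^T = A /\ forall v : 'rV[R]_d, v != 0 -> 0 < (v *m A *m v^T) ord0 ord0.

Definition min_eigenvalue {R : realType} {d : nat} (A : 'M[R]_d) : R :=
  inf [set l | eigenvalue A l].

Section coefficients.
Context {R : realType} {d : nat}.
Local Notation mu := (lebesgue_rV R d).
Local Notation mut := (lebesgue_rV R d \x @lebesgue_measure R)%E.
Variables (Omega : set 'rV[R]_d) (T : R).

Definition cylinder : set ('rV[R]_d * R) := Omega `*` `]0, T[.

(* [f] belongs to [L_oo(Omega * (0, T))], and [f t] to [L_oo(Omega)] for each
   [t] in [(0, T]]. *)
Definition bounded_coefficient (f : R -> 'rV[R]_d -> R) : Prop :=
  Lp_on mut +oo%E cylinder (fun z => f z.2 z.1) /\
  forall t, 0 < t <= T -> Lp_on mu +oo%E Omega (f t).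

(* The constant [C_L]. *)
Definition drift_ratio_sup (a : R -> 'rV[R]_d -> 'M[R]_d)
    (b : R -> 'rV[R]_d -> 'rV[R]_d) : \bar R :=
  ess_sup_on mut cylinder (fun z =>
    (\sum_i b z.2 z.1 ord0 i ^+ 2) / (4 * min_eigenvalue (a z.2 z.1))).

End coefficients.

(* Main.v *)
From HB Require Import structures.
Require Import Defs.
From mathcomp Require Import all_boot all_order all_algebra.
From mathcomp Require Import all_classical all_reals all_analysis.
From mathcomp Require Import measurable_realfun ess_sup_inf ring lra.
Import Order.TTheory GRing.Theory Num.Theory.
Import numFieldNormedType.Exports.
Local Open Scope classical_set_scope.
Local Open Scope ring_scope.
Set Implicit Arguments.
Unset Strict Implicit.
Unset Printing Implicit Defensive.

(** Let [N t] be the essential supremum over [Omega] of the positive part of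
    [u t] ([pos_sup]).  It is continuous on [[0, T]] and vanishes at [0]; suppose
    that it is positive somewhere.  Maximizing [N] against the weight
    [expR (s / h)] gives a time [t] at which [M = N t] is positive, at which [M]
    bounds [N] on [[0, t]], and such that [N <= M / 2] on [[0, r0]] for some
    [r0 < t] with [t - r0 <= h] ([weighted_maximum]).  The scale [h] depends only
    on [alpha] and [lambda]: the kernel is so large on [(t - 2 h, t)] that having
    doubled during that time costs more than the zero-order term can return.

    The inequality at time [t] is tested with [chi = G(u(t)^+)] for
    [G(s) = s f(s - kappa)], [f(y) = exp(-1/y)] for [y > 0] and [f(y) = 0]
    otherwise, at the level [kappa = M - eps].  With [X] the integral of [chi],
    the three terms are estimated as follows.

    - Diffusion and drift.  The function [f] is so flat at [0] that
      [G^2 <= eps^2 G' G] on the range of [u(t)^+], hence the drift, absorbed in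
      the diffusion through [C_L], leaves at least [- C eps^2 X]
      ([elliptic_pointwise], [elliptic_form_ge]).
    - Zero-order term.  On the support of [chi] one has [0 < u(t) <= M], so that
      it is at least [- lambda M X].
    - Caputo derivative.  Only the scalar function [U(s) = <u(s), chi>] matters.
      Its weak derivative [V] exists because pairing commutes with Bochner
      integration ([pairing_bochner]), and the integrals of [V] are increments
      of [U] ([weak_derivative_increment]).  As [U(t) >= kappa X] and
      [U(s) <= N(s) X], the increments [U(t) - U(s)] are at least
      [(M/2 - eps) X] for [s <= r0], at least [- eps X] always, and at least
      [- M1 X (t - s)] near [t], where [M1] is a Lipschitz constant of [u].  The
      kernel being nondecreasing, the integral of the kernel against [V] is
      bounded below by that against an explicit step function with these
      increments ([nondecreasing_weight_ge0], [kernel_integral_ge]); this gives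
      [((2h)^(-alpha) (M/2 - eps) - M1 I) X], with [I] the integral of the kernel
      over an interval of length [eps / M1] ending at [t].

    As [eps] tends to [0] the sum of the three terms is eventually a positive
    multiple of [X], which is positive: a contradiction
    ([positive_maximum_absurd]).

    That [chi] belongs to [H^1_0], and that its gradient is [G'(u^+)] times that
    of [u], is [truncation_H10].  Since [u^+] is only known to be a limit of test
    functions [phi_k], the chain rule is applied to [G o phi_k], which are again
    test functions because [G] is smooth and [G(0) = 0]; the gradients of [u] and
    [u^+] are compared by testing, through the fundamental lemma [ae_eq0_test]. *)

(** * Integrals of real-valued functions *)

Section Rintegral_complements.
Context {d : measure_display} {T : measurableType d} {R : realType}.
Variables (mu : {measure set T -> \bar R}) (D : set T).
Hypothesis mD : measurable D.
Implicit Types f g : T -> R.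

Lemma Rintegral_dominated (fn : nat -> T -> R) f g :
  (forall n, measurable_fun D (fn n)) -> measurable_fun D f ->
  {ae mu, forall x, D x -> fn n x @[n --> \oo] --> f x} ->
  mu.-integrable D (EFin \o g) ->
  {ae mu, forall x n, D x -> `|fn n x| <= g x} ->
  (\int[mu]_(x in D) fn n x) @[n --> \oo] --> \int[mu]_(x in D) f x.
Proof.
move=> mfn mf cfn ig dom.
have [intf _ H] : [/\ mu.-integrable D (EFin \o f),
    (\int[mu]_(x in D) `|(fn n x)%:E - (f x)%:E|)%E @[n --> \oo] --> 0%E &
    (\int[mu]_(x in D) (fn n x)%:E)%E @[n --> \oo] --> (\int[mu]_(x in D) (f x)%:E)%E].
  apply: (@dominated_convergence _ _ _ mu D mD _ _ (EFin \o g)) => //.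
  - by move=> n; exact/measurable_EFinP.
  - exact/measurable_EFinP.
  - by apply: filterS cfn => x + Dx => /(_ Dx) h; exact: cvg_comp h _.
apply: fine_cvg; rewrite /Rintegral fineK; first exact: H.
exact: (integrable_fin_num mD intf).
Qed.

Lemma eq_integrable_ae f g : measurable_fun D g ->
  {ae mu, forall x, D x -> f x = g x} ->
  mu.-integrable D (EFin \o f) -> mu.-integrable D (EFin \o g).
Proof.
move=> mg fg fi; apply/integrableP; split; first exact/(measurable_EFinP _ _).
have [mf +] := integrableP _ _ _ fi.
rewrite (@ae_eq_integral _ _ _ _ _ (fun x => `|(EFin \o f) x|%E) (fun x => `|(EFin \o g) x|%E))//.
- by apply/measurableT_comp => //; exact/measurable_EFinP.
- exact: measurableT_comp.
- by apply: filterS fg => x + Dx => /(_ Dx) /= ->.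
Qed.

Lemma ae_eq_Rintegral f g : measurable_fun D f -> measurable_fun D g ->
  {ae mu, forall x, D x -> f x = g x} ->
  \int[mu]_(x in D) f x = \int[mu]_(x in D) g x.
Proof.
move=> mf mg fg; congr fine; apply: ae_eq_integral => //; [exact/measurable_EFinP|exact/measurable_EFinP|].
by apply: filterS fg => x + Dx => /(_ Dx) /= ->.
Qed.

Lemma ae_le_Rintegral f g :
  mu.-integrable D (EFin \o f) -> mu.-integrable D (EFin \o g) ->
  {ae mu, forall x, D x -> f x <= g x} ->
  \int[mu]_(x in D) f x <= \int[mu]_(x in D) g x.
Proof.
move=> fi gi fg.
have mf := (measurable_EFinP _ _).1 (measurable_int _ fi).
have mg := (measurable_EFinP _ _).1 (measurable_int _ gi).
pose h := fun x => Num.max (f x) (g x).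
have mh : measurable_fun D h by exact: measurable_maxr.
have hg : {ae mu, forall x, D x -> g x = h x}.
  by apply: filterS fg => x + Dx => /(_ Dx) fg; rewrite /h max_r.
rewrite (ae_eq_Rintegral mg mh hg); apply: le_Rintegral => //.
  exact: eq_integrable_ae hg gi.
by move=> x Dx; rewrite /h le_max lexx.
Qed.

Lemma Rintegrable_add f g : mu.-integrable D (EFin \o f) -> mu.-integrable D (EFin \o g) ->
  mu.-integrable D (EFin \o (fun x => f x + g x)).
Proof. by move=> fi gi; exact: (integrableD mD fi gi). Qed.

Lemma Rintegrable_scale k f : mu.-integrable D (EFin \o f) ->
  mu.-integrable D (EFin \o (fun x => k * f x)).
Proof. by move=> fi; exact: (integrableZl mD k fi). Qed.

Lemma Rintegrable_sub f g : mu.-integrable D (EFin \o f) -> mu.-integrable D (EFin \o g) ->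
  mu.-integrable D (EFin \o (fun x => f x - g x)).
Proof.
move=> fi gi; have := Rintegrable_add fi (Rintegrable_scale (-1) gi).
by under eq_fun do rewrite mulN1r.
Qed.

(** Setting [f] to [0] where the bound fails, a negligible set, reduces this to a
    bound that holds everywhere. *)
Lemma integrable_le f g : measurable_fun D f -> mu.-integrable D (EFin \o g) ->
  {ae mu, forall x, D x -> `|f x| <= g x} -> mu.-integrable D (EFin \o f).
Proof.
move=> mf gi fg.
have mg := (measurable_EFinP _ _).1 (measurable_int _ gi).
pose h := fun x => if `|f x| <= g x then f x else 0.
have mh : measurable_fun D h.
  apply: measurable_fun_if => //.
    apply: measurable_fun_ler => //; exact: measurableT_comp.
  by apply: measurable_funS mf => // x [].
have hf : {ae mu, forall x, D x -> h x = f x}.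
  by apply: filterS fg => x + Dx => /(_ Dx) fg; rewrite /h fg.
apply: (eq_integrable_ae mf hf).
apply: le_integrable gi => //; first exact/(measurable_EFinP _ _).
move=> x Dx /=; rewrite lee_fin /h; case: ifPn => [/le_trans->//|_]; first exact: ler_norm.
by rewrite normr0.
Qed.

Lemma le_norm_Rintegral f g : mu.-integrable D (EFin \o f) -> mu.-integrable D (EFin \o g) ->
  {ae mu, forall x, D x -> `|f x| <= g x} ->
  `|\int[mu]_(x in D) f x| <= \int[mu]_(x in D) g x.
Proof.
move=> fi gi fg; apply: le_trans (le_normr_Rintegral mD fi) _.
by apply: ae_le_Rintegral => //; exact: integrable_norm.
Qed.

Lemma Rintegral_sum (I : Type) (s : seq I) (F : I -> T -> R) :
  (forall i, mu.-integrable D (EFin \o F i)) ->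
  \int[mu]_(x in D) (\sum_(i <- s) F i x) = \sum_(i <- s) \int[mu]_(x in D) F i x.
Proof.
move=> Fi; elim: s => [|i s IH].
  under eq_Rintegral do rewrite big_nil; rewrite big_nil.
  by rewrite Rintegral_cst// mul0r.
under eq_Rintegral do rewrite big_cons; rewrite big_cons -IH.
apply: RintegralD => //.
rewrite (_ : _ \o _ = (fun x => \sum_(i <- s) (F i x)%:E)%E).
  by apply: (@integrable_sum _ _ _ mu D mD _ s xpredT (fun i x => (F i x)%:E)) => j _; exact: Fi.
by apply/funext => x /=; rewrite sumEFin.
Qed.

Lemma integrable_Rsum (I : Type) (s : seq I) (F : I -> T -> R) :
  (forall i, mu.-integrable D (EFin \o F i)) ->
  mu.-integrable D (EFin \o (fun x => \sum_(i <- s) F i x)).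
Proof.
move=> Fi.
rewrite (_ : _ \o _ = (fun x => \sum_(i <- s) (F i x)%:E)%E).
  by apply: (@integrable_sum _ _ _ mu D mD _ s xpredT (fun i x => (F i x)%:E)) => j _; exact: Fi.
by apply/funext => x /=; rewrite sumEFin.
Qed.

End Rintegral_complements.

(** * Smooth functions *)

Section smooth_functions.
Context {R : realType} {V : normedModType R} {I : Type} (e : I -> V).
Implicit Types (f g : V -> R) (n : nat).

(** Only the directions [e i] are differentiated along: a single direction gives
    smooth functions of a real variable, the canonical basis gives the iterated
    partial derivatives of test functions.  Recursion on the order makes the
    closure under products and composition an induction. *)
Fixpoint smooth_upto n f : Prop :=
  (forall x, differentiable f x) /\
  if n is m.+1 then forall i, smooth_upto m ('D_(e i) f) else True.

Definition smooth f := forall n, smooth_upto n f.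

Lemma smooth_upto_pred n f : smooth_upto n.+1 f -> smooth_upto n f.
Proof.
elim: n f => [|n IH] f [df Df]; first by split.
by split=> // i; exact/IH/Df.
Qed.

Lemma smooth_diff f : smooth f -> forall x, differentiable f x.
Proof. by move=> /(_ 0%N)[]. Qed.

Lemma smooth_continuous f : smooth f -> continuous f.
Proof. by move=> sf x; exact/differentiable_continuous/smooth_diff. Qed.

Lemma smooth_derive f i : smooth f -> smooth ('D_(e i) f).
Proof. by move=> sf n; have [_ /(_ i)] := sf n.+1. Qed.

Lemma smooth_foldr f (s : seq I) :
  smooth f -> smooth (foldr (fun i h => 'D_(e i) h) f s).
Proof. by move=> sf; elim: s => //= i s IH; exact: smooth_derive. Qed.

Lemma foldr_smooth f :
  (forall s x, differentiable (foldr (fun i h => 'D_(e i) h) f s) x) -> smooth f.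
Proof.
move=> H n; elim: n f H => [|n IH] f H; first by split=> // x; exact: (H [::]).
split=> [x|i]; first exact: (H [::]).
by apply: IH => s x; have := H (rcons s i) x; rewrite foldr_rcons.
Qed.

Lemma smooth_upto_cst n (c : R) : smooth_upto n (fun=> c : R).
Proof.
elim: n c => [|n IH] c; first by split=> // x; exact: differentiable_cst.
split=> [x|i]; first exact: differentiable_cst.
suff -> : 'D_(e i) (fun=> c) = (fun=> 0) :> (V -> R) by exact: IH.
by apply/funext => x; rewrite derive_cst.
Qed.

Lemma smooth_cst (c : R) : smooth (fun=> c).
Proof. by move=> n; exact: smooth_upto_cst. Qed.

Lemma smooth_uptoD n f g :
  smooth_upto n f -> smooth_upto n g -> smooth_upto n (f \+ g).
Proof.
elim: n f g => [|n IH] f g [df Df] [dg Dg].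
  by split=> // x; exact: differentiableD.
split=> [x|i]; first exact: differentiableD.
suff -> : 'D_(e i) (f \+ g) = 'D_(e i) f \+ 'D_(e i) g.
  exact: IH (Df i) (Dg i).
by apply/funext => x; rewrite deriveD//; exact: diff_derivable.
Qed.

Lemma smoothD f g : smooth f -> smooth g -> smooth (f \+ g).
Proof. by move=> sf sg n; exact: smooth_uptoD. Qed.

Lemma smooth_uptoM n f g :
  smooth_upto n f -> smooth_upto n g -> smooth_upto n (f \* g).
Proof.
elim: n f g => [|n IH] f g; first by move=> [df _] [dg _]; split=> // x; exact: differentiableM.
move=> sf sg; have [df Df] := sf; have [dg Dg] := sg.
split=> [x|i]; first exact: differentiableM.
suff -> : 'D_(e i) (f \* g) = (f \* 'D_(e i) g) \+ (g \* 'D_(e i) f).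
  apply: smooth_uptoD; apply: IH; [|exact: Dg| |exact: Df];
      exact: smooth_upto_pred.
by apply/funext => x; rewrite deriveM//; exact: diff_derivable.
Qed.

Lemma smoothM f g : smooth f -> smooth g -> smooth (f \* g).
Proof. by move=> sf sg n; exact: smooth_uptoM. Qed.

Lemma smoothN f : smooth f -> smooth (fun x => - f x).
Proof.
move=> sf; rewrite (_ : (fun _ => _) = (fun=> -1) \* f).
  by apply: smoothM => //; exact: smooth_cst.
by apply/funext => x /=; rewrite mulN1r.
Qed.

Lemma smooth_prod (J : Type) (r : seq J) (F : J -> V -> R) :
  (forall j, smooth (F j)) -> smooth (fun x => \prod_(j <- r) F j x).
Proof.
move=> sF; elim: r => [|j r IH].
  by under eq_fun do rewrite big_nil; exact: smooth_cst.
by under eq_fun do rewrite big_cons; exact: (smoothM (sF j) IH).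
Qed.

Lemma smooth_linear f : linear f -> continuous f -> smooth f.
Proof.
move=> lf cf.
pose L := GRing.isLinear.Build _ _ _ _ _ lf.
pose F : {linear V -> R} := HB.pack f L.
have dF x : differentiable f x by exact: (@linear_differentiable _ _ _ F).
case=> [|n]; split=> // i.
suff -> : 'D_(e i) f = (fun=> f (e i)) by exact: smooth_upto_cst.
apply/funext => x; rewrite deriveE//.
by have -> := @diff_lin _ _ _ F x cf.
Qed.

End smooth_functions.

Section real_smooth.
Context {R : realType}.
Notation smoothR := (@smooth R R unit (fun=> 1)).

Lemma smoothR_derive1 (f : R -> R) : smoothR f -> smoothR (derive1 f).
Proof.
move=> sf; have := smooth_derive tt sf.
by rewrite (_ : 'D_1 f = (derive1 f))//; apply/funext => x; rewrite derive1E.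
Qed.

Lemma smoothR_derive1n (f : R -> R) n x : smoothR f -> derivable (derive1n n f) x 1.
Proof.
move=> sf; apply/derivable1_diffP.
suff : smoothR (derive1n n f) by move=> /smooth_diff.
by elim: n => //= n IH; exact: smoothR_derive1.
Qed.

Lemma smoothR_id : smoothR id.
Proof. by apply: smooth_linear => // x; exact: cvg_id. Qed.

Lemma derive_comp {V : normedModType R} (g : R -> R) (f : V -> R) v x :
  differentiable f x -> differentiable g (f x) ->
  'D_v (g \o f) x = (derive1 g) (f x) * 'D_v f x.
Proof.
move=> df dg; rewrite !deriveE//; last exact: differentiable_comp.
rewrite diff_comp//= diff1E//=.
by rewrite mulrC.
Qed.

Lemma smooth_upto_comp {V : normedModType R} {I : Type} (e : I -> V) n
    (g : R -> R) (f : V -> R) :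
  smoothR g -> smooth_upto e n f -> smooth_upto e n (g \o f).
Proof.
elim: n g f => [|n IH] g f sg sf; have [df Df] := sf.
  by split=> // x; apply: differentiable_comp => //; exact: smooth_diff.
split=> [x|i]; first by apply: differentiable_comp => //; exact: smooth_diff.
have -> : 'D_(e i) (g \o f) = ((derive1 g) \o f) \* 'D_(e i) f.
  by apply/funext => x; rewrite derive_comp//; exact: smooth_diff.
apply: smooth_uptoM (Df i); apply: IH; first exact: smoothR_derive1.
exact: smooth_upto_pred.
Qed.

Lemma smooth_comp {V : normedModType R} {I : Type} (e : I -> V)
    (g : R -> R) (f : V -> R) : smoothR g -> smooth e f -> smooth e (g \o f).
Proof. by move=> sg sf n; exact: smooth_upto_comp. Qed.

Lemma smoothR_affine (a b : R) : smoothR (fun x => a * x + b).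
Proof.
apply: (@smoothD _ _ _ _ (fun x => a * x) (fun=> b)); last exact: smooth_cst.
apply: (@smoothM _ _ _ _ (fun=> a) id); [exact: smooth_cst|exact: smoothR_id].
Qed.

Lemma exprn_expRN_le (y : R) n : 0 <= y -> y ^+ n * expR (- y) <= n`!%:R.
Proof.
move=> y0; rewrite expRN ler_pdivrMr ?expR_gt0//.
case: n => [|n]; first by rewrite expr0 mul1r -expR0 ler_expR.
rewrite mulrC -ler_pdivrMr ?ltr0n ?fact_gt0//.
by apply: le_trans (expR_ge1Dxn n y0); rewrite lerDr.
Qed.

(** The family [x^(-n) exp(-1/x)], extended by [0]: it contains [exp(-1/x)] and
    its span is closed under differentiation. *)
Definition flatn n (x : R) : R := if 0 < x then x^-1 ^+ n * expR (- x^-1) else 0.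

Definition flat := flatn 0.

Lemma flatn_ge0 n x : 0 <= flatn n x.
Proof.
by rewrite /flatn; case: ifPn => // x0; rewrite mulr_ge0 ?expR_ge0// exprn_ge0// invr_ge0 ltW.
Qed.

Lemma flatn_le n x : flatn n x <= n`!%:R.
Proof. by rewrite /flatn; case: ifPn => // x0; rewrite exprn_expRN_le// invr_ge0 ltW. Qed.

(** At [0] the difference quotient is at most [(n+2)! |h|], because
    [y^(n+2) exp(-y)] is bounded by [(n+2)!]. *)
Lemma is_derive_flatn n x : is_derive (x : R) 1 (flatn n) (flatn n.+2 x - n%:R * flatn n.+1 x).
Proof.
have [x0|x0|->] := ltgtP x 0.
- rewrite /flatn ltNge (ltW x0)/= mulr0 subr0 -/(flatn n).
  have E : \near x, (fun=> 0 : R) x = flatn n x.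
    near=> y; rewrite /flatn ltNge; have -> //= : y <= 0.
    by apply/ltW; near: y; exact: lt_nbhsl.
  exact: near_eq_is_derive E _.
- rewrite [X in X - _]/flatn [flatn n.+1 _]/flatn x0.
  have E : \near x, (fun y => y^-1 ^+ n * expR (- y^-1)) x = flatn n x.
    by near=> y; rewrite /flatn; have -> //= : 0 < y; near: y; exact: lt_nbhsr.
  have xn0 : x != 0 by rewrite gt_eqF.
  suff D : is_derive x 1 (fun y => y^-1 ^+ n * expR (- y^-1))
      (x^-1 ^+ n.+2 * expR (- x^-1) - n%:R * (x^-1 ^+ n.+1 * expR (- x^-1))).
    exact: near_eq_is_derive E D.
  have DV : is_derive x 1 (fun y : R => y^-1) (- x^-1 ^+ 2).
    apply: is_derive_eq; first exact: is_deriveV.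
    by rewrite /GRing.scale/= mulr1 exprVn.
  have DE : is_derive x 1 (fun y : R => expR (- y^-1)) (x^-1 ^+ 2 * expR (- x^-1)).
    have DN : is_derive x 1 (fun y : R => - y^-1) (x^-1 ^+ 2).
      by have := is_deriveN DV; rewrite opprK.
    have := @is_derive1_comp _ expR (fun y => - y^-1) x _ _ (is_derive_expR _) DN.
    by rewrite mulrC.
  have -> : (fun y : R => y^-1 ^+ n * expR (- y^-1)) =
      ((fun y : R => y^-1) ^+ n) * (fun y => expR (- y^-1)).
    by apply/funext => y; rewrite /GRing.mul/= exprfctE.
  apply: (is_derive_eq (is_deriveM (is_deriveX n DV) DE)).
  rewrite exprfctE.
  rewrite /GRing.scale/=.
  case: n {E} => [|n]; first by rewrite !mul0r mulr0 addr0 subr0 expr0 mul1r.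
  by rewrite /= !exprS expr0; ring.
- rewrite /flatn ltxx mulr0 subr0 -/(flatn n).
  have C h : h != 0 -> `|h^-1 *: (flatn n (h *: 1 + 0) - flatn n 0)| <= n.+2`!%:R * `|h|.
    move=> h0; rewrite addr0 /GRing.scale/= mulr1 [flatn n 0]/flatn ltxx subr0.
    rewrite normrM normfV ler_pdivrMl ?normr_gt0//.
    have [hle|hgt] := leP h 0.
      by rewrite /flatn ltNge hle/= normr0 !mulr_ge0.
    rewrite ger0_norm ?flatn_ge0// gtr0_norm//.
    have := flatn_le n.+2 h; rewrite /flatn hgt => H.
    have -> : h^-1 ^+ n * expR (- h^-1) = h * (h^-1 ^+ n.+2 * expR (- h^-1) * h).
      by rewrite !exprS; field.
    by rewrite ler_pM2l// ler_pM2r.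
  have : h^-1 *: (flatn n (h *: 1 + 0) - flatn n 0) @[h --> 0^'] --> (0 : R).
    apply: norm_cvg0.
    apply: (@squeeze_cvgr _ _ _ _ (fun=> 0) (fun h => n.+2`!%:R * `|h|)).
    - near=> h; rewrite normr_ge0 C//; near: h; exact: nbhs_dnbhs_neq.
    - exact: cvg_cst.
    - rewrite -[X in _ --> X](mulr0 n.+2`!%:R).
      apply: cvgMr; apply: cvg_within_filter.
      by have := @norm_continuous R R 0; rewrite /continuous_at normr0.
  move=> H; apply: DeriveDef; first by apply/cvg_ex; exists 0.
  exact/cvg_lim.
Unshelve. all: by end_near. Qed.

Lemma smooth_flatn n : smoothR (flatn n).
Proof.
move=> m; elim: m n => [|m IH] n.
  split=> // x; apply/derivable1_diffP; exact: (is_derive_flatn n x).(ex_derive).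
split=> [x|_].
  by apply/derivable1_diffP; exact: (is_derive_flatn n x).(ex_derive).
have -> : 'D_1 (flatn n) = flatn n.+2 \+ ((fun=> - n%:R) \* flatn n.+1).
  apply/funext => x; rewrite (is_derive_flatn n x).(derive_val) /=; ring.
by apply: smooth_uptoD => //; apply: smooth_uptoM => //; exact: smooth_upto_cst.
Qed.

Lemma smooth_flat : smoothR flat. Proof. exact: smooth_flatn. Qed.

Lemma flat_gt0 x : 0 < x -> 0 < flat x.
Proof. by move=> x0; rewrite /flat /flatn x0 expr0 mul1r expR_gt0. Qed.

Lemma flat_le0 n x : x <= 0 -> flatn n x = 0.
Proof. by rewrite leNgt /flatn => /negbTE ->. Qed.

Lemma flat_le1 x : flat x <= 1.
Proof. exact: (flatn_le 0). Qed.

End real_smooth.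

(** * Boxes and the fundamental lemma of the calculus of variations *)

Section boxes.
Context {R : realType} {d : nat}.
Local Notation mu := (lebesgue_rV R d).
Implicit Types (a b x : 'rV[R]_d) (D : set 'rV[R]_d).

Definition obox a b := [set x : 'rV[R]_d | forall i, a ord0 i < x ord0 i < b ord0 i].
Definition cbox a b := [set x : 'rV[R]_d | forall i, a ord0 i <= x ord0 i <= b ord0 i].

Lemma obox_cbox a b : obox a b `<=` cbox a b.
Proof. by move=> x + i => /(_ i)/andP[/ltW -> /ltW ->]. Qed.

Lemma compact_cbox a b : compact (cbox a b).
Proof.
have := @rV_compact _ d (fun i => `[a ord0 i, b ord0 i]%classic)
  (fun i => @segment_compact R _ _).
by congr compact; apply/seteqP; split=> x /= H i; have := H i; rewrite in_itv.
Qed.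

Lemma measurable_obox a b : measurable (obox a b).
Proof.
rewrite (_ : obox a b = \bigcap_(i in [set: 'I_d]) (rV_coord i @^-1` `]a ord0 i, b ord0 i[)).
  apply: fin_bigcap_measurable => // i _.
  by rewrite -[X in measurable X]setTI; exact: measurable_rV_coord.
by apply/seteqP; split=> [x H i _|x H i]; have := H i; rewrite /= in_itv//=; apply.
Qed.

Lemma setI_obox a b a' b' : obox a b `&` obox a' b' =
  obox (\row_i Num.max (a ord0 i) (a' ord0 i)) (\row_i Num.min (b ord0 i) (b' ord0 i)).
Proof.
apply/seteqP; split=> x /=.
  by move=> [H H'] i; have /andP[? ?] := H i; have /andP[? ?] := H' i; rewrite !mxE gt_max lt_min; apply/andP; split; apply/andP.
by move=> H; split=> i; have := H i; rewrite !mxE gt_max lt_min => /andP[/andP[? ?] /andP[? ?]]; apply/andP.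
Qed.

(** Boxes with rational corners.  Retaining those whose closure lies in [D] makes
    bumps supported in the closed box admissible test functions on [D]. *)
Lemma open_boxP D : open D -> exists I : set nat, exists F : nat -> 'rV[R]_d * 'rV[R]_d,
  (forall k, I k -> cbox (F k).1 (F k).2 `<=` D) /\
  D = \bigcup_(k in I) obox (F k).1 (F k).2.
Proof.
move=> oD.
pose r (q : 'rV[rat]_d) : 'rV[R]_d := map_mx ratr q.
pose G (k : nat) : 'rV[R]_d * 'rV[R]_d :=
  if @unpickle ('rV[rat]_d * 'rV[rat]_d)%type k is Some p then (r p.1, r p.2) else (0, 0).
exists [set k | cbox (G k).1 (G k).2 `<=` D], G; split=> //.
apply/seteqP; split=> [x Dx|x [k Dk Ix]]; last exact/Dk/obox_cbox.
have /nbhs_ballP[e /= e0 xe] : nbhs x D by exact: open_nbhs_nbhs.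
have lo i : {q : rat | x ord0 i - e / 2 < ratr q < x ord0 i}.
  by apply/cid; have [q] := @rat_in_itvoo R (x ord0 i - e / 2) (x ord0 i) ltac:(lra); rewrite in_itv/=; exists q.
have hi i : {q : rat | x ord0 i < ratr q < x ord0 i + e / 2}.
  by apply/cid; have [q] := @rat_in_itvoo R (x ord0 i) (x ord0 i + e / 2) ltac:(lra); rewrite in_itv/=; exists q.
pose p : 'rV[rat]_d * 'rV[rat]_d := (\row_i sval (lo i), \row_i sval (hi i)).
exists (pickle p); rewrite /G/= pickleK/=.
  move=> y Hy; apply: xe; split=> // i j; rewrite ord1.
  have := Hy j; rewrite !mxE; case: (lo j) => q /= /andP[q1 q2]; case: (hi j) => s /= /andP[s1 s2] /andP[y1 y2].
  by rewrite /ball/= ltr_norml; apply/andP; split; lra.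
move=> i; rewrite !mxE; case: (lo i) => q /= /andP[q1 q2]; case: (hi i) => s /= /andP[s1 s2].
by rewrite q2 s1.
Qed.

Lemma open_measurable_rV D : open D -> measurable D.
Proof.
move=> /open_boxP[I [F [_ ->]]]; apply: bigcup_measurable => k _.
exact: measurable_obox.
Qed.

Definition oboxes : set (set 'rV[R]_d) := [set obox p.1 p.2 | p in [set: 'rV[R]_d * 'rV[R]_d]].

(** Boxes form a generating pi-system, as Dynkin induction requires in
    [ae_obox_eq0]; they generate the open sets, hence the preimages of open
    intervals under the coordinates. *)
Lemma measurable_oboxes : @measurable _ 'rV[R]_d = <<s oboxes >>.
Proof.
apply/seteqP; split; last first.
  apply: smallest_sub; first exact: sigma_algebra_measurable.
  by move=> _ [p _ <-]; exact: measurable_obox.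
have sA : sigma_algebra [set: 'rV[R]_d] <<s oboxes >> by exact: smallest_sigma_algebra.
have oS D : open D -> <<s oboxes >> D.
  move=> /open_boxP[I [F [_ ->]]].
  rewrite bigcup_mkcond; apply: sigma_algebra_bigcup => k; case: ifPn => _.
    by apply: sub_sigma_algebra; exists (F k).
  exact: sigma_algebra0.
apply: smallest_sub => // A; rewrite -bigcup_seq/= => -[i _ [B mB <-]].
rewrite setTI.
suff : <<s @RGenOpens.G R >> `<=` [set B | <<s oboxes >> (rV_coord i @^-1` B)].
  have := RGenOpens.measurableE R; rewrite /measurable/= => <- H.
  exact: H mB.
apply: smallest_sub; last first.
  move=> _ [x [y ->]] /=; apply: oS.
  have /continuousP := @coord_continuous R 1 d ord0 i.
  by apply; exact: interval_open.
split.
- by rewrite /= preimage_set0; exact: sigma_algebra0.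
- move=> B' /= H; rewrite setTD preimage_setC; exact: sigma_algebraC.
- move=> F H /=; rewrite preimage_bigcup; exact: sigma_algebra_bigcup.
Qed.

Lemma measurable_fun_continuous_rV (f : 'rV[R]_d -> R) : continuous f -> measurable_fun setT f.
Proof.
move=> /continuousP cf; apply: (measurability _ (RGenOpens.measurableE R)).
move=> _ [_ [a [b ->] <-]]; rewrite setTI; apply: open_measurable_rV.
exact/cf/interval_open.
Qed.

End boxes.

Lemma obox_fin_measure (R : realType) d (a b : 'rV[R]_d) :
  (lebesgue_rV R d (obox a b) < +oo)%E.
Proof.
elim: d a b => [|d IH] a b /=.
  by rewrite diracE; case: (_ \in _); rewrite ltry.
rewrite /lebesgue_rV_step /pushforward.
pose a' : 'rV[R]_d := \row_i a ord0 (lift ord0 i).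
pose b' : 'rV[R]_d := \row_i b ord0 (lift ord0 i).
have -> : rV_cons @^-1` obox a b = `]a ord0 ord0, b ord0 ord0[ `*` obox a' b'.
  apply/seteqP; split=> [p H|p [H1 H2] i].
    split=> [|i]; first by have := H ord0; rewrite /= !mxE unlift_none in_itv.
    by have := H (lift ord0 i); rewrite !mxE liftK.
  case: (unliftP ord0 i) => [j|] ->; rewrite !mxE.
    by have := H2 j; rewrite !mxE liftK.
  by move: H1; rewrite unlift_none /= in_itv.
rewrite product_measure1E//; last exact: measurable_obox.
rewrite lte_mul_pinfty// ?IH//.
  rewrite ge0_fin_numE// [X in (X < _)%E]lebesgue_measure_itv; case: ifPn => _; by rewrite ?ltry.
Qed.

Section fundamental_lemma.
Context {R : realType} {d : nat}.
Local Notation mu := (lebesgue_rV R d).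
Implicit Types (a b x : 'rV[R]_d) (D Omega : set 'rV[R]_d).

Lemma test_function_smooth Omega (phi : 'rV[R]_d -> R) : test_function Omega phi <->
  compactly_supported_in Omega phi /\ smooth (fun i : 'I_d => 'e_i) phi.
Proof.
split=> -[cphi sphi]; split=> //; first exact: foldr_smooth.
by move=> s x; exact/smooth_diff/(smooth_foldr s sphi).
Qed.

Lemma compactly_supported_sub Omega (f : 'rV[R]_d -> R) (K : set 'rV[R]_d) :
  compact K -> K `<=` Omega -> (forall x, f x != 0 -> K x) ->
  compactly_supported_in Omega f.
Proof.
move=> cK KO fK.
have clK : closure [set x | f x != 0] `<=` K.
  have cK' : closed K by apply: compact_closed => //; exact: norm_hausdorff.
  by rewrite closureE => x; apply; split.
split; last exact: subset_trans KO.
by apply: (subclosed_compact (@closed_closure _ _) cK).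
Qed.

(** As [n] grows this tends to the indicator of the open box, while the support
    stays in the closed box. *)
Definition box_bump (a b : 'rV[R]_d) (n : nat) (x : 'rV[R]_d) : R :=
  \prod_(i < d) (flat (n.+1%:R * (x ord0 i - a ord0 i)) * flat (n.+1%:R * (b ord0 i - x ord0 i))).

Lemma box_bump_ge0 a b n x : 0 <= box_bump a b n x.
Proof. by apply: prodr_ge0 => i _; rewrite mulr_ge0// flatn_ge0. Qed.

Lemma box_bump_le1 a b n x : box_bump a b n x <= 1.
Proof.
apply: prodr_ile1 => i _; rewrite mulr_ge0 ?flatn_ge0//=.
by rewrite mulr_ile1 ?flatn_ge0 ?flat_le1.
Qed.

Lemma box_bump_eq0 a b n x : ~ obox a b x -> box_bump a b n x = 0.
Proof.
move=> /existsNP[i /negP]; rewrite negb_and -!leNgt => H.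
rewrite /box_bump (bigD1 i)//=.
case/orP: H => H.
  by rewrite [X in X * _ * _ = _]flat_le0 ?mul0r// pmulr_rle0// subr_le0.
by rewrite [X in _ * X * _ = _]flat_le0 ?mulr0 ?mul0r// pmulr_rle0// subr_le0.
Qed.

Lemma smooth_coord (i : 'I_d) : smooth (fun i : 'I_d => 'e_i) (fun x : 'rV[R]_d => x ord0 i).
Proof.
apply: smooth_linear; last exact: coord_continuous.
by move=> k u v; rewrite !mxE.
Qed.

Lemma test_function_box_bump Omega a b n : cbox a b `<=` Omega ->
  test_function Omega (box_bump a b n).
Proof.
move=> abO; apply/test_function_smooth; split.
  apply: compactly_supported_sub abO _; first exact: compact_cbox.
  move=> x; apply: contra_neqP => H; apply: box_bump_eq0 => /obox_cbox.
  exact: H.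
apply: smooth_prod => i.
apply: (@smoothM _ _ _ _ (fun x : 'rV[R]_d => flat (n.+1%:R * (x ord0 i - a ord0 i)))
   (fun x : 'rV[R]_d => flat (n.+1%:R * (b ord0 i - x ord0 i)))).
  rewrite (_ : (fun _ => _) = (flat \o (fun y => n.+1%:R * y + - (n.+1%:R * a ord0 i))) \o (fun x : 'rV[R]_d => x ord0 i)).
    apply: smooth_comp (smooth_coord i); apply: smooth_comp; first exact: smooth_flat.
    exact: smoothR_affine.
  by apply/funext => x /=; congr flat; ring.
rewrite (_ : (fun _ => _) = (flat \o (fun y => (- n.+1%:R) * y + (n.+1%:R * b ord0 i))) \o (fun x : 'rV[R]_d => x ord0 i)).
  apply: smooth_comp (smooth_coord i); apply: smooth_comp; first exact: smooth_flat.
  exact: smoothR_affine.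
by apply/funext => x /=; congr flat; ring.
Qed.

Lemma flat_cvg1 (y : R) : 0 < y -> flat (n.+1%:R * y) @[n --> \oo] --> (1 : R).
Proof.
move=> y0; rewrite (_ : (fun n => _) = (fun n => expR (- (y^-1 * n.+1%:R^-1)))).
  have H : (y^-1 * n.+1%:R^-1) @[n --> \oo] --> (0 : R).
    by rewrite -[X in _ --> X](mulr0 y^-1); apply: cvgMr; exact: cvg_harmonic.
  have := cvg_comp _ _ (cvgN H) (@continuous_expR R (- 0)).
  by rewrite oppr0 expR0; exact.
by apply/funext => n; rewrite /flat /flatn mulr_gt0// expr0 mul1r invfM mulrC.
Qed.

Lemma box_bump_cvg a b x : box_bump a b n x @[n --> \oo] --> (\1_(obox a b) x : R).
Proof.
have [H|H] := pselect (obox a b x); last first.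
  rewrite indicE memNset//; apply: cvg_near_cst; apply: nearW => n.
  exact: box_bump_eq0.
rewrite indicE mem_set//.
have -> : true%:R = \prod_(i < d) (1 : R) by rewrite big1.
have Hi i : flat (n.+1%:R * (x ord0 i - a ord0 i)) * flat (n.+1%:R * (b ord0 i - x ord0 i))
    @[n --> \oo] --> (1 : R).
  have /andP[h1 h2] := H i.
  by rewrite -[X in _ --> X](mulr1 1); apply: cvgM; apply: flat_cvg1; rewrite subr_gt0.
exact: (@cvg_big R 'I_d *%R 1 xpredT (@mul_continuous R) nat \oo _ _ (fun=> 1) _
  (fun i _ => Hi i)).
Qed.

Lemma test_function_continuous Omega phi : test_function Omega phi -> continuous phi.
Proof. by move=> /test_function_smooth[_ /smooth_continuous]. Qed.

Variable Omega : set 'rV[R]_d.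
Hypothesis oO : open Omega.
Let mO : measurable Omega. Proof. exact: open_measurable_rV. Qed.
Variable f : 'rV[R]_d -> R.
Hypothesis intf : mu.-integrable Omega (EFin \o f).
Hypothesis f_test : forall phi, test_function Omega phi ->
  \int[mu]_(x in Omega) (f x * phi x) = 0.

Let mf : measurable_fun Omega f.
Proof. exact: (measurable_EFinP _ _).1 (measurable_int _ intf). Qed.

Lemma integral_obox_eq0 a b : cbox a b `<=` Omega ->
  \int[mu]_(x in obox a b) f x = 0.
Proof.
move=> abO.
have oO' : obox a b `<=` Omega by move=> x /obox_cbox /abO.
have H : (\int[mu]_(x in Omega) (f x * box_bump a b n x)) @[n --> \oo] -->
    \int[mu]_(x in Omega) (f x * \1_(obox a b) x).
  apply: (@Rintegral_dominated _ _ _ _ _ mO _ _ (fun x => `|f x|)).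
  - move=> n; apply: measurable_funM => //.
    apply: (@measurable_funS _ _ _ _ setT) => //.
    by apply: measurable_fun_continuous_rV; exact: test_function_continuous (test_function_box_bump n abO).
  - by apply: measurable_funM => //; apply: measurable_indic; exact: measurable_obox.
  - apply: aeW => x _; apply: cvgMr; exact: box_bump_cvg.
  - exact: integrable_norm.
  - apply: aeW => x n _; rewrite normrM ler_piMr// ger0_norm ?box_bump_ge0//.
    exact: box_bump_le1.
have -> : \int[mu]_(x in obox a b) f x = \int[mu]_(x in Omega) (f x * \1_(obox a b) x).
  rewrite -{1}(setIidr oO') Rintegral_mkcondr; apply: eq_Rintegral => x _.
  by rewrite patchE indicE; case: (_ \in _); rewrite ?mulr1 ?mulr0.
apply/esym/(cvg_unique (@norm_hausdorff _ _) _ H).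
rewrite (_ : (fun n => _) = fun=> 0); first exact: cvg_cst.
by apply/funext => n; apply: f_test; exact: test_function_box_bump.
Qed.

Lemma ae_obox_eq0 a b : cbox a b `<=` Omega ->
  {ae mu, forall x, obox a b x -> f x = 0}.
Proof.
move=> abO; pose B := obox a b.
have mB : measurable B by exact: measurable_obox.
have BO : B `<=` Omega by move=> x /obox_cbox /abO.
have iB : mu.-integrable B (EFin \o f) by exact: integrableS intf.
have sub a' b' : \int[mu]_(x in obox a' b' `&` B) f x = 0.
  rewrite setI_obox; apply: integral_obox_eq0 => x Hx; apply: abO => i.
  by have := Hx i; rewrite !mxE ge_max le_min => /andP[/andP[_ ->] /andP[_ ->]].
have all_ E : measurable E -> \int[mu]_(x in E `&` B) f x = 0.
  move=> mE; apply: (dynkin_induction (P := fun E => \int[mu]_(x in E `&` B) f x = 0)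
    measurable_oboxes).
  - by move=> _ _ [p _ <-] [q _ <-]; rewrite setI_obox; eexists (_, _).
  - by rewrite setTI; exact: integral_obox_eq0.
  - by move=> _ [p _ <-].
  - move=> S mS HS.
    have : \int[mu]_(x in (S `&` B) `|` (~` S `&` B)) f x = 0.
      by rewrite -setIUl setUv setTI; exact: integral_obox_eq0.
    have mSC := measurableC mS.
    rewrite Rintegral_setU ?HS ?add0r//.
    + exact: measurableI.
    + exact: measurableI.
    + by rewrite -setIUl setUv setTI.
    + by apply/disj_setPS => x [[Sx _] [nSx _]].
  - move=> F mF tF HF.
    rewrite setI_bigcupl /Rintegral integral_bigcup//.
    + rewrite eseries0// => k _ _.
      have := HF k; rewrite /Rintegral => H0.
      rewrite -[LHS]fineK ?H0//; apply: integrable_fin_num; first exact: measurableI.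
      by apply: integrableS iB => //; exact: measurableI.
    + apply/trivIsetP => i j _ _ ij.
      by rewrite setIACA setIid; move/trivIsetP : tF => /(_ i j I I ij) ->; rewrite set0I.
    + by move=> k; exact: measurableI.
    + apply: integrableS iB => //; first by apply: bigcup_measurable => k _; exact: measurableI.
      by move=> x [k _ []].
  - by rewrite -measurable_oboxes.
have : ae_eq mu B (EFin \o f) (cst 0%E).
  apply: integral_ae_eq => // E EB mE.
  have := all_ E mE; rewrite setIidl// /Rintegral => H0.
  rewrite integral0 -[LHS]fineK ?H0//; apply: integrable_fin_num => //.
  exact: integrableS iB.
by apply: filterS => x /= + Bx => /(_ Bx) [].
Qed.

(** Testing with [box_bump] and letting [n] grow, [f] has integral [0] over every
    box whose closure lies in [Omega], then over every Borel subset of such a box. *)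
Lemma ae_eq0_test : {ae mu, forall x, Omega x -> f x = 0}.
Proof.
have [I [F [FO OE]]] := open_boxP oO.
have H : forall k, {ae mu, forall x, I k -> obox (F k).1 (F k).2 x -> f x = 0}.
  move=> k; have [Ik|nIk] := pselect (I k); last by apply: aeW.
  by apply: filterS (ae_obox_eq0 (FO k Ik)) => x.
have := ae_foralln H.
by apply: filterS => x Hx; rewrite OE => -[k Ik] /(Hx k Ik).
Qed.

End fundamental_lemma.

(** * The spaces L_oo and L_2 on a measurable set *)

Section ereal_cvg0.
Context {R : realType}.

Lemma ge0_cvge0P {T : Type} (F : set_system T) {FF : Filter F} (u : T -> \bar R) :
  (forall x, 0 <= u x)%E ->
  u x @[x --> F] --> 0%E <-> forall e : R, 0 < e -> \forall x \near F, (u x < e%:E)%E.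
Proof.
move=> u0; split=> [H e e0|H].
  have : nbhs (0%E : \bar R) [set y | (y < e%:E)%E].
    apply: open_nbhs_nbhs; split; last by rewrite /= lte_fin.
    exact: (@open_ereal_lt_ereal R e%:E).
  by move/H.
apply/fine_cvgP; split.
  by apply: filterS (H 1 ltr01) => x h; rewrite ge0_fin_numE// (lt_trans h)// ltry.
apply/cvgrPdist_lt => e e0; apply: filterS (H _ e0) => x h /=.
have fx : u x \is a fin_num by rewrite ge0_fin_numE// (lt_trans h)// ltry.
by rewrite sub0r normrN ger0_norm ?fine_ge0// -lte_fin fineK.
Qed.

End ereal_cvg0.

Section Lp_on.
Context {d : measure_display} {T : measurableType d} {R : realType}.
Variables (mu : {measure set T -> \bar R}) (D : set T).
Hypothesis mD : measurable D.
Implicit Types f g : T -> R.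

Lemma Loo_norm_ae f :
  {ae mu, forall x, D x -> ((`|f x|)%:E <= Lp_norm_on mu +oo D f)%E}.
Proof.
rewrite /Lp_norm_on unlock; case: ifPn => [_|].
  apply: filterS (ess_sup_ge mu (abse \o (EFin \o f \_ D))) => x + Dx.
  by rewrite /= patchE mem_set.
rewrite -leNgt => mu0; exists setT; split=> //.
by apply/eqP; rewrite eq_le mu0 measure_ge0.
Qed.

Lemma Loo_norm_ge0 f : (0 <= Lp_norm_on mu +oo D f)%E.
Proof. exact: Lnorm_ge0. Qed.

Lemma Loo_norm_le f (M : R) : 0 <= M -> {ae mu, forall x, D x -> `|f x| <= M} ->
  (Lp_norm_on mu +oo D f <= M%:E)%E.
Proof.
move=> M0 H; rewrite /Lp_norm_on unlock; case: ifPn => [_|_]; last by rewrite lee_fin.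
apply/ess_supP; apply: filterS H => x H /=.
rewrite patchE; case: ifPn => [/set_mem/H|_]; first by rewrite lee_fin.
by rewrite normr0 lee_fin.
Qed.

Lemma Lp_on_measurable p f : Lp_on mu p D f -> measurable_fun D f.
Proof.
rewrite /Lp_on inE => /andP[]; rewrite inE/= => mf _.
have := (measurable_restrict f mD measurableT).2.
rewrite setTI; apply; exact: mf.
Qed.

Lemma Loo_onP f : Lp_on mu +oo D f <->
  measurable_fun D f /\ exists M, {ae mu, forall x, D x -> `|f x| <= M}.
Proof.
split.
  move=> /[dup] /Lp_on_measurable mf; rewrite /Lp_on inE => /andP[_]; rewrite inE/= => H.
  split=> //; exists (fine (Lp_norm_on mu +oo D f)).
  apply: filterS (Loo_norm_ae f) => x + Dx => /(_ Dx).
  rewrite -lee_fin fineK// ge0_fin_numE//; exact: Loo_norm_ge0.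
move=> [mf [M HM]]; rewrite /Lp_on inE; apply/andP; split; rewrite inE/=.
  apply/(measurable_restrict f mD measurableT); by rewrite setTI.
apply: (@le_lt_trans _ _ (`|M|)%:E); last by rewrite ltry.
apply: Loo_norm_le => //; apply: filterS HM => x + Dx => /(_ Dx) /le_trans; apply.
exact: ler_norm.
Qed.

(** The functions of [Lp_on 2] (see [L2P]), through the real integral of the
    square, in which estimates are written. *)
Definition L2 f := measurable_fun D f /\ mu.-integrable D (EFin \o (fun x => f x ^+ 2)).

Lemma L2_norm2E f : measurable_fun D f ->
  (Lp_norm_on mu 2%:E D f = (\int[mu]_(x in D) ((f x ^+ 2)%:E)) `^ 2^-1)%E.
Proof.
move=> mf; rewrite /Lp_norm_on unlock; congr (_ `^ _)%E.
rewrite [RHS]integral_mkcond; apply: eq_integral => x _.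
rewrite /= !patchE; case: ifPn => _ /=; last by rewrite normr0 powR0.
by rewrite powR_mulrn// real_normK// num_real.
Qed.

Lemma L2P f : Lp_on mu 2%:E D f <-> L2 f.
Proof.
split.
  move=> /[dup] /Lp_on_measurable mf; rewrite /Lp_on inE => /andP[_]; rewrite inE/= /finite_norm.
  rewrite -[X in (X < _)%E]/(Lp_norm_on mu 2%:E D f) L2_norm2E// => H; split=> //.
  apply/integrableP; split; first by apply/measurable_EFinP; exact: measurable_funX.
  rewrite /= (eq_integral (fun x => (f x ^+ 2)%:E)).
    by apply: (@lty_poweRy _ _ 2^-1) H; rewrite invr_neq0.
  by move=> x _; rewrite ger0_norm ?sqr_ge0.
move=> [mf fi]; rewrite /Lp_on inE; apply/andP; split; rewrite inE/=.
  apply/(measurable_restrict f mD measurableT); by rewrite setTI.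
rewrite /finite_norm -[X in (X < _)%E]/(Lp_norm_on mu 2%:E D f) L2_norm2E//.
rewrite poweR_lty//; exact: integrable_lty.
Qed.

Lemma L2_measurable f : L2 f -> measurable_fun D f. Proof. by case. Qed.

Lemma L2_mul f g : L2 f -> L2 g -> mu.-integrable D (EFin \o (fun x => f x * g x)).
Proof.
move=> [mf fi] [mg gi].
apply: (integrable_le mD (g := fun x => f x ^+ 2 + g x ^+ 2)).
- exact: measurable_funM.
- exact: (integrableD mD fi gi).
- by apply: aeW => x _; rewrite ler_norml; apply/andP; split; nra.
Qed.

Lemma L2_sub f g : L2 f -> L2 g -> L2 (fun x => f x - g x).
Proof.
move=> [mf fi] [mg gi]; split; first exact: measurable_funB.
apply: (integrable_le mD (g := fun x => (f x ^+ 2 + g x ^+ 2) + (f x ^+ 2 + g x ^+ 2))).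
- by apply: measurable_funX; exact: measurable_funB.
- by apply: (Rintegrable_add mD); exact: (Rintegrable_add mD fi gi).
- apply: aeW => x _; rewrite ger0_norm ?sqr_ge0// -subr_ge0.
  by rewrite [leRHS](_ : _ = (f x + g x) ^+ 2) ?sqr_ge0//; ring.
Qed.

Lemma L2_bounded_mul f g : L2 f -> measurable_fun D g ->
  (exists M, {ae mu, forall x, D x -> `|g x| <= M}) -> L2 (fun x => g x * f x).
Proof.
move=> [mf fi] mg [M HM]; split; first exact: measurable_funM.
apply: (integrable_le mD (g := fun x => M ^+ 2 * (f x ^+ 2))).
- by apply: measurable_funX; exact: measurable_funM.
- exact: (integrableZl mD _ fi).
- apply: filterS HM => x + Dx => /(_ Dx) H.
  by rewrite ger0_norm ?sqr_ge0// exprMn ler_wpM2r ?sqr_ge0// -(real_normK (num_real (g x))) lerXn2r// ?nnegrE// (le_trans _ H).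
Qed.

Lemma L2_add f g : L2 f -> L2 g -> L2 (fun x => f x + g x).
Proof.
move=> [mf fi] [mg gi]; split; first exact: measurable_funD.
apply: (integrable_le mD (g := fun x => (f x ^+ 2 + g x ^+ 2) + (f x ^+ 2 + g x ^+ 2))).
- by apply: measurable_funX; exact: measurable_funD.
- by apply: (Rintegrable_add mD); exact: (Rintegrable_add mD fi gi).
- apply: aeW => x _; rewrite ger0_norm ?sqr_ge0// -subr_ge0.
  by rewrite [leRHS](_ : _ = (f x - g x) ^+ 2) ?sqr_ge0//; ring.
Qed.

Definition sqnorm f := \int[mu]_(x in D) (f x ^+ 2).

Lemma sqnorm_ge0 f : 0 <= sqnorm f.
Proof. by apply: Rintegral_ge0 => x _; exact: sqr_ge0. Qed.

Lemma L2_cvgP (fn : nat -> T -> R) : (forall n, L2 (fn n)) ->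
  Lp_norm_on mu 2%:E D (fn n) @[n --> \oo] --> 0%E <->
  sqnorm (fn n) @[n --> \oo] --> 0.
Proof.
move=> Lf.
have E n : Lp_norm_on mu 2%:E D (fn n) = ((sqnorm (fn n)) `^ 2^-1)%:E.
  rewrite L2_norm2E; last by have [] := Lf n.
  rewrite -poweR_EFin; congr (_ `^ _)%E; rewrite /sqnorm /Rintegral fineK//.
  by apply: integrable_fin_num => //; have [] := Lf n.
under eq_cvg do rewrite E.
rewrite ge0_cvge0P; last by move=> n; rewrite lee_fin powR_ge0.
split=> [H|/cvgrPdist_lt H e e0].
  apply/cvgrPdist_lt => e e0; have e'0 : 0 < e `^ 2^-1 by rewrite powR_gt0.
  apply: filterS (H _ e'0) => n; rewrite lte_fin sub0r normrN ger0_norm ?sqnorm_ge0//.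
  rewrite !ltNge; apply: contra => h.
  by apply: ge0_ler_powR => //; rewrite ?nnegrE ?sqnorm_ge0// ltW.
have e'0 : 0 < e ^+ 2 by rewrite exprn_gt0.
apply: filterS (H _ e'0) => n; rewrite lte_fin sub0r normrN ger0_norm ?sqnorm_ge0// => h.
have -> : e = (e ^+ 2) `^ 2^-1.
  by rewrite -powR_mulrn ?ltW// -powRrM mulfV ?pnatr_eq0// powRr1// ltW.
by apply: gt0_ltr_powR => //; rewrite ?nnegrE ?sqnorm_ge0// ltW.
Qed.

(** Young's inequality [|f k| <= del/2 f^2 + k^2/(2 del)] for [k = gn n - g], with a
    small [del]. *)
Lemma L2_cvg_mul f (gn : nat -> T -> R) g : L2 f -> (forall n, L2 (gn n)) -> L2 g ->
  sqnorm (fun x => gn n x - g x) @[n --> \oo] --> 0 ->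
  \int[mu]_(x in D) (f x * gn n x) @[n --> \oo] --> \int[mu]_(x in D) (f x * g x).
Proof.
move=> Lf Lgn Lg /cvgrPdist_lt H; apply/cvgrPdist_le => e e0.
pose A := sqnorm f + 1; have A0 : 0 < A by rewrite ltr_wpDl ?sqnorm_ge0.
pose del := e / A; have del0 : 0 < del by rewrite divr_gt0.
have e'0 : 0 < e * del by rewrite mulr_gt0.
apply: filterS (H _ e'0) => n; rewrite sub0r normrN ger0_norm ?sqnorm_ge0// => h.
have Ln := L2_sub Lg (Lgn n).
rewrite -RintegralB//; [|exact: L2_mul..].
have -> : \int[mu]_(x in D) (f x * g x - f x * gn n x) = \int[mu]_(x in D) (f x * (g x - gn n x)).
  by apply: eq_Rintegral => x _; rewrite mulrBr.
have i1 : mu.-integrable D (EFin \o (fun x => del / 2 * (f x ^+ 2))).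
  by apply: (Rintegrable_scale mD); case: Lf.
have i2 : mu.-integrable D (EFin \o (fun x => (2 * del)^-1 * ((gn n x - g x) ^+ 2))).
  by apply: (Rintegrable_scale mD); have [] := L2_sub (Lgn n) Lg.
apply: (@le_trans _ _ (\int[mu]_(x in D) (del / 2 * (f x ^+ 2) + (2 * del)^-1 * ((gn n x - g x) ^+ 2)))).
  apply: (le_norm_Rintegral mD) => //; first exact: L2_mul.
    exact: (Rintegrable_add mD i1 i2).
  apply: aeW => x _; rewrite -subr_ge0.
  have -> : del / 2 * f x ^+ 2 + (2 * del)^-1 * (gn n x - g x) ^+ 2 - `|f x * (g x - gn n x)| =
     (del * `|f x| - `|g x - gn n x|) ^+ 2 / (2 * del).
    rewrite normrM -(real_normK (num_real (f x))) -(real_normK (num_real (gn n x - g x))).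
    by rewrite (distrC (gn n x)); field; rewrite gt_eqF.
  by rewrite divr_ge0 ?sqr_ge0// mulr_ge0// ltW.
have j1 : mu.-integrable D (EFin \o (fun x => f x ^+ 2)) by case: Lf.
have j2 : mu.-integrable D (EFin \o (fun x => (gn n x - g x) ^+ 2)) by have [] := L2_sub (Lgn n) Lg.
rewrite RintegralD// !RintegralZl//.
rewrite -/(sqnorm f) -/(sqnorm (fun x => gn n x - g x)).
have h1 : del / 2 * sqnorm f <= e / 2.
  rewrite (_ : del / 2 * sqnorm f = e / 2 * (sqnorm f / A)).
    rewrite ler_piMr ?divr_ge0 ?(ltW e0)//.
    by rewrite ler_pdivrMr// mul1r lerDl.
  by rewrite /del; field; rewrite gt_eqF.
have h2 : (2 * del)^-1 * sqnorm (fun x => gn n x - g x) <= e / 2.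
  have d2 : 0 < 2 * del by rewrite mulr_gt0.
  rewrite (ler_pdivrMl _ _ d2); apply: (le_trans (ltW h)).
  by rewrite [leRHS](_ : _ = e * del)//; field.
lra.
Qed.

(** Where [|h|] is at most a level [K] the factor [bn n] is controlled by [an n];
    where it is larger, the bound [c1] on [bn n] and the smallness of the tail of
    [h] in [L_2] are used. *)
Lemma L2_cvg_dominated (an bn : nat -> T -> R) h (c1 c2 : R) : 0 <= c2 ->
  (forall n, L2 (an n)) -> (forall n, measurable_fun D (bn n)) -> L2 h ->
  (forall n x, D x -> `|bn n x| <= c1) ->
  (forall n x, D x -> `|bn n x| <= c2 * `|an n x|) ->
  sqnorm (an n) @[n --> \oo] --> 0 ->
  sqnorm (fun x => bn n x * h x) @[n --> \oo] --> 0.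
Proof.
move=> c20 La mb Lh b1 b2 a0.
pose hK (K : nat) x := if K%:R < `|h x| then h x else 0.
have mh := L2_measurable Lh.
have mhK K : measurable_fun D (hK K).
  apply: measurable_fun_if => //; last by apply: measurable_funS mh => // x [].
  by apply: measurable_fun_ltr => //; exact: measurableT_comp.
have LhK K : L2 (hK K).
  split=> //; apply: (integrable_le mD (g := fun x => h x ^+ 2)); last 2 first.
  - by case: Lh.
  - apply: aeW => x _; rewrite ger0_norm ?sqr_ge0// /hK; case: ifP => // _.
    by rewrite expr0n sqr_ge0.
  - exact: measurable_funX.
have hK0 : sqnorm (hK K) @[K --> \oo] --> 0.
  have -> : 0 = \int[mu]_(x in D) (0 : R) by rewrite Rintegral_cst// mul0r.
  apply: (Rintegral_dominated mD (g := fun x => h x ^+ 2)) => //.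
  - by move=> n; exact: measurable_funX.
  - apply: aeW => x _; apply: cvg_near_cst; near=> K.
    rewrite /hK ltNge; have -> /= : `|h x| <= K%:R by near: K; exact: nbhs_infty_ger.
    by rewrite expr0n.
  - by case: Lh.
  - apply: aeW => x n _; rewrite ger0_norm ?sqr_ge0// /hK; case: ifP => // _.
    by rewrite expr0n sqr_ge0.
have bound n K : sqnorm (fun x => bn n x * h x) <=
    (c2 * K%:R) ^+ 2 * sqnorm (an n) + c1 ^+ 2 * sqnorm (hK K).
  rewrite /sqnorm -!RintegralZl//; [|by case: (LhK K)|by case: (La n)].
  have i1 : mu.-integrable D (EFin \o (fun x => (c2 * K%:R) ^+ 2 * an n x ^+ 2)).
    by apply: (Rintegrable_scale mD); case: (La n).
  have i2 : mu.-integrable D (EFin \o (fun x => c1 ^+ 2 * hK K x ^+ 2)).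
    by apply: (Rintegrable_scale mD); case: (LhK K).
  rewrite -RintegralD//; apply: (ae_le_Rintegral mD).
  - have [] // := @L2_bounded_mul h (bn n) Lh (mb n).
    by exists c1; apply: aeW => x; exact: b1.
  - exact: (Rintegrable_add mD i1 i2).
  - apply: aeW => x Dx; have B1 := b1 n x Dx; have B2 := b2 n x Dx.
    rewrite exprMn -(real_normK (num_real (bn n x))) -(real_normK (num_real (an n x))).
    rewrite /hK; case: ltP => hKx.
      apply: (@le_trans _ _ (c1 ^+ 2 * h x ^+ 2)); last by rewrite lerDr mulr_ge0 ?sqr_ge0.
      rewrite ler_wpM2r ?sqr_ge0//.
      by rewrite lerXn2r// nnegrE// (le_trans _ B1).
    rewrite -(real_normK (num_real (h x))) expr0n/= mulr0 addr0 -!exprMn lerXn2r// ?nnegrE ?mulr_ge0//.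
    by rewrite mulrAC ler_pM.
apply/cvgrPdist_lt => e e0.
have c0 : 0 < c1 ^+ 2 + 1 by rewrite ltr_wpDl// sqr_ge0.
have /cvgrPdist_lt /(_ (e / 2 / (c1 ^+ 2 + 1))) [|K _ /(_ K (leqnn K))] := hK0.
  by rewrite !divr_gt0.
rewrite sub0r normrN ger0_norm ?sqnorm_ge0// => hKe.
have c0' : 0 < (c2 * K%:R) ^+ 2 + 1 by rewrite ltr_wpDl// sqr_ge0.
have /cvgrPdist_lt /(_ (e / 2 / ((c2 * K%:R) ^+ 2 + 1))) := a0.
rewrite !divr_gt0// => /(_ isT); apply: filterS => n.
rewrite sub0r normrN ger0_norm ?sqnorm_ge0// => ane.
rewrite sub0r normrN ger0_norm ?sqnorm_ge0//.
apply: le_lt_trans (bound n K) _.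
move: hKe ane; rewrite !ltr_pdivlMr// => hKe ane.
have s1 := sqnorm_ge0 (hK K); have s2 := sqnorm_ge0 (an n).
rewrite [ltRHS](splitr e).
by apply: ltr_leD; [nra|nra].
Unshelve. all: by end_near. Qed.

End Lp_on.

(** * Truncations of Sobolev functions *)

Section cutoff.
Context {R : realType}.
Notation smoothR := (@smooth R R unit (fun=> 1)).

Lemma derive_bounded_lipschitz (K dK : R -> R) C : (forall x : R, is_derive x 1 K (dK x)) ->
  (forall x, `|dK x| <= C) -> forall x y, `|K x - K y| <= C * `|x - y|.
Proof.
move=> KdK dKC x y.
wlog xy : x y / x <= y.
  move=> H; have [xy|/ltW yx] := leP x y; first exact: H.
  by rewrite distrC (distrC x); exact: H.
have cK : {within `[x, y], continuous K}.
  apply: derivable_within_continuous => z _; exact: (KdK z).(ex_derive).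
have [c _ E] := MVT_segment xy (fun z _ => KdK z) cK.
by rewrite distrC E normrM (distrC x) ler_wpM2r.
Qed.

(** What makes composition with [K] continuous on [H^1]: smoothness sends test
    functions to test functions, the bound on [K'] and its Lipschitz continuity
    give the convergence of [K o phi_k] and of its gradient. *)
Definition tame (K K' : R -> R) : Prop :=
  [/\ smoothR K, derive1 K = K', exists C, forall s, `|K' s| <= C &
      exists C, forall s t, `|K' s - K' t| <= C * `|s - t|].

Lemma tame_lipschitz K K' : tame K K' -> exists2 C, 0 <= C & forall s t, `|K s - K t| <= C * `|s - t|.
Proof.
move=> [sK E [C HC] _]; exists C; first exact: le_trans (HC 0).
apply: (@derive_bounded_lipschitz _ K') => // x.
rewrite -E derive1E; apply: derivableP; apply/derivable1_diffP; exact: smooth_diff.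
Qed.

Variable kappa : R.

Definition flats n (s : R) := flatn n (s - kappa).

Lemma is_derive_flats n (s : R) : is_derive s 1 (flats n) (flats n.+2 s - n%:R * flats n.+1 s).
Proof.
rewrite /flats.
have DS : is_derive s 1 (fun s : R => s - kappa) 1.
  by have := is_deriveB (is_derive_id s (1 : R)) (is_derive_cst kappa s (1 : R)); rewrite subr0.
have := @is_derive1_comp _ (flatn n) (fun s => s - kappa) s _ _ (is_derive_flatn n _) DS.
by rewrite mulr1.
Qed.

Lemma flats_norm n s : `|flats n s| <= n`!%:R.
Proof. by rewrite ger0_norm ?flatn_ge0// flatn_le. Qed.

Lemma mul_flats n s : s * flats n.+1 s = flats n s + kappa * flats n.+1 s.
Proof.
rewrite /flats /flatn; case: ifPn => s0; last by rewrite !mulr0 addr0.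
by rewrite exprS; field; rewrite gt_eqF.
Qed.

Lemma smooth_flats n : smoothR (flats n).
Proof.
apply: (@smooth_comp R R unit (fun=> 1) (flatn n) (fun s => s - kappa)); first exact: smooth_flatn.
apply: (@smoothD _ _ _ _ id (fun=> - kappa)); [exact: smoothR_id|exact: smooth_cst].
Qed.

(** With [f(y) = exp(-1/y)], [cutH] is [f(s - kappa)] and [cutG] is [s f(s - kappa)];
    primes denote derivatives.  The factor [s] makes [cutG(u^+)] the product
    [u^+ cutH(u^+)], to which [product_weak_partial] applies. *)
Definition cutH := flats 0.
Definition cutH' := flats 2.
Definition cutG (s : R) := s * cutH s.
Definition cutG' (s : R) := cutH s + s * cutH' s.

Lemma tame_cutH : tame cutH cutH'.
Proof.
split; first exact: smooth_flats.
- apply/funext => s; rewrite derive1E (is_derive_flats 0 s).(derive_val).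
  by rewrite mul0r subr0.
- by exists 2 => s; exact: (flats_norm 2).
- exists (4`!%:R + 2 * 3`!%:R).
  apply: (derive_bounded_lipschitz (is_derive_flats 2)) => s.
  rewrite (le_trans (ler_normB _ _))// lerD ?flats_norm// normrM ger0_norm//.
  by rewrite ler_pM2l// flats_norm.
Qed.

(** The factor [s] is unbounded, but [s f^(k)(s - kappa)] is not: one power of
    [s - kappa] is absorbed by the exponential ([mul_flats]). *)
Lemma tame_cutG : tame cutG cutG'.
Proof.
have dG (s : R) : is_derive s 1 cutG (cutG' s).
  have h := (is_derive_flats 0 s).
  rewrite (_ : cutG = (id : R -> R) * flats 0)//.
  apply: (is_derive_eq (is_deriveM (is_derive_id s 1) h)).
  by rewrite mul0r subr0 /GRing.scale/= mulr1 addrC.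
have dG' (s : R) : is_derive s 1 cutG'
    (flats 2 s + (flats 2 s + s * (flats 4 s - 2 * flats 3 s))).
  have h2 := (is_derive_flats 2 s).
  have h0 := (is_derive_flats 0 s).
  rewrite (_ : cutG' = flats 0 + (id : R -> R) * flats 2)//.
  apply: (is_derive_eq (is_deriveD h0 (is_deriveM (is_derive_id s 1) h2))).
  by rewrite mul0r subr0 /GRing.scale/= mulr1 [in RHS](addrC _ (s * _)).
split.
- apply: (@smoothM _ _ _ _ id cutH); [exact: smoothR_id|exact: smooth_flats].
- by apply/funext => s; rewrite derive1E (dG s).(derive_val).
- exists (0`!%:R + (1`!%:R + `|kappa| * 2`!%:R)) => s; rewrite /cutG' /cutH' mul_flats.
  rewrite (le_trans (ler_normD _ _))// lerD ?flats_norm//.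
  rewrite (le_trans (ler_normD _ _))// lerD ?flats_norm//.
  by rewrite normrM ler_wpM2l ?flats_norm.
- exists (2`!%:R + (2`!%:R + ((3`!%:R + `|kappa| * 4`!%:R) + 2 * (2`!%:R + `|kappa| * 3`!%:R)))).
  apply: (derive_bounded_lipschitz dG') => s.
  rewrite mulrBr mulrCA !mul_flats.
  do 2 (rewrite (le_trans (ler_normD _ _))// lerD ?flats_norm//).
  rewrite (le_trans (ler_normB _ _))// lerD//.
    by rewrite (le_trans (ler_normD _ _))// lerD ?flats_norm// normrM ler_wpM2l ?flats_norm.
  rewrite normrM ger0_norm// ler_pM2l//.
  by rewrite (le_trans (ler_normD _ _))// lerD ?flats_norm// normrM ler_wpM2l ?flats_norm.
Qed.

Lemma cutH_ge0 s : 0 <= cutH s. Proof. exact: flatn_ge0. Qed.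
Lemma cutH'_ge0 s : 0 <= cutH' s. Proof. exact: flatn_ge0. Qed.

Lemma cutH_eq0 s : s <= kappa -> cutH s = 0.
Proof. by move=> h; apply: flat_le0; rewrite subr_le0. Qed.

Lemma cutH'_eq0 s : s <= kappa -> cutH' s = 0.
Proof. by move=> h; apply: flat_le0; rewrite subr_le0. Qed.

Lemma cutH_gt0 s : kappa < s -> 0 < cutH s.
Proof. by move=> h; apply: flat_gt0; rewrite subr_gt0. Qed.

(** The logarithmic derivative of [exp(-1/y)] is [y^(-2)]: just above [kappa],
    [cutH] is much smaller than its derivative. *)
Lemma cutHE s : cutH s = (s - kappa) ^+ 2 * cutH' s.
Proof.
rewrite /cutH /cutH' /flats /flatn; case: ifPn => h; last by rewrite mulr0.
by rewrite expr0; field; rewrite gt_eqF.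
Qed.

End cutoff.

Section sobolev_chain.
Context {R : realType} {d : nat}.
Local Notation mu := (lebesgue_rV R d).
Variable Omega : set 'rV[R]_d.
Hypothesis oO : open Omega.
Hypothesis fO : (mu Omega < +oo)%E.
Let mO : measurable Omega. Proof. exact: open_measurable_rV. Qed.
Notation L2 := (L2 mu Omega).
Notation sqnorm := (sqnorm mu Omega).
Notation smooth_rV := (smooth (fun i : 'I_d => 'e_i : 'rV[R]_d)).
Implicit Types (phi psi f v q p : 'rV[R]_d -> R).

Lemma bounded_L2 f : measurable_fun Omega f ->
  (exists M, {ae mu, forall x, Omega x -> `|f x| <= M}) -> L2 f.
Proof.
move=> mf [M HM]; split=> //.
apply: (integrable_le mO (g := fun=> M ^+ 2)).
- exact: measurable_funX.
- by apply: measurable_bounded_integrable => //; exists `|M ^+ 2|; split=> // y /ltW h z _ /=.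
- apply: filterS HM => x + Ox => /(_ Ox) H.
  rewrite ger0_norm ?sqr_ge0// -(real_normK (num_real (f x))) lerXn2r// ?nnegrE//.
  exact: le_trans H.
Qed.

Lemma L2_integrable f : L2 f -> mu.-integrable Omega (EFin \o f).
Proof.
move=> Lf; have L1 : L2 (fun=> 1).
  by apply: bounded_L2 => //; exists 1; apply: aeW => x _; rewrite normr1.
by have := L2_mul mO Lf L1; under eq_fun do rewrite mulr1.
Qed.

Lemma L2_le f (g : 'rV[R]_d -> R) (c : R) : measurable_fun Omega g -> L2 f ->
  (forall x, Omega x -> `|g x| <= c * `|f x|) -> L2 g.
Proof.
move=> mg [mf fi] H; split=> //.
apply: (integrable_le mO (g := fun x => c ^+ 2 * f x ^+ 2)).
- exact: measurable_funX.
- exact: (Rintegrable_scale mO).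
- apply: aeW => x Ox; rewrite ger0_norm ?sqr_ge0// -(real_normK (num_real (g x))) -(real_normK (num_real (f x))) -exprMn.
  by rewrite lerXn2r// ?nnegrE// ?(le_trans _ (H x Ox))// H.
Qed.

Lemma ae_eq_sqnorm f g : measurable_fun Omega f -> measurable_fun Omega g ->
  {ae mu, forall x, Omega x -> f x = g x} -> sqnorm f = sqnorm g.
Proof.
move=> mf mg fg; apply: (ae_eq_Rintegral mO) => //; try exact: measurable_funX.
by apply: filterS fg => x + Ox => /(_ Ox) ->.
Qed.

Lemma test_function_bounded phi : test_function Omega phi ->
  exists M, forall x, `|phi x| <= M.
Proof.
move=> tphi; have cphi := test_function_continuous tphi.
have [[cK KO] _] := tphi; set K := closure _ in cK.
have cfK : {within K, continuous phi} by exact: continuous_subspaceT.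
have /compact_bounded [M [_ HM]] := continuous_compact cfK cK.
exists (`|M + 1|) => x.
have [->|px] := eqVneq (phi x) 0; first by rewrite normr0.
apply: le_trans (ler_norm _); apply: (HM (M + 1)); first by rewrite ltrDl.
by exists x => //; exact: subset_closure.
Qed.

Lemma test_function_derive phi i : test_function Omega phi ->
  test_function Omega ('D_('e_i) phi).
Proof.
move=> tphi; have [[cK KO] sphi] := (test_function_smooth _ _).1 tphi.
apply/test_function_smooth; split; last exact: smooth_derive.
apply: (compactly_supported_sub cK KO) => x; apply: contraNP => nKx.
have : nbhs x (~` closure [set x | phi x != 0]).
  by apply: open_nbhs_nbhs; split=> //; exact/closed_openC/closed_closure.
move=> H; apply/eqP; rewrite -[RHS](@derive_cst R _ R 0 x 'e_i).
apply: near_eq_derive; apply: filterS H => y /= Hy.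
by apply/eqP/negPn/negP => py; apply: Hy; exact: subset_closure.
Qed.

Lemma test_function_measurable phi : test_function Omega phi -> measurable_fun Omega phi.
Proof.
move=> /test_function_continuous/measurable_fun_continuous_rV.
exact: measurable_funS.
Qed.

Lemma test_function_L2 phi : test_function Omega phi -> L2 phi.
Proof.
move=> tphi; apply: bounded_L2; first exact: test_function_measurable.
by have [M HM] := test_function_bounded tphi; exists M; exact: aeW.
Qed.

Lemma L2_test_mul phi f : test_function Omega phi -> L2 f -> L2 (fun x => phi x * f x).
Proof.
move=> tphi Lf; apply: (L2_bounded_mul mO) => //; first exact: test_function_measurable.
by have [M HM] := test_function_bounded tphi; exists M; exact: aeW.
Qed.

Lemma test_function_mul (K : 'rV[R]_d -> R) psi : smooth_rV K -> test_function Omega psi ->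
  test_function Omega (K \* psi).
Proof.
move=> sK /test_function_smooth[[cK KO] spsi]; apply/test_function_smooth; split.
  apply: (compactly_supported_sub cK KO) => x /= h; apply: subset_closure => /=.
  by apply: contra h => /eqP ->; rewrite mulr0.
exact: smoothM.
Qed.

Lemma test_function_comp (K : R -> R) psi : smooth (fun _ : unit => 1 : R) K -> K 0 = 0 ->
  test_function Omega psi -> test_function Omega (K \o psi).
Proof.
move=> sK K0 /test_function_smooth[[cK KO] spsi]; apply/test_function_smooth; split.
  apply: (compactly_supported_sub cK KO) => x /= h; apply: subset_closure => /=.
  by apply: contra h => /eqP ->; rewrite K0.
exact: smooth_comp.
Qed.

Lemma is_weak_partial_unique i f p q : is_weak_partial Omega i f p ->
  is_weak_partial Omega i f q -> {ae mu, forall x, Omega x -> p x = q x}.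
Proof.
move=> [/(L2P _ mO _) Lp Hp] [/(L2P _ mO _) Lq Hq].
have H : {ae mu, forall x, Omega x -> p x - q x = 0}.
  apply: (ae_eq0_test oO (f := fun x => p x - q x)).
    exact: L2_integrable (L2_sub mO Lp Lq).
  move=> phi tphi; under eq_Rintegral do rewrite mulrBl.
  have Lphi := test_function_L2 tphi.
  rewrite RintegralB//; [|exact: L2_mul..].
  by apply/eqP; rewrite subr_eq0 -eqr_opp -Hp// -Hq.
by apply: filterS H => x + Ox => /(_ Ox)/eqP; rewrite subr_eq0 => /eqP.
Qed.

Lemma weak_partialP i f : H1 Omega f -> is_weak_partial Omega i f (weak_partial Omega i f).
Proof. by move=> [_ /(_ i) H]; exact: xgetPex. Qed.

Lemma continuous_comp_measurable (K : R -> R) f : continuous K -> measurable_fun Omega f ->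
  measurable_fun Omega (fun x => K (f x)).
Proof. by move=> cK mf; apply: (@measurableT_comp _ _ _ _ _ _ K _ f) => //; exact: continuous_measurable_fun. Qed.

Section approximation.
Variables (phi : nat -> 'rV[R]_d -> R) (f : 'rV[R]_d -> R) (p : 'I_d -> 'rV[R]_d -> R).
Hypothesis tphi : forall k, test_function Omega (phi k).
Hypothesis Lf : L2 f.
Hypothesis Lp : forall i, L2 (p i).
Hypothesis phif : sqnorm (fun x => phi k x - f x) @[k --> \oo] --> 0.
Hypothesis dphip : forall i, sqnorm (fun x => 'D_('e_i) (phi k) x - p i x) @[k --> \oo] --> 0.
Variables (K K' : R -> R).
Hypothesis nK : tame K K'.
Hypothesis K0 : K 0 = 0.

Let sK : smooth (fun _ : unit => 1 : R) K. Proof. by case: nK. Qed.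
Let cK : continuous K. Proof. exact: smooth_continuous sK. Qed.
Let cK' : continuous K'.
Proof. by case: nK => _ <- _ _; apply: smooth_continuous; exact: smoothR_derive1. Qed.
Let Lphi k : L2 (phi k). Proof. exact: test_function_L2. Qed.
Let Ldphi k i : L2 ('D_('e_i) (phi k)).
Proof. by apply: test_function_L2; exact: test_function_derive. Qed.

Lemma L2_comp v : L2 v -> L2 (fun x => K (v x)).
Proof.
move=> Lv; have [C C0 HC] := tame_lipschitz nK.
apply: (L2_le (f := v) (c := C)) => //; first by apply: continuous_comp_measurable; case: Lv.
by move=> x _; have := HC (v x) 0; rewrite K0 !subr0.
Qed.

Lemma L2_comp' v w : measurable_fun Omega v -> L2 w -> L2 (fun x => K' (v x) * w x).
Proof.
move=> mv Lw; apply: (L2_bounded_mul mO) => //; first exact: continuous_comp_measurable.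
by case: nK => _ _ [C HC] _; exists C; apply: aeW => x _; exact: HC.
Qed.

Lemma comp_cvg : sqnorm (fun x => K (phi k x) - K (f x)) @[k --> \oo] --> 0.
Proof.
have [C C0 HC] := tame_lipschitz nK.
have H : (C ^+ 2 * sqnorm (fun x => phi k x - f x)) @[k --> \oo] --> 0.
  by rewrite -[X in _ --> X](mulr0 (C ^+ 2)); exact: cvgMr.
apply: (squeeze_cvgr _ (cvg_cst 0) H); apply: nearW => k.
rewrite sqnorm_ge0/= -RintegralZl//; last by have [] := L2_sub mO (Lphi k) Lf.
have [_ iK] := L2_sub mO (L2_comp (Lphi k)) (L2_comp Lf).
apply: (ae_le_Rintegral mO) => //.
  by apply: (Rintegrable_scale mO); have [] := L2_sub mO (Lphi k) Lf.
apply: aeW => x _.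
rewrite -(real_normK (num_real (K _ - _))) -[X in _ * X](real_normK (num_real _)) -exprMn.
by rewrite lerXn2r// ?nnegrE// mulr_ge0.
Qed.

Lemma derive_comp_phi k i x : 'D_('e_i) (K \o phi k) x = K' (phi k x) * 'D_('e_i) (phi k) x.
Proof.
rewrite derive_comp; last 2 first.
- by have [_ /smooth_diff] := (test_function_smooth _ _).1 (tphi k).
- exact: smooth_diff.
by case: nK => _ -> _ _.
Qed.

(** The error is split into [K'(phi_k) (d phi_k - p)] and [(K'(phi_k) - K'(f)) p];
    the second is handled by [L2_cvg_dominated]. *)
Lemma comp_derive_cvg i :
  sqnorm (fun x => 'D_('e_i) (K \o phi k) x - K' (f x) * p i x) @[k --> \oo] --> 0.
Proof.
have [_ _ [C HC] [C2 HC2]] := nK.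
have C0 : 0 <= C by exact: le_trans (HC 0).
have mf : measurable_fun Omega f by case: Lf.
pose A k := fun x => K' (phi k x) * ('D_('e_i) (phi k) x - p i x).
pose B k := fun x => (K' (phi k x) - K' (f x)) * p i x.
have LA k : L2 (A k).
  by apply: L2_comp'; [exact: test_function_measurable|exact: (L2_sub mO)].
have LB k : L2 (B k).
  have := L2_sub mO (L2_comp' (test_function_measurable (tphi k)) (Lp i)) (L2_comp' mf (Lp i)).
  by under eq_fun do rewrite -mulrBl.
have cA : sqnorm (A k) @[k --> \oo] --> 0.
  have H : (C ^+ 2 * sqnorm (fun x => 'D_('e_i) (phi k) x - p i x)) @[k --> \oo] --> 0.
    by rewrite -[X in _ --> X](mulr0 (C ^+ 2)); apply: cvgMr; exact: dphip.
  apply: (squeeze_cvgr _ (cvg_cst 0) H); apply: nearW => k.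
  have [_ iD] := L2_sub mO (Ldphi k i) (Lp i).
  rewrite sqnorm_ge0/= -RintegralZl//.
  apply: (ae_le_Rintegral mO) => //; first by case: (LA k).
    exact: (Rintegrable_scale mO).
  apply: aeW => x _; rewrite /A exprMn ler_wpM2r ?sqr_ge0//.
  rewrite -(real_normK (num_real (K' _))) lerXn2r// nnegrE//.
have cB : sqnorm (B k) @[k --> \oo] --> 0.
  apply: (@L2_cvg_dominated _ _ _ mu Omega mO (fun k x => phi k x - f x)
    (fun k x => K' (phi k x) - K' (f x)) (p i) (C + C) `|C2|) => //.
  - by move=> k; exact: (L2_sub mO).
  - move=> k; apply: measurable_funB; apply: continuous_comp_measurable => //.
    exact: test_function_measurable.
  - by move=> k x _; rewrite (le_trans (ler_normB _ _))// lerD.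
  - move=> k x _; apply: le_trans (HC2 _ _) _.
    by rewrite ler_wpM2r// ler_norm.
have H : (2 * sqnorm (A k) + 2 * sqnorm (B k)) @[k --> \oo] --> 0.
  rewrite -[X in _ --> X](addr0 0); apply: cvgD.
    by rewrite -[X in _ --> X](mulr0 2); exact: cvgMr.
  by rewrite -[X in _ --> X](mulr0 2); exact: cvgMr.
apply: (squeeze_cvgr _ (cvg_cst 0) H); apply: nearW => k.
have [_ iA] := LA k; have [_ iB] := LB k.
rewrite sqnorm_ge0/= -!RintegralZl// -RintegralD//; [|exact: (Rintegrable_scale mO)..].
apply: (ae_le_Rintegral mO) => //.
- have := L2_add mO (LA k) (LB k) => -[_].
  congr (_.-integrable _ (EFin \o _)); apply/funext => x.
  by rewrite derive_comp_phi /A /B; congr (_ ^+ 2); ring.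
- by apply: (Rintegrable_add mO); exact: (Rintegrable_scale mO).
- apply: aeW => x _; rewrite derive_comp_phi.
  have -> : K' (phi k x) * 'D_('e_i) (phi k) x - K' (f x) * p i x = A k x + B k x.
    by rewrite /A /B; ring.
  rewrite -subr_ge0 [leRHS](_ : _ = (A k x - B k x) ^+ 2) ?sqr_ge0//; ring.
Qed.

(** Leibniz rule for [v] times [K(f)].  The functions [K(phi_k) psi] are test
    functions, so they may be inserted in the definition of the weak derivative of
    [v]; all three terms pass to the limit. *)
Lemma product_weak_partial i v q psi : L2 v -> is_weak_partial Omega i v q ->
  test_function Omega psi ->
  \int[mu]_(x in Omega) ((v x * K (f x)) * 'D_('e_i) psi x) =
  - \int[mu]_(x in Omega) ((K (f x) * q x + v x * (K' (f x) * p i x)) * psi x).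
Proof.
move=> Lv [/(L2P _ mO _) Lq Hq] tpsi.
have tdpsi := test_function_derive i tpsi.
have mf : measurable_fun Omega f by case: Lf.
have LKf := L2_comp Lf.
have LKp := L2_comp' mf (Lp i).
have L1 : L2 (fun x => 'D_('e_i) psi x * v x) by exact: L2_test_mul.
have L2' : L2 (fun x => psi x * v x) by exact: L2_test_mul.
have L3 : L2 (fun x => psi x * q x) by exact: L2_test_mul.
have tK k : test_function Omega (K \o phi k) by exact: test_function_comp.
have c1 := L2_cvg_mul mO L1 (fun k => L2_comp (Lphi k)) LKf comp_cvg.
have c2 := L2_cvg_mul mO L2' (fun k => test_function_L2 (test_function_derive i (tK k))) LKp (comp_derive_cvg i).
have c3 := L2_cvg_mul mO L3 (fun k => L2_comp (Lphi k)) LKf comp_cvg.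
have E k : \int[mu]_(x in Omega) ('D_('e_i) psi x * v x * K (phi k x)) +
    \int[mu]_(x in Omega) (psi x * v x * 'D_('e_i) (K \o phi k) x) +
    \int[mu]_(x in Omega) (psi x * q x * K (phi k x)) = 0.
  have LKk := L2_comp (Lphi k).
  have LDk := test_function_L2 (test_function_derive i (tK k)).
  have [_ sKk] := (test_function_smooth _ _).1 (tK k).
  have [_ spsi] := (test_function_smooth _ _).1 tpsi.
  have := Hq _ (test_function_mul sKk tpsi).
  rewrite -RintegralD//; [|exact: (L2_mul mO)..].
  move=> H; apply/eqP; rewrite addr_eq0; apply/eqP.
  transitivity (\int[mu]_(x in Omega) (v x * 'D_('e_i) ((K \o phi k) \* psi) x)).
    apply: eq_Rintegral => x _; rewrite deriveM; [|apply: diff_derivable; exact: smooth_diff..].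
    by rewrite /GRing.scale/=; ring.
  by rewrite H; congr (- _); apply: eq_Rintegral => x _ /=; ring.
have Z : \int[mu]_(x in Omega) ('D_('e_i) psi x * v x * K (f x)) +
    \int[mu]_(x in Omega) (psi x * v x * (K' (f x) * p i x)) +
    \int[mu]_(x in Omega) (psi x * q x * K (f x)) = 0.
  have H := cvgD (cvgD c1 c2) c3.
  apply/esym/(cvg_unique (@norm_hausdorff _ R) _ (H _ _)).
  by apply: cvg_near_cst; apply: nearW => k; exact: E.
have -> : \int[mu]_(x in Omega) (v x * K (f x) * 'D_('e_i) psi x) =
   \int[mu]_(x in Omega) ('D_('e_i) psi x * v x * K (f x)).
  by apply: eq_Rintegral => x _; ring.
move/eqP: Z; rewrite -addrA addr_eq0 => /eqP ->; congr (- _).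
rewrite -RintegralD//; [|exact: (L2_mul mO)..].
by apply: eq_Rintegral => x _; ring.
Qed.

End approximation.

Lemma funrposE f x : f^\+ x = Num.max (f x) 0. Proof. by []. Qed.

Definition truncation (kappa : R) (u : 'rV[R]_d -> R) : 'rV[R]_d -> R :=
  fun x => cutG kappa (u^\+ x).

(** The truncation is the limit of [cutG o phi_k].  To replace the gradient of
    [u^+] by that of [u], the Leibniz rule is applied to the product of [u^+ - u]
    with [cutH(u^+)], which vanishes identically: hence so does the gradient of
    [u^+ - u] where [u^+ > kappa]. *)
Lemma truncation_H10 (u : 'rV[R]_d -> R) (kappa : R) : 0 <= kappa ->
  H1 Omega u -> H10 Omega u^\+ ->
  H10 Omega (truncation kappa u) /\
  forall i, {ae mu, forall x, Omega x ->
    weak_partial Omega i (truncation kappa u) x = cutG' kappa (u^\+ x) * weak_partial Omega i u x}.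
Proof.
move=> k0 H1u [H1w [phi [tphi c0 c1]]]; set chi := truncation kappa u; set w := u^\+ in H1w c0 c1 *.
pose p i := weak_partial Omega i w.
have wp i : is_weak_partial Omega i w (p i) by exact: weak_partialP.
have Lw : L2 w by apply/(L2P _ mO _); case: H1w.
have Lu : L2 u by apply/(L2P _ mO _); case: H1u.
have Lp i : L2 (p i) by apply/(L2P _ mO _); case: (wp i).
have mw : measurable_fun Omega w by case: Lw.
have Lphi k := test_function_L2 (tphi k).
have cphi : sqnorm (fun x => phi k x - w x) @[k --> \oo] --> 0.
  by apply/(L2_cvgP mO) => // k; exact: (L2_sub mO).
have cdphi i : sqnorm (fun x => 'D_('e_i) (phi k) x - p i x) @[k --> \oo] --> 0.
  apply/(L2_cvgP mO); last exact: c1.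
  by move=> k; apply: (L2_sub mO) => //; apply: test_function_L2; exact: test_function_derive.
have H00 : cutH kappa 0 = 0 by exact: cutH_eq0.
have G00 : cutG kappa 0 = 0 by rewrite /cutG mul0r.
have nH := tame_cutH kappa; have nG := tame_cutG kappa.
have Lchi : L2 chi by exact: (L2_comp nG G00).
pose q i x := cutG' kappa (w x) * p i x.
have Lq i : L2 (q i) by exact: (L2_comp' nG).
have wq i : is_weak_partial Omega i chi (q i).
  split; first exact/(L2P _ mO _).
  move=> psi tpsi.
  have := product_weak_partial tphi Lw Lp cphi cdphi nH H00 Lw (wp i) tpsi.
  move=> ->; congr (- _); apply: eq_Rintegral => x _; congr (_ * _).
  by rewrite /q /cutG'; ring.
have H1chi : H1 Omega chi by split; [exact/(L2P _ mO _)|move=> i; exists (q i)].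
have wqE i : {ae mu, forall x, Omega x -> weak_partial Omega i chi x = q i x}.
  exact: is_weak_partial_unique (weak_partialP i H1chi) (wq i).
split.
  split=> //; exists (fun k => cutG kappa \o phi k); split.
  - by move=> k; apply: test_function_comp => //; case: nG.
  - apply/(L2_cvgP mO); first by move=> k; exact: (L2_sub mO (L2_comp nG G00 (Lphi k)) Lchi).
    exact: (comp_cvg tphi Lw cphi nG G00).
  - move=> i.
    have tGk k : test_function Omega ('D_('e_i) (cutG kappa \o phi k)).
      by apply/test_function_derive/test_function_comp => //; case: nG.
    have Lpc : L2 (weak_partial Omega i chi).
      by apply/(L2P _ mO _); case: (weak_partialP i H1chi).
    apply/(L2_cvgP mO); first by move=> k; apply: (L2_sub mO) => //; exact: test_function_L2.
    have E : (fun k => sqnorm ('D_('e_i) (cutG kappa \o phi k) \- weak_partial Omega i chi)) =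
        (fun k => sqnorm (fun x => 'D_('e_i) (cutG kappa \o phi k) x - q i x)).
      apply/funext => k; apply: ae_eq_sqnorm.
      - by have [] := L2_sub mO (test_function_L2 (tGk k)) Lpc.
      - by have [] := L2_sub mO (test_function_L2 (tGk k)) (Lq i).
      - by apply: filterS (wqE i) => x + Ox => /(_ Ox) /= ->.
    rewrite E; exact: (comp_derive_cvg tphi Lw Lp cphi cdphi nG i).
move=> i; pose r := weak_partial Omega i u.
have wr : is_weak_partial Omega i u r by exact: weak_partialP.
have Lr : L2 r by apply/(L2P _ mO _); case: wr.
have wdiff : is_weak_partial Omega i (fun x => w x - u x) (fun x => p i x - r x).
  split; first by apply/(L2P _ mO _); exact: (L2_sub mO).
  move=> psi tpsi.
  have Ld := test_function_L2 (test_function_derive i tpsi); have Lpsi := test_function_L2 tpsi.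
  under eq_Rintegral do rewrite mulrBl.
  under [in RHS]eq_Rintegral do rewrite mulrBl.
  rewrite !RintegralB//; [|exact: (L2_mul mO)..].
  by rewrite (wp i).2// wr.2// opprB opprK addrC.
have wu0 x : (w x - u x) * cutH kappa (w x) = 0.
  rewrite /w funrposE; case: leP => h; last by rewrite subrr mul0r.
  by rewrite cutH_eq0 ?mulr0.
have wu0' x : (w x - u x) * cutH' kappa (w x) = 0.
  rewrite /w funrposE; case: leP => h; last by rewrite subrr mul0r.
  by rewrite cutH'_eq0 ?mulr0.
have LHw : L2 (fun x => cutH kappa (w x)) by exact: (L2_comp nH H00).
have Z : {ae mu, forall x, Omega x -> cutH kappa (w x) * (p i x - r x) = 0}.
  apply: (ae_eq0_test oO (f := fun x => cutH kappa (w x) * (p i x - r x))).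
    exact: (L2_mul mO LHw (L2_sub mO (Lp i) Lr)).
  move=> psi tpsi.
  have := product_weak_partial tphi Lw Lp cphi cdphi nH H00 (L2_sub mO Lw Lu) wdiff tpsi.
  under eq_Rintegral do rewrite wu0 mul0r.
  rewrite Rintegral_cst// mul0r => /esym/eqP; rewrite oppr_eq0 => /eqP <-.
  by apply: eq_Rintegral => x _; rewrite mulrA wu0' mul0r addr0.
apply: filterS2 (wqE i) Z => x h1 h2 Ox; rewrite (h1 Ox) /q -/(r x).
have [wk|wk] := leP (w x) kappa.
  by rewrite /cutG' cutH_eq0// cutH'_eq0// mulr0 addr0 !mul0r.
move: (h2 Ox) => /eqP; rewrite mulf_eq0 gt_eqF ?cutH_gt0//= subr_eq0 => /eqP -> //.
Qed.

End sobolev_chain.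

(** * The smallest eigenvalue and the elliptic form *)

Section min_eigenvalue.
Context {R : realType} {d : nat}.
Implicit Types (A : 'M[R]_d) (v w : 'rV[R]_d).

Definition dot v w : R := (v *m w^T) ord0 ord0.
Definition qf A v w : R := (v *m A *m w^T) ord0 ord0.

Lemma dotE v w : dot v w = \sum_i v ord0 i * w ord0 i.
Proof. by rewrite /dot mxE; apply: eq_bigr => i _; rewrite mxE. Qed.

Lemma qfE A v w : qf A v w = \sum_i \sum_j A i j * w ord0 j * v ord0 i.
Proof.
rewrite /qf mxE; under eq_bigr do rewrite !mxE big_distrl/=.
rewrite exchange_big/=; apply: eq_bigr => i _; apply: eq_bigr => j _; ring.
Qed.

Lemma dot_ge0 v : 0 <= dot v v.
Proof. by rewrite dotE; apply: sumr_ge0 => i _; rewrite -expr2 sqr_ge0. Qed.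

Lemma dot_gt0 v : v != 0 -> 0 < dot v v.
Proof.
move=> v0; rewrite lt_neqAle dot_ge0 andbT eq_sym.
apply: contra v0 => /eqP; rewrite dotE => /eqP.
rewrite psumr_eq0; last by move=> i _; rewrite -expr2 sqr_ge0.
move=> /allP H; apply/eqP/rowP => i; rewrite mxE.
by have := H i (mem_index_enum _); rewrite -expr2 sqrf_eq0 => /eqP.
Qed.

Lemma qfZ A k v : qf A (k *: v) (k *: v) = k ^+ 2 * qf A v v.
Proof. by rewrite !qfE mulr_sumr; apply: eq_bigr => i _; rewrite mulr_sumr; apply: eq_bigr => j _; rewrite !mxE; ring. Qed.

Lemma dotZ k v : dot (k *: v) (k *: v) = k ^+ 2 * dot v v.
Proof. by rewrite !dotE mulr_sumr; apply: eq_bigr => i _; rewrite !mxE; ring. Qed.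

Lemma continuous_sum (F : 'I_d -> 'rV[R]_d -> R) : (forall i, continuous (F i)) ->
  continuous (fun v => \sum_i F i v).
Proof.
move=> cF v.
have addC : continuous (fun z : R * R => z.1 + z.2) by exact: add_continuous.
by apply: (@cvg_big R 'I_d +%R 0 xpredT addC _ (nbhs v) (index_enum 'I_d)
  F (fun i => F i v) _) => i _; exact: cF.
Qed.

(** The quadratic form attains its minimum on the unit sphere at some [v0]; that the
    first variation vanishes in the direction [y = v0 A - l v0] forces [y = 0]. *)
Lemma rayleigh_min A : (0 < d)%N -> A^T = A -> exists l : R,
  eigenvalue A l /\ forall v, l * dot v v <= qf A v v.
Proof.
move=> d0 symA.
pose S := [set v : 'rV[R]_d | dot v v = 1].
have cdot : continuous (fun v => dot v v).
  under eq_fun do rewrite dotE.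
  apply: (@continuous_sum (fun i v => v ord0 i * v ord0 i)) => i v.
  have h := @coord_continuous R 1 d ord0 i v.
  exact: (cvgM h h).
have cqf : continuous (fun v => qf A v v).
  under eq_fun do rewrite qfE.
  apply: (@continuous_sum (fun i v => \sum_j A i j * v ord0 j * v ord0 i)) => i.
  apply: (@continuous_sum (fun j v => A i j * v ord0 j * v ord0 i)) => j v.
  have hi := @coord_continuous R 1 d ord0 i v.
  have hj := @coord_continuous R 1 d ord0 j v.
  exact: (cvgM (cvgM (cvg_cst (A i j)) hj) hi).
have S0 : S !=set0.
  exists ('e_(Ordinal d0)); rewrite /S /= dotE (bigD1 (Ordinal d0))//= big1 ?mxE ?eqxx ?mulr1 ?addr0//.
  by move=> i /negbTE ne; rewrite !mxE ne andbF mulr0.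
have cS : compact S.
  apply: bounded_closed_compact.
    exists 1; split=> // M M1 v Sv.
    apply: (@le_trans _ _ 1); last exact: ltW.
    rewrite [leLHS]/Num.norm/= mx_normrE; apply/bigmax_leP; split=> // -[i j] _ /=.
    rewrite ord1 -(@expr_le1 _ 2)// real_normK ?num_real//.
    rewrite -Sv dotE (bigD1 j)//= -expr2 lerDl.
    by apply: sumr_ge0 => k _; rewrite -expr2 sqr_ge0.
  rewrite (_ : S = (fun v => dot v v) @^-1` [set 1]); last by apply/seteqP; split.
  by apply: closed_comp => [v _|]; [exact: cdot|exact: (@closed_eq R 1)].
have [v0 Sv0 v0min] : exists2 v0, v0 \in S & forall v, v \in S -> qf A v0 v0 <= qf A v v.
  by apply: compact_EVT_min => //; exact: continuous_subspaceT.
move: Sv0; rewrite inE /S /= => Sv0.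
pose l := qf A v0 v0.
have lmin v : l * dot v v <= qf A v v.
  have [->|vn0] := eqVneq v 0.
    by rewrite dotE qfE big1 ?big1 ?mulr0// => i _; rewrite ?big1// => *; rewrite !mxE ?(mulr0, mul0r).
  have d0' := dot_gt0 vn0; set s := Num.sqrt (dot v v).
  have s0 : 0 < s by rewrite sqrtr_gt0.
  have s2 : s ^+ 2 = dot v v by rewrite sqr_sqrtr// ltW.
  have := v0min (s^-1 *: v); rewrite inE /S /= dotZ qfZ exprVn s2 mulVf ?gt_eqF// => /(_ erefl).
  by rewrite -/l [_^-1 * _]mulrC ler_pdivlMr.
exists l; split=> //; apply/eigenvalueP; exists v0; last first.
  by apply/eqP => h; move: Sv0; rewrite h dotE big1 ?mxE => [/eqP|i _]; rewrite ?mxE ?mul0r// eq_sym oner_eq0.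
pose y := v0 *m A - l *: v0.
suff y0 : dot y y = 0.
  apply/eqP; rewrite -subr_eq0; apply/eqP/eqP; apply: contraT => yn0.
  by have := dot_gt0 yn0; rewrite y0 ltxx.
have symq v w : qf A w v = qf A v w.
  by rewrite /qf -[in LHS](trmxK (w *m A *m v^T)) mxE !trmx_mul trmxK symA mulmxA.
have yE w : dot y w = qf A v0 w - l * dot v0 w.
  by rewrite /dot /qf /y mulmxBl -scalemxAl !mxE.
have key (t : R) w : 0 <= 2 * t * dot y w + t ^+ 2 * (qf A w w - l * dot w w).
  have := lmin (v0 + t *: w); rewrite -subr_ge0.
  have -> : dot (v0 + t *: w) (v0 + t *: w) = dot v0 v0 + 2 * t * dot v0 w + t ^+ 2 * dot w w.
    rewrite !dotE !mulr_sumr -!big_split/=; apply: eq_bigr => i _; rewrite !mxE; ring.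
  have -> : qf A (v0 + t *: w) (v0 + t *: w) = qf A v0 v0 + 2 * t * qf A v0 w + t ^+ 2 * qf A w w.
    rewrite [RHS](_ : _ = qf A v0 v0 + t * qf A v0 w + t * qf A w v0 + t ^+ 2 * qf A w w); last by rewrite symq; ring.
    rewrite !qfE !mulr_sumr -!big_split/=; apply: eq_bigr => i _.
    rewrite !mulr_sumr -!big_split/=; apply: eq_bigr => j _; rewrite !mxE; ring.
  by rewrite yE Sv0 -/l; congr (0 <= _); ring.
set Y := dot y y in key *; set Q := qf A y y - l * dot y y in key *.
have K := key ^~ y; rewrite -/Q -/Y in K.
have Y0 : 0 <= Y by exact: dot_ge0.
apply/eqP; rewrite eq_le Y0 andbT leNgt; apply/negP => Yp.
have Qp : 0 <= Q by rewrite subr_ge0; exact: lmin.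
have := K (- (Y / (Q + 1))).
have Q1 : 0 < Q + 1 by lra.
rewrite leNgt => /negP; apply.
rewrite [X in X < 0](_ : _ = - (Y ^+ 2 / (Q + 1) ^+ 2 * (Q + 2))); last by field; rewrite gt_eqF.
by rewrite oppr_lt0 mulr_gt0 ?divr_gt0 ?exprn_gt0//; lra.
Qed.

(** The Rayleigh minimum is an eigenvalue, so it is at least the infimum of the
    eigenvalues, which is taken over a set bounded below by [0]. *)
Lemma min_eigenvalue_spec A : (0 < d)%N -> sym_posdef A ->
  0 <= min_eigenvalue A /\
  forall v, min_eigenvalue A * (\sum_i v ord0 i ^+ 2) <=
    \sum_i \sum_j A i j * v ord0 j * v ord0 i.
Proof.
move=> d0 [symA posA].
have [l [el lmin]] := rayleigh_min d0 symA.
have lb0 : lbound [set l | eigenvalue A l] 0.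
  move=> k /= /eigenvalueP[v vA vn0].
  have := posA v vn0; rewrite vA -scalemxAl mxE -/(dot v v) => h.
  by have := dot_gt0 vn0 => h'; rewrite ltW// -(pmulr_lgt0 _ h').
split; first by apply: lb_le_inf => //; exists l.
move=> v; rewrite -qfE.
have -> : \sum_i v ord0 i ^+ 2 = dot v v by rewrite dotE; apply: eq_bigr => i _; rewrite expr2.
apply: le_trans (lmin v); apply: ler_wpM2r; first exact: dot_ge0.
by apply: ge_inf => //; exists 0.
Qed.

(** The drift [B G] satisfies [B^2 <= 4 l C |p|^2] by Cauchy-Schwarz, so that
    [(B G)^2 <= 4 (G' l |p|^2) (C e G)], and the arithmetic-geometric inequality
    absorbs it in the diffusion at the cost of [C e G]. *)
Lemma elliptic_pointwise A (b p : 'rV[R]_d) (G G' C e : R) : (0 < d)%N -> sym_posdef A ->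
  0 <= C -> \sum_i b ord0 i ^+ 2 <= 4 * min_eigenvalue A * C ->
  0 <= G -> 0 <= G' -> 0 <= e -> G ^+ 2 <= e * G' * G ->
  - (C * e * G) <= \sum_i \sum_j A i j * p ord0 j * (G' * p ord0 i)
     + \sum_i b ord0 i * p ord0 i * G.
Proof.
move=> d0 pA C0 bC G0 G'0 e0 GG'.
have [l0 lA] := min_eigenvalue_spec d0 pA; set l := min_eigenvalue A in l0 lA bC.
have pE : \sum_i \sum_j A i j * p ord0 j * (G' * p ord0 i) =
    G' * \sum_i \sum_j A i j * p ord0 j * p ord0 i.
  rewrite mulr_sumr; apply: eq_bigr => i _; rewrite mulr_sumr; apply: eq_bigr => j _; ring.
rewrite pE -mulr_suml; set P := \sum_i p ord0 i ^+ 2 in lA *.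
have {}lA := lA p.
set B := \sum_i b ord0 i * p ord0 i.
have CS : B ^+ 2 <= (\sum_i b ord0 i ^+ 2) * P.
  rewrite mulrC; set Sb := \sum_i b ord0 i ^+ 2.
  have : 0 <= \sum_i (P * b ord0 i - B * p ord0 i) ^+ 2 by apply: sumr_ge0 => i _; exact: sqr_ge0.
  have -> : \sum_i (P * b ord0 i - B * p ord0 i) ^+ 2 = P * (P * Sb - B ^+ 2).
    have gen (y z : R) : \sum_i (y * b ord0 i - z * p ord0 i) ^+ 2 =
        y ^+ 2 * Sb - 2 * y * z * B + z ^+ 2 * P.
      rewrite /B /Sb /P !mulr_sumr -sumrB -big_split/=; apply: eq_bigr => i _; ring.
    by rewrite gen; ring.
  have : 0 <= P by apply: sumr_ge0 => i _; exact: sqr_ge0.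
  rewrite le_eqVlt => /predU1P[P0|P0]; last by rewrite pmulr_rge0// subr_ge0.
  suff -> : B = 0 by rewrite -P0 mul0r expr0n mul0r.
  rewrite /B big1// => i _; suff -> : p ord0 i = 0 by rewrite mulr0.
  have /eqP := P0; rewrite eq_sym psumr_eq0; last by move=> k _; exact: sqr_ge0.
  by move=> /allP /(_ i (mem_index_enum _)); rewrite sqrf_eq0 => /eqP.
have P0 : 0 <= P by apply: sumr_ge0 => i _; exact: sqr_ge0.
pose al := G' * (l * P); pose be := C * e * G.
have al0 : 0 <= al by rewrite !mulr_ge0.
have be0 : 0 <= be by rewrite !mulr_ge0.
have H : (B * G) ^+ 2 <= 4 * al * be.
  rewrite exprMn; apply: (@le_trans _ _ ((4 * l * C * P) * (e * G' * G))).
    apply: ler_pM; rewrite ?sqr_ge0//.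
    by apply: le_trans CS _; rewrite ler_wpM2r.
  by rewrite /al /be [leLHS](_ : _ = 4 * (G' * (l * P)) * (C * e * G))//; ring.
have H2 : (B * G) ^+ 2 <= (al + be) ^+ 2.
  apply: le_trans H _; rewrite -subr_ge0 [leRHS](_ : _ = (al - be) ^+ 2) ?sqr_ge0//; ring.
have H3 : - (al + be) <= B * G.
  have : `|B * G| <= al + be.
    by rewrite -(ler_pXn2r (n := 2))// ?nnegrE ?addr_ge0// real_normK ?num_real.
  by rewrite ler_norml => /andP[].
have H4 : al <= G' * \sum_i \sum_j A i j * p ord0 j * p ord0 i by exact: ler_wpM2l.
rewrite -/be; lra.
Qed.

End min_eigenvalue.

Section elliptic_form_bound.
Context {R : realType} {d : nat}.
Local Notation mu := (lebesgue_rV R d).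
Variable Omega : set 'rV[R]_d.
Hypothesis oO : open Omega.
Hypothesis fO : (mu Omega < +oo)%E.
Let mO : measurable Omega. Proof. exact: open_measurable_rV. Qed.

Lemma L2_coef_mul (f p q : 'rV[R]_d -> R) : Lp_on mu +oo%E Omega f ->
  L2 mu Omega p -> L2 mu Omega q ->
  mu.-integrable Omega (EFin \o (fun x => f x * p x * q x)).
Proof.
move=> /(Loo_onP _ mO _)[mf bf] Lp Lq.
by apply: (L2_mul mO) => //; exact: (L2_bounded_mul mO).
Qed.

Lemma elliptic_form_ge (A : 'rV[R]_d -> 'M[R]_d) (b : 'rV[R]_d -> 'rV[R]_d)
    (u : 'rV[R]_d -> R) (C kappa eps : R) : (0 < d)%N ->
  (forall i j, Lp_on mu +oo%E Omega (fun x => A x i j)) ->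
  (forall i, Lp_on mu +oo%E Omega (fun x => b x ord0 i)) ->
  {ae mu, forall x, Omega x -> sym_posdef (A x)} ->
  0 <= C -> {ae mu, forall x, Omega x ->
    \sum_i b x ord0 i ^+ 2 <= 4 * min_eigenvalue (A x) * C} ->
  0 <= kappa -> 0 <= eps -> H1 Omega u -> H10 Omega u^\+ ->
  {ae mu, forall x, Omega x -> u x <= kappa + eps} ->
  - (C * eps ^+ 2 * \int[mu]_(x in Omega) truncation kappa u x) <=
    elliptic_form Omega A b u (truncation kappa u).
Proof.
move=> d0 LA Lb pA C0 bC k0 e0 H1u H10u ule.
have [H10chi Dchi] := truncation_H10 oO fO k0 H1u H10u.
set chi := truncation kappa u in H10chi Dchi *.
have [H1chi _] := H10chi.
have L2w v i : H1 Omega v -> L2 mu Omega (weak_partial Omega i v).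
  by move=> H1v; apply/(L2P _ mO _); case: (weak_partialP i H1v).
have Lchi : L2 mu Omega chi by apply/(L2P _ mO _); case: H1chi.
pose p x : 'rV[R]_d := \row_i weak_partial Omega i u x.
have i1 i j : mu.-integrable Omega (EFin \o (fun x => A x i j * weak_partial Omega j u x * weak_partial Omega i chi x)).
  by apply: L2_coef_mul; [exact: LA|exact: L2w|exact: L2w].
have i2 i : mu.-integrable Omega (EFin \o (fun x => b x ord0 i * weak_partial Omega i u x * chi x)).
  by apply: L2_coef_mul; [exact: Lb|exact: L2w|].
pose F x := \sum_i \sum_j A x i j * weak_partial Omega j u x * weak_partial Omega i chi x
   + \sum_i b x ord0 i * weak_partial Omega i u x * chi x.
have iF1 : mu.-integrable Omega (EFin \o (fun x => \sum_i \sum_j A x i j * weak_partial Omega j u x * weak_partial Omega i chi x)).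
  by apply: (integrable_Rsum mO) => i; exact: (integrable_Rsum mO).
have iF2 : mu.-integrable Omega (EFin \o (fun x => \sum_i b x ord0 i * weak_partial Omega i u x * chi x)).
  exact: (integrable_Rsum mO).
have -> : elliptic_form Omega A b u chi = \int[mu]_(x in Omega) F x.
  rewrite /F RintegralD// !Rintegral_sum//; last by move=> i; exact: (integrable_Rsum mO).
  by congr (_ + _); apply: eq_bigr => i _; rewrite Rintegral_sum.
have ichi := L2_integrable oO fO Lchi.
rewrite -mulNr -RintegralZl//; apply: (ae_le_Rintegral mO).
- exact: (Rintegrable_scale mO).
- exact: (Rintegrable_add mO).
have Dall : {ae mu, forall x, forall i, Omega x ->
    weak_partial Omega i chi x = cutG' kappa (u^\+ x) * weak_partial Omega i u x}.
  apply: filter_forall => i.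
  exact: Dchi.
apply: filterS3 pA bC (filterI ule Dall) => x pAx bCx [ulex Dx] Ox.
have wle : u^\+ x <= kappa + eps by rewrite funrposE ge_max ulex// addr_ge0.
have w0 : 0 <= u^\+ x by rewrite funrposE le_max lexx orbT.
have := @elliptic_pointwise R d (A x) (b x) (p x) (chi x) (cutG' kappa (u^\+ x)) C (eps ^+ 2) d0 (pAx Ox) C0 (bCx Ox).
have G0 : 0 <= chi x by rewrite mulr_ge0// cutH_ge0.
have G'0 : 0 <= cutG' kappa (u^\+ x) by rewrite addr_ge0 ?mulr_ge0 ?cutH_ge0 ?cutH'_ge0.
move=> /(_ G0 G'0 (sqr_ge0 _)).
have GG' : chi x ^+ 2 <= eps ^+ 2 * cutG' kappa (u^\+ x) * chi x.
  have [wk|wk] := leP (u^\+ x) kappa.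
    by rewrite /chi /truncation /cutG cutH_eq0// mulr0 expr0n mulr0.
  rewrite expr2 ler_wpM2r// {1}/chi /truncation /cutG cutHE mulrCA.
  apply: (@le_trans _ _ (eps ^+ 2 * (u^\+ x * cutH' kappa (u^\+ x)))).
    rewrite ler_wpM2r ?mulr_ge0 ?cutH'_ge0// lerXn2r// ?nnegrE//; lra.
  by rewrite ler_wpM2l ?sqr_ge0// /cutG' lerDr cutH_ge0.
move=> /(_ GG').
rewrite /F mulNr; congr (_ <= _ + _).
  by apply: eq_bigr => i _; apply: eq_bigr => j _; rewrite Dx// !mxE.
by apply: eq_bigr => i _; rewrite !mxE.
Qed.

End elliptic_form_bound.

(** * The singular kernel *)

Section singular_integrals.
Context {R : realType}.
Local Notation leb := (@lebesgue_measure R).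
Implicit Types (p q r s t : R).

(** The integral of a nonnegative function is the supremum of those of the simple
    functions below it, which yields monotonicity for an arbitrary [g]; the norm of
    a Bochner approximation error will be such a [g]. *)
Lemma le_integral_nonmeasurable {d} {T : measurableType d} (mu : {measure set T -> \bar R})
    (D : set T) (f g : T -> \bar R) : measurable D ->
  measurable_fun D f -> (forall x, D x -> 0 <= f x)%E -> (forall x, D x -> 0 <= g x)%E ->
  {ae mu, forall x, D x -> (f x <= g x)%E} ->
  (\int[mu]_(x in D) f x <= \int[mu]_(x in D) g x)%E.
Proof.
move=> mD mf f0 g0 [N [mN N0 fgN]].
rewrite (ge0_negligible_integral mN mD mf f0 N0).
have mDN : measurable (D `\` N) by exact: measurableD.
have f0' x : (0 <= (f \_ (D `\` N)) x)%E.
  by rewrite patchE; case: ifPn => // /set_mem[Dx _]; exact: f0.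
rewrite integral_mkcond ge0_integralTE// ge0_integralE//.
apply: le_ereal_sup => _ /= [h hf <-]; exists h => // x.
apply: le_trans (hf x) _; rewrite !patchE; case: ifPn => [/set_mem[Dx Nx]|_].
  by rewrite mem_set//; move/subsetCl : fgN => /(_ _ Nx); apply.
by case: ifPn => // /set_mem Dx; exact: g0.
Qed.

(** Over the intervals [[a n, b n]] the integral of [f] is an increment of [F],
    hence at most [2 C]; monotone convergence exhausts [D]. *)
Lemma integrable_bounded_primitive (D : set R) (f F : R -> R) (a b : nat -> R) (C : R) :
  measurable D -> measurable_fun D f -> (forall x, D x -> 0 <= f x) ->
  (forall n, a n < b n) -> (forall n, a n.+1 <= a n) -> (forall n, b n <= b n.+1) ->
  (forall n, `[a n, b n]%classic `<=` D) -> D `<=` \bigcup_n `[a n, b n]%classic ->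
  (forall x, D x -> {for x, continuous f}) ->
  (forall x, D x -> is_derive x 1 F (f x)) ->
  (forall x, D x -> `|F x| <= C) ->
  leb.-integrable D (EFin \o f).
Proof.
move=> mD mf f0 ab an bn abD Dab cf dF FC.
pose g n x : \bar R := (f x * \1_(`[a n, b n]%classic) x)%:E.
have sub m n : (m <= n)%N -> `[a m, b m]%classic `<=` `[a n, b n]%classic.
  move=> mn; have an' : a n <= a m by move/nonincreasing_seqP : an => /(_ _ _ mn).
  have bn' : b m <= b n by move/nondecreasing_seqP : bn => /(_ _ _ mn).
  move=> x; rewrite /= !in_itv/= => /andP[h1 h2].
  by rewrite (le_trans an' h1) (le_trans h2 bn').
apply/integrableP; split; first exact/measurable_EFinP.
have gE x : D x -> limn (g^~ x) = (f x)%:E.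
  move=> Dx; apply/cvg_lim => //; have [N _ Nx] := Dab x Dx.
  apply: cvg_near_cst; near=> n.
  by rewrite /g indicE mem_set ?mulr1//; apply: sub Nx; near: n; exact: nbhs_infty_ge.
have -> : (\int[leb]_(x in D) `|(EFin \o f) x| = \int[leb]_(x in D) limn (g^~ x))%E.
  by apply: eq_integral => x /set_mem Dx; rewrite gE// /= ger0_norm// f0.
rewrite monotone_convergence//.
- apply: (@le_lt_trans _ _ (C + C)%:E); last by rewrite ltry.
  apply: lime_le.
    apply: ereal_nondecreasing_is_cvgn => m n mn.
    apply: ge0_le_integral => //.
    + by move=> x Dx; rewrite lee_fin mulr_ge0// f0.
    + by apply/measurable_EFinP; apply: measurable_funM => //; exact: measurable_indic.
    + by apply/measurable_EFinP; apply: measurable_funM => //; exact: measurable_indic.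
    + move=> x Dx; rewrite lee_fin ler_wpM2l ?f0// !indicE ler_nat.
      by case: (boolP (x \in `[a m, b m]%classic)) => //= /set_mem /(sub _ _ mn) h; rewrite mem_set.
  apply: nearW => n.
  have -> : (\int[leb]_(x in D) g n x = \int[leb]_(x in `[a n, b n]) (f x)%:E)%E.
    rewrite -[in RHS](setIidr (abD n)) integral_mkcondr; apply: eq_integral => x _.
    by rewrite /g patchE indicE; case: (x \in _); rewrite ?mulr1 ?mulr0.
  have inD x : x \in `[a n, b n] -> D x by move=> h; apply: (abD n).
  have an_D : D (a n) by apply: inD; rewrite in_itv/= lexx ltW.
  have bn_D : D (b n) by apply: inD; rewrite in_itv/= lexx ltW.
  rewrite (@continuous_FTC2 _ f F)//.
  + rewrite -EFinB lee_fin; have := FC _ an_D; have := FC _ bn_D.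
    by rewrite !ler_norml; lra.
  + apply: continuous_in_subspaceT => x /set_mem; rewrite /= => h; apply: cf; exact: inD.
  + have cF x : D x -> {for x, continuous F}.
      move=> /dF h; apply/differentiable_continuous/derivable1_diffP; exact: h.(ex_derive).
    split.
    * move=> x /subset_itv_oo_cc xab; exact: (dF x (inD _ xab)).(ex_derive).
    * by apply: cvg_at_right_filter; exact: cF.
    * by apply: cvg_at_left_filter; exact: cF.
  + move=> x /subset_itv_oo_cc xab; rewrite derive1E; exact: (dF x (inD _ xab)).(derive_val).
- by move=> n; apply/measurable_EFinP; apply: measurable_funM => //; exact: measurable_indic.
- by move=> n x Dx; rewrite lee_fin mulr_ge0// f0.
- move=> x Dx m n mn; rewrite lee_fin ler_wpM2l ?f0// !indicE ler_nat.
  by case: (boolP (x \in `[a m, b m]%classic)) => //= /set_mem /(sub _ _ mn) h; rewrite mem_set.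
Unshelve. all: by end_near. Qed.

Variable alpha : R.
Hypothesis al : 0 < alpha < 1.

Definition kernel t s := (t - s) `^ (- alpha).

Lemma kernel_ge0 t s : 0 <= kernel t s. Proof. exact: powR_ge0. Qed.

Lemma kernel_le t s s' : s <= s' -> s' < t -> kernel t s <= kernel t s'.
Proof.
move=> ss' s't; rewrite /kernel !powRN lef_pV2 ?posrE ?powR_gt0 ?subr_gt0//; last by lra.
by case/andP: al => al0 al1; apply: ge0_ler_powR; rewrite ?nnegrE; lra.
Qed.

Lemma is_derive_powR_sub t s (x : R) : s < t ->
  is_derive s 1 (fun s => (t - s) `^ x) (- (x * (t - s) `^ (x - 1))).
Proof.
move=> st.
have D1 : is_derive s 1 (fun s : R => t - s) (-1).
  by have := is_deriveB (is_derive_cst t s (1 : R)) (is_derive_id s (1 : R)); rewrite sub0r.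
have ts : 0 < t - s by rewrite subr_gt0.
have := @is_derive1_comp _ (fun y => y `^ x) (fun s => t - s) s _ _ (is_derive1_powR x ts) D1.
by rewrite mulrN1.
Qed.

Lemma kernel_continuous t s : s < t -> {for s, continuous (kernel t)}.
Proof.
move=> st; have h := is_derive_powR_sub (- alpha) st.
apply/differentiable_continuous/derivable1_diffP; exact: h.(ex_derive).
Qed.

Lemma measurable_kernel t (D : set R) : measurable_fun D (kernel t).
Proof.
apply: (@measurable_funS _ _ _ _ setT) => //.
apply: (@measurableT_comp _ _ _ _ _ _ (fun y : R => y `^ (- alpha)) _ (fun s => t - s)).
  exact: measurable_powR.
exact: measurable_funB.
Qed.

(** The primitive [- (t - s)^(1 - alpha) / (1 - alpha)] is bounded near [t]. *)
Lemma integrable_kernel p t : p < t -> leb.-integrable `]p, t[ (EFin \o kernel t).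
Proof.
move=> pt.
pose e n := (t - p) / 3 / n.+1%:R.
have e0 n : 0 < e n by rewrite !divr_gt0// subr_gt0.
have e3 n : e n <= (t - p) / 3.
  by rewrite ler_pdivrMr// ler_peMr ?divr_ge0 ?subr_ge0 ?(ltW pt)// ler1n.
have eS n : e n.+1 <= e n.
  by rewrite ler_wpM2l ?divr_ge0 ?subr_ge0 ?(ltW pt)// lef_pV2 ?posrE// ler_nat.
pose F s := - (1 - alpha)^-1 * (t - s) `^ (1 - alpha).
have a1 : 0 < 1 - alpha by case/andP: al; lra.
apply: (@integrable_bounded_primitive _ _ F (fun n => p + e n) (fun n => t - e n)
  ((1 - alpha)^-1 * (t - p) `^ (1 - alpha))) => //.
- exact: measurable_kernel.
- by move=> x _; exact: kernel_ge0.
- by move=> n; have := e3 n; have := e0 n; lra.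
- by move=> n; have := eS n; lra.
- by move=> n; have := eS n; lra.
- move=> n x; rewrite /= !in_itv/=.
  by move=> /andP[h1 h2]; have e0n := e0 n; apply/andP; split; lra.
- move=> x; rewrite /= in_itv/= => /andP[px xt].
  have m0 : 0 < Num.min (x - p) (t - x) by rewrite lt_min !subr_gt0 px.
  have tp0 : 0 < (t - p) / 3 by rewrite divr_gt0// subr_gt0.
  pose n := Num.truncn ((t - p) / 3 / Num.min (x - p) (t - x)).
  exists n => //=; rewrite in_itv/=.
  have : e n <= Num.min (x - p) (t - x).
    rewrite /e ler_pdivrMr// -ler_pdivrMl// [leLHS]mulrC.
    by have /andP[_ /ltW] := truncn_itv (ltW (divr_gt0 tp0 m0)).
  by rewrite le_min => /andP[? ?]; apply/andP; split; lra.
- by move=> x; rewrite /= in_itv/= => /andP[px xt]; exact: kernel_continuous.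
- move=> x; rewrite /= in_itv/= => /andP[px xt].
  have -> : kernel t x = - (1 - alpha)^-1 *: - ((1 - alpha) * (t - x) `^ (1 - alpha - 1)).
    rewrite /GRing.scale/= /kernel mulrNN mulrA mulVf ?gt_eqF// mul1r.
    by congr (_ `^ _); lra.
  exact: is_deriveZ (is_derive_powR_sub (1 - alpha) xt).
- move=> x; rewrite /= in_itv/= => /andP[px xt].
  rewrite /F mulNr normrN ger0_norm ?mulr_ge0 ?powR_ge0 ?invr_ge0 ?(ltW a1)//.
  rewrite ler_wpM2l ?invr_ge0 ?(ltW a1)//.
  by apply: ge0_ler_powR; rewrite ?nnegrE; lra.
Qed.

Lemma kernel_tail p t (eta : R) : p < t -> 0 < eta -> exists2 d0, 0 < d0 <= t - p &
  forall d, 0 < d <= d0 -> \int[leb]_(s in `]t - d, t[) kernel t s < eta.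
Proof.
move=> pt eta0.
pose f n s := kernel t s * \1_`]t - (t - p) / n.+1%:R, t[ s.
have tp : 0 < t - p by rewrite subr_gt0.
have itv_sub (d : R) : d <= t - p -> `]t - d, t[ `<=` `]p, t[.
  by move=> dtp x; rewrite /= !in_itv/= => /andP[h ->]; rewrite andbT; lra.
have fE (d : R) : d <= t - p -> \int[leb]_(s in `]t - d, t[) kernel t s =
   \int[leb]_(s in `]p, t[) (kernel t s * \1_`]t - d, t[ s).
  move=> dtp; rewrite -[in LHS](setIidr (itv_sub d dtp)) Rintegral_mkcondr.
  apply: eq_Rintegral => x _.
  by rewrite patchE indicE; case: (x \in _); rewrite ?mulr1 ?mulr0.
have ik := integrable_kernel pt.
have mkI (d : R) : measurable_fun `]p, t[ (fun s => kernel t s * \1_`]t - d, t[ s).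
  by apply: measurable_funM; [exact: measurable_kernel|exact: measurable_indic].
have : \int[leb]_(s in `]p, t[) f n s @[n --> \oo] --> \int[leb]_(s in `]p, t[) (0 : R).
  apply: (@Rintegral_dominated _ _ _ leb _ _ f _ (kernel t)) => //.
  - by move=> n; exact: mkI.
  - apply: aeW => x; rewrite /= in_itv/= => /andP[px xt].
    apply: cvg_near_cst; near=> n.
    rewrite /f indicE memNset ?mulr0//= in_itv/= => /andP[+ _].
    apply/negP; rewrite -leNgt lerBrDr -lerBrDl ler_pdivrMr// mulrC -ler_pdivrMr ?subr_gt0//.
    have tx : 0 < t - x by rewrite subr_gt0.
    have /andP[_ /ltW h] := truncn_itv (ltW (divr_gt0 tp tx)).
    apply: le_trans h _; rewrite ler_nat ltnS; near: n; exact: nbhs_infty_ge.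
  - apply: aeW => x n _; rewrite ger0_norm ?mulr_ge0 ?kernel_ge0//.
    by rewrite ler_piMr ?kernel_ge0// indicE; case: (_ \in _).
rewrite Rintegral_cst// mul0r => /cvgrPdist_lt /(_ _ eta0)[n _ /(_ n (leqnn n))].
rewrite sub0r normrN => h.
have n0 : 0 < n.+1%:R :> R by [].
have dn : 0 < (t - p) / n.+1%:R <= t - p.
  by rewrite divr_gt0//= ler_pdivrMr// ler_peMr ?(ltW tp)// ler1n.
have /andP[dn0 dn1] := dn.
exists ((t - p) / n.+1%:R) => // d /andP[d0 dle].
apply: le_lt_trans (le_lt_trans (ler_norm _) h).
rewrite fE; last exact: le_trans dn1.
apply: le_Rintegral => //.
- apply: (integrable_le _ _ ik); [by []|exact: mkI|].
  apply: aeW => x _; rewrite ger0_norm ?mulr_ge0 ?kernel_ge0//.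
  by rewrite ler_piMr ?kernel_ge0// indicE; case: (_ \in _).
- apply: (integrable_le _ _ ik); [by []|exact: mkI|].
  apply: aeW => x _; rewrite ger0_norm ?mulr_ge0 ?kernel_ge0//.
  by rewrite ler_piMr ?kernel_ge0// indicE; case: (_ \in _).
- move=> x _; rewrite ler_wpM2l ?kernel_ge0// !indicE ler_nat.
  case: (boolP (x \in `]t - d, t[%classic)) => //= /set_mem; rewrite /= in_itv/= => /andP[h1 h2].
  suff -> : x \in `]t - (t - p) / n.+1%:R, t[%classic by [].
  by apply/mem_set; rewrite /= in_itv/= h2 andbT (le_lt_trans _ h1)// lerD2l lerN2.
Unshelve. all: by end_near. Qed.

(** A divergent integral is turned into [0] by [fine], so integrability has to be
    established: the integrand is at most a multiple of the derivative of
    [- (1 + x^(1 - alpha))^(-1)], which is bounded. *)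
Lemma Gamma_gt0 : 0 < Gamma (1 - alpha).
Proof.
have /andP[al0 al1] := al.
have a1 : 0 < 1 - alpha by lra.
pose f x := x `^ (1 - alpha - 1) * expR (- x).
pose y x := x `^ (1 - alpha).
pose F x := (1 + y x)^-1.
pose g x := (1 - alpha) * x `^ (1 - alpha - 1) * F x ^+ 2.
have y0 x : 0 <= y x by exact: powR_ge0.
have mpow z : measurable_fun [set: R] (fun x : R => x `^ z) by exact: measurable_powR.
have mf : measurable_fun [set: R] f.
  apply: measurable_funM; first exact: mpow.
  by apply: measurableT_comp; [exact: measurable_expR|exact: oppr_measurable].
have pos (x : R) : [set` `]0, +oo[%R] x -> 0 < x by rewrite /= in_itv/= andbT.
have dy (x : R) : 0 < x -> is_derive x 1 y ((1 - alpha) * x `^ (1 - alpha - 1)).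
  by move=> x0; exact: is_derive1_powR.
have y1 x : 1 + y x != 0 by rewrite gt_eqF// ltr_wpDr.
have dF (x : R) : 0 < x -> is_derive x 1 F (- g x).
  move=> x0; have d1 := is_deriveD (is_derive_cst (1 : R) x 1) (dy x x0).
  have d2 := @is_deriveV _ (fun x => 1 + y x) x _ 1 (y1 x) d1.
  apply: (is_derive_eq d2).
  by rewrite /GRing.scale/= add0r /g /F exprVn; ring.
have cpow (z x : R) : 0 < x -> {for x, continuous (fun x : R => x `^ z)}.
  move=> x0; apply/differentiable_continuous/derivable1_diffP.
  exact: (is_derive1_powR z x0).(ex_derive).
have F01 x : 0 <= F x <= 1.
  by rewrite invr_ge0 addr_ge0//= invf_le1 ?lerDl// ltr_wpDr.
have cg (x : R) : 0 < x -> {for x, continuous g}.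
  move=> x0; have cF : {for x, continuous F}.
    by apply/differentiable_continuous/derivable1_diffP; exact: (dF x x0).(ex_derive).
  apply: cvgM; first by apply: cvgM; [exact: cvg_cst|exact: cpow].
  by rewrite expr2; apply: cvgM; exact: cF.
have ig : leb.-integrable `]0, +oo[ (EFin \o g).
  apply: (@integrable_bounded_primitive _ g (fun x => - F x) (fun n => n.+2%:R^-1) (fun n => n.+2%:R) 1) => //.
  - apply: open_continuous_measurable_fun; first exact: interval_open.
    by move=> x /set_mem /pos; exact: cg.
  - move=> x _; apply: mulr_ge0; last exact: sqr_ge0.
    by apply: mulr_ge0; [exact: ltW|exact: powR_ge0].
  - move=> n; apply: (@lt_trans _ _ 1); last by rewrite ltr1n.
    by rewrite invf_lt1// ltr1n.
  - by move=> n; rewrite lef_pV2 ?posrE// ler_nat.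
  - by move=> n; rewrite ler_nat.
  - by move=> n x; rewrite /= !in_itv/= andbT => /andP[h _]; rewrite (lt_le_trans _ h).
  - move=> x /pos x0; pose m := maxn (Num.truncn x) (Num.truncn x^-1).
    exists m => //=; rewrite in_itv/=; apply/andP; split.
      rewrite invf_ple ?posrE//; have xV : 0 <= x^-1 by rewrite invr_ge0 ltW.
      have /andP[_ /ltW h] := truncn_itv xV; apply: le_trans h _.
      by rewrite ler_nat leqW// ltnS /m leq_max leqnn orbT.
    have /andP[_ /ltW h] := truncn_itv (ltW x0); apply: le_trans h _.
    by rewrite ler_nat leqW// ltnS /m leq_max leqnn.
  - by move=> x /pos; exact: cg.
  - by move=> x /pos x0; have := is_deriveN (dF x x0); rewrite opprK.
  - by move=> x _; have /andP[h1 h2] := F01 x; rewrite normrN ger0_norm.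
have ef x : 0 < x -> f x <= 4 / (1 - alpha) * g x.
  move=> x0; have p0 : 0 <= x `^ (1 - alpha - 1) by exact: powR_ge0.
  rewrite /f /g [leRHS](_ : _ = x `^ (1 - alpha - 1) * (4 * F x ^+ 2)); last by field; rewrite gt_eqF.
  rewrite ler_wpM2l// /F exprVn expRN -ler_pdivrMr ?invr_gt0 ?exprn_gt0 ?ltr_wpDr//.
  rewrite invrK mulrC ler_pdivrMr ?expR_gt0//.
  have yx : y x <= 1 + x.
    have [x1|x1] := leP x 1.
      apply: (@le_trans _ _ 1); last by rewrite lerDl ltW.
      have <- : 1 `^ (1 - alpha) = 1 :> R by rewrite powR1.
      by rewrite /y; apply: ge0_ler_powR; rewrite ?nnegrE; lra.
    apply: (@le_trans _ _ x); last by rewrite lerDr.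
    by rewrite /y -[leRHS]powRr1; [apply: ler_powR; lra|lra].
  have -> : expR x = expR (x / 2) ^+ 2 by rewrite -expRM_natl; congr expR; field.
  rewrite (_ : 4 = 2 ^+ 2 :> R); last by ring.
  have h1 : 0 <= 1 + y x by rewrite addr_ge0.
  have h2 : 1 + y x <= 2 * expR (x / 2) by have := expR_ge1Dx (x / 2); lra.
  by rewrite -exprMn lerXn2r// nnegrE (le_trans h1 h2).
have f0 x : 0 <= f x by rewrite mulr_ge0 ?powR_ge0 ?expR_ge0.
have mfD : measurable_fun (`]0, +oo[%classic : set R) f by exact: measurable_funS mf.
have fi : leb.-integrable `]0, +oo[ (EFin \o f).
  have ig4 := @Rintegrable_scale _ _ _ leb _ (measurable_itv `]0, +oo[) (4 / (1 - alpha)) _ ig.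
  apply: (integrable_le _ _ ig4) => //.
  by apply: aeW => x /pos x0; rewrite ger0_norm// ef.
rewrite /Gamma -/f.
pose c : R := 2^-1 * expR (- 2).
have c0 : 0 < c by rewrite mulr_gt0// expR_gt0.
pose I12 : set R := `[1, 2]%classic; pose P : set R := `]0, +oo[%classic.
have sub12 : I12 `<=` P.
  by move=> x; rewrite /I12 /P /= !in_itv/= andbT => /andP[h _]; rewrite (lt_le_trans _ h).
have cf x : P x -> c * \1_I12 x <= f x.
  move=> _; rewrite indicE; case: (boolP (x \in I12)) => [/set_mem|_]; last by rewrite mulr0.
  rewrite /I12/= in_itv/= mulr1 => /andP[x1 x2].
  have x0 : 0 < x by lra.
  apply: ler_pM => //; rewrite ?expR_ge0// ?ler_expR ?lerN2//.
  apply: (@le_trans _ _ (x `^ (-1))); last by apply: ler_powR; lra.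
  by rewrite powR_inv1 ?(ltW x0)// lef_pV2 ?posrE.
have c1_0 x : 0 <= c * \1_I12 x by rewrite mulr_ge0 ?(ltW c0).
have ic : leb.-integrable P (EFin \o (fun x => c * \1_I12 x)).
  apply: (integrable_le _ _ fi) => //.
    by apply: measurable_funM; [exact: measurable_cst|apply: measurable_indic; exact: measurable_itv].
  by apply: aeW => x Px; rewrite ger0_norm// cf.
have H : \int[leb]_(x in P) (c * \1_I12 x) <= \int[leb]_(x in P) f x.
  by apply: le_Rintegral; [exact: measurable_itv|exact: ic|exact: fi|exact: cf].
apply: lt_le_trans H.
have -> : \int[leb]_(x in P) (c * \1_I12 x) = \int[leb]_(x in I12) c.
  rewrite -[in RHS](setIidr sub12) Rintegral_mkcondr.
  apply: eq_Rintegral => x _.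
  by rewrite patchE indicE; case: (x \in _); rewrite ?mulr1 ?mulr0.
rewrite Rintegral_cst; last exact: measurable_itv.
have -> : fine (leb I12) = 2 - 1 by rewrite lebesgue_measure_itv/= lte_fin ltr1n -EFinB.
by rewrite mulr_gt0//; lra.
Qed.

End singular_integrals.

(** * Nondecreasing weights *)

Section comparison.
Context {R : realType}.
Local Notation leb := (@lebesgue_measure R).
Implicit Types (p q r s t : R) (k D V : R -> R).

Lemma fine_lebesgue_itv_oo (a b : R) : fine (leb `]a, b[) = Num.max 0 (b - a).
Proof.
rewrite lebesgue_measure_itv/= lte_fin; case: ltP => h.
  by rewrite -EFinD/= max_r// subr_ge0 ltW.
by rewrite max_l// subr_le0.
Qed.

Lemma integrable_itv_scale p t M (f : R -> R) :
  leb.-integrable `]p, t[ (EFin \o f) -> leb.-integrable `]p, t[ (EFin \o (fun s => M * f s)).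
Proof. by move=> fi; exact: (@Rintegrable_scale _ _ _ leb _ (measurable_itv `]p, t[) M _ fi). Qed.

Lemma integrable_itv_le p t (f g : R -> R) : measurable_fun `]p, t[ f ->
  leb.-integrable `]p, t[ (EFin \o g) ->
  (forall s, p < s < t -> `|f s| <= g s) -> leb.-integrable `]p, t[ (EFin \o f).
Proof.
move=> mf ig fg; apply: (integrable_le _ _ ig); [exact: measurable_itv|exact: mf|].
by apply: aeW => s; rewrite /= in_itv/= => st; exact: fg.
Qed.

Lemma integrable_cst_itv (p t M : R) : leb.-integrable `]p, t[ (EFin \o cst M).
Proof.
have h : leb.-integrable `]p, t[ (EFin \o cst 1).
  apply/integrableP; split; first by apply/measurable_EFinP; exact: measurable_cst.
  under eq_integral do rewrite /= normr1.
  rewrite integral_cst/=; last exact: measurable_itv.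
  rewrite lebesgue_measure_itv/=; case: ifP => _; last by rewrite mule0 ltry.
  by rewrite -EFinB -EFinM ltry.
have := integrable_itv_scale M h.
by apply: eq_integrable => // s _ /=; rewrite mulr1.
Qed.

Lemma integrable_bounded_itv p t (f : R -> R) (M : R) : measurable_fun `]p, t[ f ->
  (forall s, p < s < t -> `|f s| <= M) -> leb.-integrable `]p, t[ (EFin \o f).
Proof. by move=> mf; exact: integrable_itv_le mf (integrable_cst_itv p t M). Qed.

Lemma sum_indic_le_truncn (N : nat) (z : R) : 0 <= z ->
  \sum_(j < N) ((j.+1%:R <= z)%R : nat)%:R = (minn N (Num.truncn z))%:R :> R.
Proof.
move=> z0; elim: N => [|N IH]; first by rewrite big_ord0 min0n.
rewrite big_ord_recr/= IH -natrD; congr _%:R.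
rewrite -truncn_ge_nat//.
case: (leqP N.+1 (Num.truncn z)) => h.
  by rewrite (minn_idPl (ltnW h)) addn1.
by rewrite (minn_idPr _) ?addn0.
Qed.

(** Such an [A] is, up to one point, the interval from its infimum to [t]. *)
Lemma upper_level_integral_ge0 p t (A : set R) D (M : R) : p < t ->
  A `<=` `]p, t[ -> (forall s s', A s -> s <= s' -> s' < t -> A s') ->
  measurable_fun `]p, t[ D -> (forall s, p < s < t -> `|D s| <= M) ->
  (forall r, p <= r < t -> 0 <= \int[leb]_(s in `]r, t[) D s) ->
  measurable A /\ 0 <= \int[leb]_(s in `]p, t[) (\1_A s * D s).
Proof.
move=> pt Ap Aup mD DM H.
have mA : measurable A.
  apply: is_interval_measurable => x y Ax Ay z /andP[xz zy].
  apply: Aup Ax xz _; apply: le_lt_trans zy _.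
  by have := Ap _ Ay; rewrite /= in_itv/= => /andP[].
split => //.
have [->|/set0P A0] := eqVneq A set0.
  by under eq_Rintegral do rewrite indic0 mul0r; rewrite Rintegral_cst// mul0r.
have lbA : lbound A p by move=> x /Ap; rewrite /= in_itv/= => /andP[/ltW].
have hi : has_inf A by split => //; exists p.
have pr : p <= inf A by exact: lb_le_inf.
have [a0 Aa0] := A0.
have rt : inf A < t.
  apply: le_lt_trans (ge_inf hi.2 Aa0) _.
  by have := Ap _ Aa0; rewrite /= in_itv/= => /andP[].
apply: le_trans (H (inf A) _) _; first by rewrite pr.
have sub : `]inf A, t[ `<=` `]p, t[.
  by move=> x; rewrite /= !in_itv/= => /andP[h ->]; rewrite andbT (le_lt_trans pr).
rewrite -[in leLHS](setIidr sub) Rintegral_mkcondr.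
rewrite le_eqVlt; apply/orP; left; apply/eqP; apply: ae_eq_Rintegral => //.
- have mI : measurable (`]inf A, t[%classic : set R) by exact: measurable_itv.
  have mJ : measurable (`]p, t[%classic : set R) by exact: measurable_itv.
  apply: (measurable_restrict D mI mJ).1.
  by apply: measurable_funS mD => // x [].
- apply: measurable_funM => //; exact: measurable_indic.
- have N0 : leb.-negligible [set inf A] by apply/negligibleP => //; exact: lebesgue_measure_set1.
  apply: negligibleS N0 => x /= /not_implyP[]; rewrite in_itv/= => /andP[px xt] h.
  apply: contrapT => xr; apply: h; rewrite patchE indicE mulrb.
  have [xA|xA] := boolP (x \in A).
    move/set_mem : (xA) => /(ge_inf hi.2); rewrite le_eqVlt => /orP[/eqP/esym//|h].
    by rewrite mem_set ?mul1r//= in_itv/= h.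
  rewrite memNset ?mul0r// /= in_itv/= => /andP[h _].
  have [y Ay yx] := inf_adherent (ltac:(rewrite subr_gt0; exact: h) : 0 < x - inf A) hi.
  by move/negP : xA; apply; apply/mem_set; apply: (Aup _ _ Ay _ xt); rewrite ltW// -(subrK (inf A) x) addrC.
Qed.

(** A nondecreasing weight is a limit of positive combinations of indicators of
    terminal segments, so the sign of the integrals over those decides. *)
Lemma nondecreasing_weight_ge0 p t k D (M : R) : p < t ->
  (forall s, p < s < t -> 0 <= k s) ->
  (forall s s', p < s -> s <= s' -> s' < t -> k s <= k s') ->
  leb.-integrable `]p, t[ (EFin \o k) ->
  measurable_fun `]p, t[ D -> (forall s, p < s < t -> `|D s| <= M) ->
  (forall r, p <= r < t -> 0 <= \int[leb]_(s in `]r, t[) D s) ->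
  0 <= \int[leb]_(s in `]p, t[) (k s * D s).
Proof.
move=> pt k0 knd ki mD DM H.
have pM : 0 <= M.
  have h := DM ((p + t) / 2); apply: le_trans (h _); first exact: normr_ge0.
  by apply/andP; split; lra.
pose A n (j : nat) := [set s : R | p < s < t /\ j.+1%:R <= n.+1%:R * k s].
have HA n j : measurable (A n j) /\ 0 <= \int[leb]_(s in `]p, t[) (\1_(A n j) s * D s).
  apply: (@upper_level_integral_ge0 _ _ _ _ M) => //.
  - by move=> x [+ _]; rewrite /= in_itv/=.
  - move=> s s' [/andP[ps st] h] ss' s't; split; first by rewrite s't (lt_le_trans ps).
    by apply: le_trans h _; rewrite ler_wpM2l// knd.
pose kn (n : nat) (s : R) : R := n.+1%:R^-1 * \sum_(j < (n.+1 * n.+1)%N) \1_(A n j) s.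
have knE n s : p < s < t ->
    kn n s = n.+1%:R^-1 * (minn (n.+1 * n.+1) (Num.truncn (n.+1%:R * k s)))%:R.
  move=> st; rewrite /kn -sum_indic_le_truncn ?mulr_ge0 ?k0//; congr (_ * _).
  apply: eq_bigr => j _; rewrite indicE; congr (_%:R); congr nat_of_bool.
  by apply/idP/idP => [/set_mem[]//|h]; exact/mem_set.
have kn_le n s : p < s < t -> 0 <= kn n s <= k s.
  move=> st; rewrite knE// mulr_ge0//= ler_pdivrMl//.
  apply: le_trans (_ : (Num.truncn (n.+1%:R * k s))%:R <= _).
    by rewrite ler_nat geq_minr.
  by have /andP[] := truncn_itv (ltac:(by rewrite mulr_ge0// k0) : 0 <= n.+1%:R * k s).
have mkn n : measurable_fun `]p, t[ (kn n).
  apply: measurable_funM => //; apply: measurable_sum => j.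
  by apply: measurable_indic; exact: (HA n j).1.
have mk : measurable_fun `]p, t[ k by exact: (measurable_EFinP _ _).1 (measurable_int _ ki).
have Dint (f : R -> R) : measurable_fun `]p, t[ f -> (forall s, p < s < t -> `|f s| <= k s) ->
    leb.-integrable `]p, t[ (EFin \o (fun s => f s * D s)).
  move=> mf fk; have ig := integrable_itv_scale M ki.
  apply: (integrable_itv_le _ ig); first exact: measurable_funM.
  - move=> s st; rewrite normrM mulrC.
    by rewrite ler_pM// ?DM// fk.
have lim : \int[leb]_(s in `]p, t[) (kn n s * D s) @[n --> \oo] -->
           \int[leb]_(s in `]p, t[) (k s * D s).
  apply: (@Rintegral_dominated _ _ _ leb _ _ _ _ (fun s => M * k s)) => //.
  - by move=> n; apply: measurable_funM; [exact: mkn|exact: mD].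
  - by apply: measurable_funM; [exact: mk|exact: mD].
  - apply: aeW => s; rewrite /= in_itv/= => st.
    apply: cvgM; last exact: cvg_cst.
    apply/cvgrPdist_le => e e0.
    near=> n.
    have /andP[h1 h2] := kn_le n s st.
    rewrite ger0_norm ?subr_ge0// knE//.
    have nk : k s <= n.+1%:R.
      have /andP[_ /ltW h] := truncn_itv (k0 _ st); apply: le_trans h _.
      by rewrite ler_nat ltnS; near: n; exact: nbhs_infty_ge.
    have z0 : 0 <= n.+1%:R * k s by rewrite mulr_ge0// k0.
    have /minn_idPr -> : (Num.truncn (n.+1%:R * k s) <= n.+1 * n.+1)%N.
      rewrite -(ler_nat R) natrM; apply: (@le_trans _ _ (n.+1%:R * k s)).
        by have /andP[] := truncn_itv z0.
      by rewrite ler_wpM2l.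
    have n0 : 0 < n.+1%:R :> R by [].
    have n1 : n.+1%:R != 0 :> R by rewrite gt_eqF.
    rewrite -{1}(mulKf n1 (k s)).
    rewrite -mulrBr ler_pdivrMl//; apply: (@le_trans _ _ 1).
      have /andP[_] := truncn_itv z0; rewrite -natr1; lra.
    rewrite -ler_pdivrMr// mul1r.
    have /andP[_ /ltW h] := truncn_itv (ltac:(by rewrite invr_ge0 ltW) : 0 <= e^-1).
    by apply: le_trans h _; rewrite ler_nat ltnS; near: n; exact: nbhs_infty_ge.
  - exact: Rintegrable_scale.
  - apply: aeW => s n; rewrite /= in_itv/= => st; rewrite normrM mulrC.
    have /andP[h1 h2] := kn_le n s st.
    by rewrite ler_pM// ?DM// ger0_norm.
rewrite -(cvg_lim _ lim)//; apply: limr_ge; first by apply/cvg_ex; exists (\int[leb]_(s in `]p, t[) (k s * D s)).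
apply: nearW => n.
under eq_Rintegral do rewrite /kn -mulrA mulr_suml.
have iA (j : 'I_(n.+1 * n.+1)) : leb.-integrable `]p, t[ (EFin \o (fun s => \1_(A n j) s * D s)).
  apply: (@integrable_bounded_itv _ _ _ M).
    by apply: measurable_funM; [apply: measurable_indic; exact: (HA n j).1|exact: mD].
  move=> s st; apply: le_trans (DM _ st); rewrite normrM ler_piMl// indicE.
  by case: (_ \in _); rewrite ?normr1 ?normr0.
rewrite RintegralZl//; last exact: integrable_Rsum.
rewrite mulr_ge0// Rintegral_sum//.
by apply: sumr_ge0 => j _; exact: (HA n j).2.
Unshelve. all: by end_near. Qed.

Lemma Rintegral_indic_itv r t (a b : R) :
  \int[leb]_(s in `]r, t[) \1_`]a, b[ s =
  Num.max 0 (Num.min t b - Num.max r a).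
Proof.
have -> : \int[leb]_(s in `]r, t[) \1_`]a, b[ s =
    \int[leb]_(s in `]r, t[ `&` `]a, b[) 1.
  rewrite Rintegral_mkcondr; apply: eq_Rintegral => s _.
  by rewrite patchE indicE; case: (_ \in _).
rewrite Rintegral_cst; last exact: measurableI.
have -> : `]r, t[ `&` `]a, b[ = `]Num.max r a, Num.min t b[%classic :> set R.
  by apply/seteqP; split => s; rewrite /= !in_itv/= gt_max lt_min; [case=> /andP[-> ->] /andP[-> ->]|case/andP=> /andP[-> ->] /andP[-> ->]].
by rewrite mul1r; exact: fine_lebesgue_itv_oo.
Qed.

(** The competitor [W] gains [A0 + L * delta] on [(r0 - sg, r0)] and decreases at
    rate [L] during the last interval of length [delta].  Its integrals over
    terminal segments are at most those of [V], so [nondecreasing_weight_ge0]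
    applies to [V - W]. *)
Lemma kernel_integral_ge (alpha p t h r0 sg delta A0 L M : R) V :
  0 < alpha < 1 -> p < r0 - sg -> 0 < sg -> r0 <= t - delta -> 0 < delta ->
  t - (r0 - sg) <= 2 * h -> 0 <= A0 -> 0 <= L ->
  measurable_fun `]p, t[ V -> (forall s, p < s < t -> `|V s| <= M) ->
  (forall r, p <= r <= r0 -> A0 <= \int[leb]_(s in `]r, t[) V s) ->
  (forall r, p <= r < t -> - (L * delta) <= \int[leb]_(s in `]r, t[) V s) ->
  (forall r, t - delta <= r < t -> - (L * (t - r)) <= \int[leb]_(s in `]r, t[) V s) ->
  (2 * h) `^ (- alpha) * A0 - L * \int[leb]_(s in `]t - delta, t[) kernel alpha t s <=
  \int[leb]_(s in `]p, t[) (kernel alpha t s * V s).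
Proof.
move=> al pr0 sg0 r0t d0 th A00 L0 mV VM H1 H2 H3.
have pt : p < t by lra.
pose I1 : set R := `]r0 - sg, r0[%classic; pose I2 : set R := `]t - delta, t[%classic.
have mI1 : measurable I1 by exact: measurable_itv.
have mI2 : measurable I2 by exact: measurable_itv.
pose c := (A0 + L * delta) / sg.
have c0 : 0 <= c by rewrite divr_ge0 ?addr_ge0 ?mulr_ge0// ltW.
pose W s := c * \1_I1 s - L * \1_I2 s.
have mi (a b : R) I : measurable I -> measurable_fun `]a, b[ (\1_I : R -> R).
  by move=> mI; exact: measurable_indic.
have mW (a b : R) : measurable_fun `]a, b[ W.
  by apply: measurable_funB; apply: measurable_funM; [exact: measurable_cst|exact: mi|exact: measurable_cst|exact: mi].
have i01 I s : 0 <= (\1_I s : R) <= 1 by rewrite indicE; case: (_ \in _); rewrite /= ?ler01 ?lexx.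
have WM s : `|W s| <= c + L.
  have /andP[? ?] := i01 I1 s; have /andP[? ?] := i01 I2 s.
  by rewrite ler_norml /W; apply/andP; split; nra.
have ii (a b : R) I : measurable I -> leb.-integrable `]a, b[ (EFin \o (\1_I : R -> R)).
  move=> mI; apply: (@integrable_bounded_itv _ _ _ 1); first exact: mi.
  by move=> s _; have /andP[? ?] := i01 I s; rewrite ger0_norm.
have intW r : \int[leb]_(s in `]r, t[) W s =
    c * Num.max 0 (Num.min t r0 - Num.max r (r0 - sg)) -
    L * Num.max 0 (Num.min t t - Num.max r (t - delta)).
  rewrite RintegralB//; [|by apply: integrable_itv_scale; exact: ii|by apply: integrable_itv_scale; exact: ii].
  by rewrite !RintegralZl//; [rewrite !Rintegral_indic_itv|exact: ii|exact: ii].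
have sgn0 : sg != 0 by rewrite gt_eqF.
have csg : c * sg = A0 + L * delta by rewrite /c mulfVK.
have W1 r : p <= r < t -> \int[leb]_(s in `]r, t[) W s <= \int[leb]_(s in `]r, t[) V s.
  move=> /andP[pr rt]; rewrite intW minxx.
  have [rr0|rr0] := leP r r0.
    apply: le_trans (H1 r _); last by rewrite pr.
    rewrite (@max_r _ _ r (t - delta)); last by lra.
    rewrite [Num.max 0 (t - _)]max_r; last by lra.
    rewrite (_ : t - (t - delta) = delta); last by ring.
    have : Num.max 0 (Num.min t r0 - Num.max r (r0 - sg)) <= sg.
      rewrite ge_max (ltW sg0)/= lerBlDr addrC -lerBlDr.
      by apply: (@le_trans _ _ (r0 - sg)); [rewrite lerD2r ge_min lexx orbT|rewrite le_max lexx orbT].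
    move=> /(ler_wpM2l c0); rewrite csg; lra.
  have -> : Num.max 0 (Num.min t r0 - Num.max r (r0 - sg)) = 0.
    apply/max_l; rewrite subr_le0; apply: (@le_trans _ _ r0); first by rewrite ge_min lexx orbT.
    by rewrite le_max (ltW rr0).
  rewrite mulr0 sub0r; have [rd|rd] := leP r (t - delta).
    apply: le_trans (H2 r _); last by rewrite pr.
    rewrite max_r; last by lra.
    by rewrite (_ : t - (t - delta) = delta)//; ring.
  apply: le_trans (H3 r _); last by rewrite (ltW rd).
  by rewrite max_r//; lra.
have ik := integrable_kernel al pt.
have mk : measurable_fun `]p, t[ (kernel alpha t) by exact: measurable_kernel.
have kM (f : R -> R) K : measurable_fun `]p, t[ f -> (forall s, p < s < t -> `|f s| <= K) ->
    leb.-integrable `]p, t[ (EFin \o (fun s => kernel alpha t s * f s)).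
  move=> mf fK; apply: (integrable_itv_le _ (integrable_itv_scale K ik)).
    by apply: measurable_funM.
  move=> s st; rewrite normrM mulrC (ger0_norm (kernel_ge0 _ _ _)).
  by apply: ler_wpM2r; [exact: kernel_ge0|exact: fK].
have isub r (f : R -> R) K : measurable_fun `]p, t[ f -> (forall s, p < s < t -> `|f s| <= K) ->
    p <= r -> leb.-integrable `]r, t[ (EFin \o f).
  move=> mf fK pr; have sub : `]r, t[ `<=` `]p, t[.
    by move=> x; rewrite /= !in_itv/= => /andP[rx ->]; rewrite andbT (le_lt_trans pr).
  apply: (@integrable_bounded_itv _ _ _ K); first exact: measurable_funS mf.
  by move=> s sr; apply: fK; have := sub s; rewrite /= !in_itv/=; exact.
have WMI s : p < s < t -> `|W s| <= c + L by move=> _; exact: WM.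
have main : 0 <= \int[leb]_(s in `]p, t[) (kernel alpha t s * (V s - W s)).
  apply: (@nondecreasing_weight_ge0 _ _ _ _ (M + (c + L))) => //.
  - by move=> s _; exact: kernel_ge0.
  - by move=> s s' _ ss' s't; exact: kernel_le.
  - by apply: measurable_funB.
  - by move=> s st; apply: le_trans (ler_normB _ _) _; rewrite lerD ?VM.
  - move=> r /andP[pr rt]; rewrite RintegralB//; [|exact: isub VM pr|exact: isub WMI pr].
    by rewrite subr_ge0 W1// pr.
have iV := kM _ _ mV VM.
have iW := kM _ _ (mW p t) WMI.
have main' : \int[leb]_(s in `]p, t[) (kernel alpha t s * W s) <= \int[leb]_(s in `]p, t[) (kernel alpha t s * V s).
  by rewrite -subr_ge0 -RintegralB//; under eq_Rintegral do rewrite -mulrBr.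
apply: le_trans main'.
have kI I : measurable I -> leb.-integrable `]p, t[ (EFin \o (fun s => kernel alpha t s * \1_I s)).
  move=> mI; apply: (kM _ 1); first exact: mi.
  by move=> s _; have /andP[? ?] := i01 I s; rewrite ger0_norm.
have -> : \int[leb]_(s in `]p, t[) (kernel alpha t s * W s) =
   c * \int[leb]_(s in `]p, t[) (kernel alpha t s * \1_I1 s) -
   L * \int[leb]_(s in `]p, t[) (kernel alpha t s * \1_I2 s).
  rewrite -!RintegralZl//; [|exact: kI|exact: kI].
  rewrite -RintegralB//; [|by apply: integrable_itv_scale; exact: kI|by apply: integrable_itv_scale; exact: kI].
  by apply: eq_Rintegral => s _; rewrite /W; ring.
have restr I f : measurable I -> I `<=` `]p, t[ ->
    \int[leb]_(s in `]p, t[) (f s * \1_I s) = \int[leb]_(s in I) f s.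
  move=> mI sub; rewrite -[in RHS](setIidr sub) Rintegral_mkcondr.
  apply: eq_Rintegral => x _.
  by rewrite patchE indicE; case: (x \in _); rewrite ?mulr1 ?mulr0.
have s1 : I1 `<=` `]p, t[ by move=> x; rewrite /I1 /= !in_itv/= => /andP[? ?]; apply/andP; split; lra.
have s2 : I2 `<=` `]p, t[ by move=> x; rewrite /I2 /= !in_itv/= => /andP[? ?]; apply/andP; split; lra.
rewrite [X in _ <= _ - L * X]restr// lerB//.
have k1 : (2 * h) `^ (- alpha) * sg <= \int[leb]_(s in `]p, t[) (kernel alpha t s * \1_I1 s).
  rewrite restr//.
  have <- : \int[leb]_(s in I1) ((2 * h) `^ (- alpha)) = (2 * h) `^ (- alpha) * sg.
    rewrite Rintegral_cst//; congr (_ * _); rewrite fine_lebesgue_itv_oo max_r; lra.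
  apply: le_Rintegral => //.
  - exact: integrable_cst_itv.
  - exact: integrableS ik.
  - move=> s; rewrite /I1/= in_itv/= => /andP[? ?].
    rewrite /kernel !powRN lef_pV2 ?posrE ?powR_gt0//; [|by lra|by lra].
    by case/andP: al => al0 al1; apply: ge0_ler_powR; rewrite ?nnegrE; lra.
apply: le_trans (ler_wpM2l c0 k1).
rewrite mulrCA csg ler_wpM2l ?powR_ge0// lerDl mulr_ge0//; exact: ltW.
Qed.

End comparison.

(** * Scalar weak derivatives in time *)

Section smooth_step.
Context {R : realType}.
Local Notation leb := (@lebesgue_measure R).
Local Notation smoothR := (@smooth R R unit (fun=> 1)).
Implicit Types x y a w : R.

Lemma flat_le x y : x <= y -> flat x <= flat y.
Proof.
move=> xy; have [x0|x0] := ltP 0 x; last by rewrite /flat flat_le0// flatn_ge0.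
have y0 := lt_le_trans x0 xy.
by rewrite /flat /flatn x0 y0 !expr0 !mul1r ler_expR lerN2 lef_pV2.
Qed.

(** The inner [flat (1 - x)] vanishes for [x >= 1] and is at least [flat 1] for
    [x <= 0], so the outer [flat] is constant on both sides of [[0, 1]]. *)
Definition step x : R := (flat (flat 1))^-1 * flat (flat 1 - flat (1 - x)).

Let c0 : 0 < flat (flat 1) :> R. Proof. by rewrite !flat_gt0. Qed.

Lemma step_le0 x : x <= 0 -> step x = 0.
Proof.
move=> x0; have h : flat 1 - flat (1 - x) <= 0 by rewrite subr_le0; apply: flat_le; lra.
by rewrite /step [X in _ * X](flat_le0 0 h) mulr0.
Qed.

Lemma step_ge1 x : 1 <= x -> step x = 1.
Proof.
move=> x1; have h : 1 - x <= 0 by lra.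
by rewrite /step [flat (1 - x)](flat_le0 0 h) subr0 mulVf// gt_eqF.
Qed.

Lemma step01 x : 0 <= step x <= 1.
Proof.
rewrite mulr_ge0 ?invr_ge0 ?flatn_ge0 ?(ltW c0)//= ler_pdivrMl// mulr1.
by apply: flat_le; rewrite lerBlDr lerDl flatn_ge0.
Qed.

Lemma smooth_step : smoothR step.
Proof.
apply: (@smoothM _ _ _ _ (fun=> _) (fun x => flat (flat 1 - flat (1 - x)))); first exact: smooth_cst.
have h1 : smoothR (fun x : R => flat (-1 * x + 1)) by apply: smooth_comp; [exact: smooth_flatn|exact: smoothR_affine].
have h2 : smoothR (fun x : R => -1 * flat (-1 * x + 1) + flat 1).
  exact: (smooth_comp (smoothR_affine (-1) (flat 1)) h1).
have := smooth_comp (smooth_flatn 0) h2; congr smoothR.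
by apply/funext => x /=; rewrite !mulN1r addrC (addrC (- x)).
Qed.

Lemma is_derive_step x : is_derive x 1 step
  ((flat (flat 1))^-1 * (flatn 2 (flat 1 - flat (1 - x)) * flatn 2 (1 - x))).
Proof.
have d0 : is_derive x 1 (fun x : R => 1 - x) (-1).
  by have := is_deriveB (is_derive_cst (1:R) x (1 : R)) (is_derive_id x (1 : R)); rewrite sub0r.
have df y : is_derive y 1 (flat : R -> R) (flatn 2 y).
  by have := is_derive_flatn 0 y; rewrite mul0r subr0.
have d1 := @is_derive1_comp _ flat (fun x => 1 - x) x _ _ (df (1 - x)) d0.
have d2 := is_deriveB (is_derive_cst (flat 1 : R) x (1 : R)) d1.
have d3 := @is_derive1_comp _ flat (fun x => flat 1 - flat (1 - x)) x _ _ (df (flat 1 - flat (1 - x))) d2.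
have d4 := is_deriveZ (flat (flat 1))^-1 d3.
by apply: (is_derive_eq d4); rewrite /GRing.scale/= sub0r mulrN1 opprK.
Qed.

Lemma derive1_step_ge0 x : 0 <= derive1 step x.
Proof.
rewrite derive1E (is_derive_step x).(derive_val).
by rewrite !mulr_ge0 ?invr_ge0 ?flatn_ge0.
Qed.

Lemma derive1_step_eq0 x : (x <= 0) || (1 <= x) -> derive1 step x = 0.
Proof.
rewrite derive1E (is_derive_step x).(derive_val) => /orP[x0|x1].
  by rewrite (flat_le0 2 (_ : flat 1 - _ <= 0)) ?mul0r ?mulr0// subr_le0 flat_le//; lra.
by rewrite (flat_le0 2 (_ : 1 - x <= 0)) ?mulr0//; lra.
Qed.

(** A smooth transition from 0 to 1 across [[a, a + w^-1]]. *)
Definition ramp a w x : R := step (w * x + - (w * a)).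

Lemma smooth_ramp a w : smoothR (ramp a w).
Proof. by apply: smooth_comp; [exact: smooth_step|exact: smoothR_affine]. Qed.

Lemma derive1_ramp a w x : derive1 (ramp a w) x = w * derive1 step (w * x + - (w * a)).
Proof.
have d0 : is_derive x 1 (fun x => w * x + - (w * a)) w.
  have := is_deriveD (is_deriveZ w (is_derive_id x (1 : R))) (is_derive_cst (- (w * a)) x (1 : R)).
  by move=> h; apply: (is_derive_eq h); rewrite addr0 /GRing.scale/= mulr1.
have d1 := @is_derive1_comp _ step (fun x => w * x + - (w * a)) x _ _ (is_derive_step (w * x + - (w * a))) d0.
rewrite derive1E d1.(derive_val) derive1E (is_derive_step _).(derive_val).
by rewrite mulrC.
Qed.

Lemma ramp_le a w x : 0 < w -> x <= a -> ramp a w x = 0.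
Proof. by move=> w0 xa; apply: step_le0; nra. Qed.

Lemma ramp_ge a w x : 0 < w -> a + w^-1 <= x -> ramp a w x = 1.
Proof.
move=> w0 xa; apply: step_ge1; rewrite -mulrN -mulrDr -ler_pdivrMl// mulr1; lra.
Qed.

Lemma derive1_ramp_ge0 a w x : 0 < w -> 0 <= derive1 (ramp a w) x.
Proof. by move=> w0; rewrite derive1_ramp mulr_ge0 ?derive1_step_ge0// ltW. Qed.

Lemma derive1_ramp_eq0 a w x : 0 < w -> (x <= a) || (a + w^-1 <= x) ->
  derive1 (ramp a w) x = 0.
Proof.
move=> w0 h; rewrite derive1_ramp derive1_step_eq0 ?mulr0//.
case/orP: h => h; first by apply/orP; left; nra.
by apply/orP; right; rewrite -mulrN -mulrDr -ler_pdivrMl// mulr1; lra.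
Qed.

Lemma integrable_itv_continuous (p q : R) (f : R -> R) (D : set R) :
  measurable D -> D `<=` `[p, q] -> {within `[p, q], continuous f} ->
  leb.-integrable D (EFin \o f).
Proof.
move=> mD sD cf; have h := continuous_compact_integrable (@segment_compact _ p q) cf.
exact: integrableS h.
Qed.

Lemma integrable_oo_continuous (p q : R) (f : R -> R) : {within `[p, q], continuous f} ->
  leb.-integrable `]p, q[ (EFin \o f).
Proof. by apply: integrable_itv_continuous => //; exact: subset_itv_oo_cc. Qed.

Lemma Rintegral_itv_oo_cc (p q : R) (f : R -> R) : {within `[p, q], continuous f} ->
  \int[leb]_(x in `]p, q[) f x = \int[leb]_(x in `[p, q]) f x.
Proof.
move=> cf; rewrite -Rintegral_itv_bndo_bndc; last first.
  by apply: integrable_itv_continuous cf => //; exact: subset_itv_co_cc.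
by rewrite -Rintegral_itv_obnd_cbnd//; exact: integrable_oo_continuous.
Qed.

(** The derivative of [ramp a w] is nonnegative with mass [1], concentrated on
    [[a, a + w^-1]]. *)
Lemma ramp_average (p q a w : R) (U : R -> R) (u0 e : R) : p < q -> 0 < w ->
  p <= a -> a + w^-1 <= q -> {within `[p, q], continuous U} ->
  (forall x, a <= x <= a + w^-1 -> `|U x - u0| <= e) ->
  `|\int[leb]_(x in `]p, q[) (derive1 (ramp a w) x * U x) - u0| <= e.
Proof.
move=> pq w0 pa aq cU Ue.
have cr : continuous (derive1 (ramp a w)).
  exact/smooth_continuous/smoothR_derive1/smooth_ramp.
have cr' : {within `[p, q], continuous (derive1 (ramp a w))} by exact: continuous_subspaceT.
have cU' (k : R) : {within `[p, q], continuous (fun x => U x - k)}.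
  by move=> x; apply: cvgB; [exact: cU|exact: cvg_cst].
have c1 (k : R) : {within `[p, q], continuous (fun x => derive1 (ramp a w) x * (U x - k))}.
  by move=> x; apply: cvgM; [exact: cr'|exact: cU'].
have i1 (f : R -> R) : continuous f -> leb.-integrable `]p, q[ (EFin \o (fun x => derive1 (ramp a w) x * f x)).
  move=> cf; apply: integrable_oo_continuous; apply: continuous_subspaceT => x.
  by apply: cvgM; [exact: cr|exact: cf].
have mass : \int[leb]_(x in `]p, q[) derive1 (ramp a w) x = 1.
  rewrite Rintegral_itv_oo_cc// /Rintegral (@continuous_FTC2 _ _ (ramp a w))//.
  - by rewrite -EFinB/= ramp_ge// ramp_le// subr0.
  - have cR : continuous (ramp a w) by exact/smooth_continuous/smooth_ramp.
    split.
    + by move=> x _; apply/derivable1_diffP; exact/smooth_diff/smooth_ramp.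
    + exact/cvg_at_right_filter/cR.
    + exact/cvg_at_left_filter/cR.
have massE : u0 = \int[leb]_(x in `]p, q[) (derive1 (ramp a w) x * u0).
  by rewrite RintegralZr ?mass ?mul1r//; exact: integrable_oo_continuous.
have iU : leb.-integrable `]p, q[ (EFin \o (fun x => derive1 (ramp a w) x * U x)).
  by apply: integrable_oo_continuous => x; apply: cvgM; [exact: cr'|exact: cU].
rewrite {1}massE -RintegralB//; last by apply: i1 => x; exact: cvg_cst.
have -> : e = \int[leb]_(x in `]p, q[) (derive1 (ramp a w) x * e).
  by rewrite RintegralZr ?mass ?mul1r//; exact: integrable_oo_continuous.
apply: le_norm_Rintegral => //.
- by apply: eq_integrable (integrable_oo_continuous (c1 u0)) => // x _ /=; rewrite mulrBr.
- by apply: i1 => x; exact: cvg_cst.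
- apply: aeW => x _; rewrite -mulrBr normrM ger0_norm ?derive1_ramp_ge0//.
  have [h|h] := boolP ((x <= a) || (a + w^-1 <= x)).
    by rewrite derive1_ramp_eq0// !mul0r.
  rewrite ler_wpM2l ?derive1_ramp_ge0// Ue//.
  by move: h; rewrite negb_or -!ltNge => /andP[/ltW -> /ltW ->].
Qed.

(** A smooth approximation, from inside, of the indicator of [[s1, s2]]. *)
Definition plateau s1 s2 w x : R := ramp (s1 + w^-1) w x - ramp (s2 - 2 * w^-1) w x.

Lemma smooth_plateau s1 s2 w : smoothR (plateau s1 s2 w).
Proof. by apply: smoothD; [exact: smooth_ramp|apply: smoothN; exact: smooth_ramp]. Qed.

Lemma derive1_plateau s1 s2 w x : derive1 (plateau s1 s2 w) x =
  derive1 (ramp (s1 + w^-1) w) x - derive1 (ramp (s2 - 2 * w^-1) w) x.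
Proof.
rewrite !derive1E deriveB//.
- by apply/derivable1_diffP; exact/smooth_diff/smooth_ramp.
- by apply/derivable1_diffP; exact/smooth_diff/smooth_ramp.
Qed.

Lemma plateau_le1 s1 s2 w x : `|plateau s1 s2 w x| <= 1.
Proof.
have /andP[] := step01 (w * x + - (w * (s1 + w^-1))).
have /andP[] := step01 (w * x + - (w * (s2 - 2 * w^-1))).
rewrite /plateau /ramp; move: (step _) (step _) => a b h1 h2 h3 h4.
by rewrite ler_norml; apply/andP; split; lra.
Qed.

Lemma plateau_out s1 s2 w x : 0 < w -> 3 * w^-1 <= s2 - s1 ->
  (x < s1 + w^-1) || (s2 - w^-1 < x) -> plateau s1 s2 w x = 0.
Proof.
move=> w0; have : 0 < w^-1 by rewrite invr_gt0.
rewrite /plateau => w1 w3 /orP[h|h]; first by rewrite !ramp_le ?subrr//; lra.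
by rewrite !ramp_ge ?subrr//; lra.
Qed.

Lemma plateau_in s1 s2 w x : 0 < w ->
  s1 + 2 * w^-1 <= x -> x <= s2 - 2 * w^-1 -> plateau s1 s2 w x = 1.
Proof.
move=> w0; have : 0 < w^-1 by rewrite invr_gt0.
by rewrite /plateau => w1 h1 h2; rewrite ramp_ge ?ramp_le ?subr0//; lra.
Qed.

Lemma plateau_supported p q s1 s2 w : 0 < w -> 3 * w^-1 <= s2 - s1 ->
  p <= s1 -> s2 <= q -> compactly_supported_in `]p, q[%classic (plateau s1 s2 w).
Proof.
move=> w0 w3 ps1 s2q; have wV0 : 0 < w^-1 by rewrite invr_gt0.
have sub : `[s1 + w^-1, s2 - w^-1]%classic `<=` `]p, q[%classic.
  by move=> x; rewrite /= !in_itv/= => /andP[h1 h2]; apply/andP; split; lra.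
have cK := @segment_compact R (s1 + w^-1) (s2 - w^-1).
have clK : closure [set x | plateau s1 s2 w x != 0] `<=` `[s1 + w^-1, s2 - w^-1]%classic.
  have cK' : closed `[s1 + w^-1, s2 - w^-1]%classic by exact: interval_closed.
  rewrite closureE => x; apply; split => // y /= y0; rewrite in_itv/=.
  by apply/andP; split; rewrite leNgt; apply/negP => h; move/eqP: y0; apply;
    apply: plateau_out => //; rewrite h ?orbT.
split; last exact: subset_trans sub.
by apply: (subclosed_compact (@closed_closure _ _) cK).
Qed.

Lemma plateau_average p q s1 s2 w (U : R -> R) e : p < q -> 0 < w ->
  3 * w^-1 <= s2 - s1 -> p <= s1 -> s2 <= q -> {within `[p, q], continuous U} ->
  (forall x, s1 <= x <= s1 + 2 * w^-1 -> `|U x - U s1| <= e) ->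
  (forall x, s2 - 2 * w^-1 <= x <= s2 -> `|U x - U s2| <= e) ->
  `|\int[leb]_(x in `]p, q[) (derive1 (plateau s1 s2 w) x * U x) - (U s1 - U s2)| <= e + e.
Proof.
move=> pq w0 w3 ps1 s2q cU U1 U2; have wV0 : 0 < w^-1 by rewrite invr_gt0.
have cr a : {within `[p, q], continuous (fun x => derive1 (ramp a w) x * U x)}.
  move=> x; apply: cvgM; last exact: cU.
  have cf : continuous (derive1 (ramp a w)).
    exact/smooth_continuous/smoothR_derive1/smooth_ramp.
  exact: (continuous_subspaceT cf).
under eq_Rintegral do rewrite derive1_plateau mulrBl.
rewrite RintegralB//; [|by apply: integrable_oo_continuous; exact: cr..].
have swap (a b c d : R) : a - b - (c - d) = (a - c) - (b - d) by ring.
rewrite swap.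
apply: le_trans (ler_normB _ _) _; apply: lerD.
  apply: ramp_average => //; [by lra|by lra|].
  by move=> x /andP[h1 h2]; apply: U1; apply/andP; split; lra.
apply: ramp_average => //; [by lra|by lra|].
by move=> x /andP[h1 h2]; apply: U2; apply/andP; split; lra.
Qed.

Lemma within_continuous_ball (p q s : R) (U : R -> R) e :
  {within `[p, q], continuous U} -> p <= s <= q -> 0 < e ->
  exists2 d, 0 < d & forall x, p <= x <= q -> `|x - s| < d -> `|U x - U s| <= e.
Proof.
move=> cU sp e0; have := cU s; rewrite /prop_for /continuous_at /= => /cvgrPdist_le /(_ _ e0).
have sI : `[p, q]%classic s by rewrite /= in_itv.
have -> : nbhs (s : subspace `[p, q]) = within `[p, q] (nbhs s).
  by rewrite nbhs_subspace_in.
move=> [d d0 H]; exists d => // x xp xs.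
by rewrite distrC; apply: (H x) => //=; rewrite distrC.
Qed.

Lemma cvg_indic_plateau s1 s2 (w : nat -> R) x : s1 < s2 ->
  (forall n, 0 < w n) -> (forall n, 3 * (w n)^-1 <= s2 - s1) ->
  (forall e, 0 < e -> \forall n \near \oo, (w n)^-1 <= e) ->
  plateau s1 s2 (w n) x @[n --> \oo] --> (\1_`]s1, s2[ x : R).
Proof.
move=> s12 w0 w3 wcvg; apply: cvg_near_cst; rewrite indicE.
have [/set_mem|/negP sN] := boolP (x \in `]s1, s2[%classic); [rewrite /= in_itv/= => /andP[h1 h2]|].
  have x1 : 0 < (x - s1) / 2 by rewrite divr_gt0// subr_gt0.
  have x2 : 0 < (s2 - x) / 2 by rewrite divr_gt0// subr_gt0.
  near=> n.
  have a1 : (w n)^-1 <= (x - s1) / 2 by near: n; exact: wcvg.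
  have a2 : (w n)^-1 <= (s2 - x) / 2 by near: n; exact: wcvg.
  by rewrite plateau_in//; move: a1 a2; clear; lra.
apply: nearW => n; rewrite plateau_out//.
have wp : 0 < (w n)^-1 by rewrite invr_gt0.
apply: contra_notT sN; rewrite negb_or -!leNgt => /andP[h1 h2].
by apply/mem_set; rewrite /= in_itv/=; move: wp h1 h2; clear => ? ? ?; apply/andP; split; lra.
Unshelve. all: by end_near. Qed.

(** The plateau functions are admissible and tend to the indicator of [(s1, s2)],
    while their derivatives concentrate with mass [1] at [s1] and [-1] at [s2]. *)
Lemma weak_derivative_increment (p q : R) (U V : R -> R) (M : R) : p < q ->
  {within `[p, q], continuous U} ->
  measurable_fun `]p, q[ V -> (forall s, p < s < q -> `|V s| <= M) ->
  (forall phi : R -> R, compactly_supported_in `]p, q[%classic phi ->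
    (forall n s, derivable (derive1n n phi) s 1) ->
    \int[leb]_(s in `]p, q[) (derive1 phi s * U s) =
    - \int[leb]_(s in `]p, q[) (phi s * V s)) ->
  forall s1 s2, p <= s1 -> s1 < s2 -> s2 <= q ->
    U s2 - U s1 = \int[leb]_(s in `]s1, s2[) V s.
Proof.
move=> pq cU mV VM weak s1 s2 ps1 s12 s2q.
have [w [w0 w3 wcvg]] : exists w : nat -> R, [/\ forall n, 0 < w n,
    forall n, 3 * (w n)^-1 <= s2 - s1 &
    forall e, 0 < e -> \forall n \near \oo, (w n)^-1 <= e].
  have pos : 0 < s2 - s1 by rewrite subr_gt0.
  have wV n : (3 / (s2 - s1) * n.+1%:R)^-1 = (s2 - s1) / 3 / n.+1%:R by rewrite invfM invf_div.
  exists (fun n => 3 / (s2 - s1) * n.+1%:R); split.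
  - by move=> n; rewrite mulr_gt0// divr_gt0.
  - move=> n; rewrite wV mulrA [3 * _]mulrC divfK//.
    by rewrite ler_pdivrMr// ler_peMr ?(ltW pos)// ler1n.
  - move=> e e0; near=> n; rewrite wV ler_pdivrMr// -ler_pdivrMl// mulrC.
    have h0 : 0 <= (s2 - s1) / 3 / e by rewrite !divr_ge0// ltW.
    have /andP[_ /ltW h] := truncn_itv h0; apply: le_trans h _.
    by rewrite ler_nat ltnS; near: n; exact: nbhs_infty_ge.
pose phi n := plateau s1 s2 (w n).
have wk n := weak (phi n) (plateau_supported (w0 n) (w3 n) ps1 s2q)
  (fun k s => @smoothR_derive1n _ (phi n) k s (smooth_plateau _ _ _)).
have mphi n : measurable_fun `]p, q[ (phi n).
  apply: (@measurable_funS _ _ _ _ setT) => //.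
  by apply: continuous_measurable_fun; exact/smooth_continuous/smooth_plateau.
have lim1 : \int[leb]_(s in `]p, q[) (phi n s * V s) @[n --> \oo] -->
    \int[leb]_(s in `]p, q[) (\1_`]s1, s2[ s * V s).
  apply: (@Rintegral_dominated _ _ _ leb _ _ _ _ (fun=> M)) => //.
  - by move=> n; apply: measurable_funM; [exact: mphi|exact: mV].
  - by apply: measurable_funM => //; apply: measurable_indic; exact: measurable_itv.
  - by apply: aeW => s _; apply: cvgM; [exact: cvg_indic_plateau|exact: cvg_cst].
  - exact: integrable_cst_itv.
  - apply: aeW => s n; rewrite /= in_itv/= => sp; rewrite normrM.
    by apply: le_trans (VM _ sp); rewrite ler_piMl// plateau_le1.
have lim2 : \int[leb]_(s in `]p, q[) (derive1 (phi n) s * U s) @[n --> \oo] --> U s1 - U s2.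
  apply/cvgrPdist_le => e e0; have e20 : 0 < e / 2 by rewrite divr_gt0.
  have [|d1 d10 D1] := @within_continuous_ball _ _ s1 _ _ cU _ e20.
    by rewrite ps1 (le_trans (ltW s12)).
  have [|d2 d20 D2] := @within_continuous_ball _ _ s2 _ _ cU _ e20.
    by rewrite s2q andbT (le_trans ps1)// ltW.
  have d13 : 0 < d1 / 3 by rewrite divr_gt0.
  have d23 : 0 < d2 / 3 by rewrite divr_gt0.
  near=> n.
  have a1 : (w n)^-1 <= d1 / 3 by near: n; exact: wcvg.
  have a2 : (w n)^-1 <= d2 / 3 by near: n; exact: wcvg.
  have wp : 0 < (w n)^-1 by rewrite invr_gt0.
  have wl := w3 n.
  rewrite distrC [leRHS]splitr; apply: plateau_average => //.
  - move=> x /andP[h1 h2]; apply: D1.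
      by move: ps1 s12 s2q wp wl h1 h2; clear => *; apply/andP; split; lra.
    by rewrite ltr_norml; move: a1 wp h1 h2; clear => *; apply/andP; split; lra.
  - move=> x /andP[h1 h2]; apply: D2.
      by move: ps1 s12 s2q wp wl h1 h2; clear => *; apply/andP; split; lra.
    by rewrite ltr_norml; move: a2 wp h1 h2; clear => *; apply/andP; split; lra.
have lim3 : \int[leb]_(s in `]p, q[) (derive1 (phi n) s * U s) @[n --> \oo] -->
    - \int[leb]_(s in `]p, q[) (\1_`]s1, s2[ s * V s).
  by under eq_fun do rewrite wk; exact: cvgN.
have E := cvg_unique _ lim2 lim3.
have sub : `]s1, s2[ `<=` `]p, q[.
  by move=> x; rewrite /= !in_itv/= => /andP[h1 h2]; rewrite (le_lt_trans ps1)// (lt_le_trans h2).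
rewrite -[in RHS](setIidr sub) Rintegral_mkcondr -opprB E// opprK.
apply: eq_Rintegral => x _.
by rewrite patchE indicE; case: (x \in _); rewrite ?mul1r ?mul0r.
Unshelve. all: by end_near. Qed.

End smooth_step.

(** * Time-dependent functions paired with a fixed function of space *)

Section ae_lebesgue.
Context {R : realType}.
Local Notation leb := (@lebesgue_measure R).

Lemma ae_leb_imply (P Q : R -> Prop) : {ae leb, forall s, P s} ->
  (forall s, P s -> Q s) -> {ae leb, forall s, Q s}.
Proof. by move=> HP PQ; apply: (@filterS _ _ (ae_filter_ringOfSetsType leb) _ _ PQ). Qed.

Lemma ae_leb_imply2 (P Q S : R -> Prop) : {ae leb, forall s, P s} ->
  {ae leb, forall s, Q s} -> (forall s, P s -> Q s -> S s) -> {ae leb, forall s, S s}.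
Proof.
by move=> HP HQ PQ; apply: (@filterS2 _ _ (ae_filter_ringOfSetsType leb) _ _ _ PQ).
Qed.

Lemma le_integral_itv (p q : R) (f : R -> R) (g : R -> \bar R) :
  leb.-integrable `]p, q[ (EFin \o f) -> (forall s, 0 <= f s) -> (forall s, 0 <= g s)%E ->
  {ae leb, forall s, s \in `]p, q[ -> ((f s)%:E <= g s)%E} ->
  ((\int[leb]_(s in `]p, q[) f s)%:E <= \int[leb]_(s in `]p, q[) g s)%E.
Proof.
move=> fi f0 g0 fg; rewrite /Rintegral fineK; last exact: integrable_fin_num fi.
apply: le_integral_nonmeasurable; [exact: measurable_itv|exact: measurable_int fi| | |].
- by move=> s _; rewrite lee_fin.
- by move=> s _.
- by apply: (ae_leb_imply fg) => s h; rewrite /= in_itv/= => sp; apply: h; rewrite in_itv.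
Qed.

End ae_lebesgue.

Section pairing.
Context {R : realType} {d : nat}.
Local Notation mu := (lebesgue_rV R d).
Local Notation leb := (@lebesgue_measure R).
Variables (Omega : set 'rV[R]_d) (chi : 'rV[R]_d -> R).
Hypotheses (mO : measurable Omega) (ichi : mu.-integrable Omega (EFin \o chi)).
Local Notation Loo := (Lp_on mu +oo%E Omega).
Local Notation Loo_norm := (Lp_norm_on mu +oo%E Omega).
Implicit Types (f g F : 'rV[R]_d -> R) (p q s : R).

Lemma Loo_sub f g : Loo f -> Loo g -> Loo (fun x => f x - g x).
Proof.
move=> /(Loo_onP _ mO _)[mf [M HM]] /(Loo_onP _ mO _)[mg [N HN]].
apply/(Loo_onP _ mO _); split; first exact: measurable_funB.
exists (M + N); apply: filterS2 HM HN => x + + Ox => /(_ Ox) h1 /(_ Ox) h2.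
by apply: le_trans (ler_normB _ _) _; exact: lerD.
Qed.

Lemma Loo_scale k f : Loo f -> Loo (fun x => k * f x).
Proof.
move=> /(Loo_onP _ mO _)[mf [M HM]].
apply/(Loo_onP _ mO _); split; first by apply: measurable_funM => //; exact: measurable_cst.
exists (`|k| * M); apply: filterS HM => x + Ox => /(_ Ox) h1.
by rewrite normrM ler_wpM2l.
Qed.

Lemma Loo_comb n (a : 'I_n -> R) (f : 'I_n -> 'rV[R]_d -> R) :
  (forall k, Loo (f k)) -> Loo (fun x => \sum_k a k * f k x).
Proof.
move=> Lf.
suff H (r : seq 'I_n) : Loo (fun x => \sum_(k <- r) a k * f k x) by exact: H.
elim: r => [|k r IH].
  under eq_fun do rewrite big_nil.
  by apply/(Loo_onP _ mO _); split => //; exists 0; apply: aeW => x _; rewrite normr0.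
under eq_fun do rewrite big_cons.
have h := Loo_sub (Loo_scale (a k) (Lf k)) (Loo_scale (-1) IH).
by rewrite (_ : (fun _ => _) = fun x => a k * f k x - -1 * \sum_(j <- r) a j * f j x)//;
  apply/funext => x; rewrite mulN1r opprK.
Qed.

Definition pairing f : R := \int[mu]_(x in Omega) (f x * chi x).
Definition chi_mass : R := \int[mu]_(x in Omega) `|chi x|.

Lemma chi_mass_ge0 : 0 <= chi_mass. Proof. by apply: Rintegral_ge0. Qed.

Lemma integrable_pairing f : Loo f -> mu.-integrable Omega (EFin \o (fun x => f x * chi x)).
Proof.
move=> /(Loo_onP _ mO _)[mf [M HM]].
have mchi := (measurable_EFinP _ _).1 (measurable_int _ ichi).
apply: (integrable_le mO (g := fun x => `|M| * `|chi x|)); first exact: measurable_funM.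
- by apply: (Rintegrable_scale mO); exact: integrable_norm.
- apply: filterS HM => x + Ox => /(_ Ox) h; rewrite normrM ler_wpM2r//.
  exact: le_trans h (ler_norm _).
Qed.

Lemma pairing_norm_le f (M : R) : Loo f -> {ae mu, forall x, Omega x -> `|f x| <= M} ->
  `|pairing f| <= M * chi_mass.
Proof.
move=> Lf HM; have ic := integrable_norm ichi.
rewrite -RintegralZl//; apply: (le_norm_Rintegral mO (integrable_pairing Lf)).
  exact: (Rintegrable_scale mO).
by apply: filterS HM => x + Ox => /(_ Ox) h; rewrite normrM ler_wpM2r.
Qed.

(** The extended-real form can be compared directly with integrals of the norm. *)
Lemma pairing_le f : Loo f -> (((chi_mass + 1)^-1 * `|pairing f|)%:E <= Loo_norm f)%E.
Proof.
move=> Lf; have c0 : 0 < chi_mass + 1 by rewrite ltr_wpDl ?chi_mass_ge0.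
case E : (Loo_norm f) => [N| |]; last 2 first.
- by rewrite leey.
- by have := Loo_norm_ge0 mu Omega f; rewrite E.
have N0 : 0 <= N by have := Loo_norm_ge0 mu Omega f; rewrite E lee_fin.
rewrite lee_fin ler_pdivrMl// mulrC; apply: (@le_trans _ _ (N * chi_mass)).
  apply: pairing_norm_le => //; apply: filterS (Loo_norm_ae mu Omega f) => x + Ox => /(_ Ox).
  by rewrite E lee_fin.
by rewrite ler_wpM2l// lerDl.
Qed.

Lemma pairing_sub f g : Loo f -> Loo g -> pairing (f \- g) = pairing f - pairing g.
Proof.
move=> Lf Lg; rewrite /pairing -RintegralB//; [|exact: integrable_pairing..].
by apply: eq_Rintegral => x _; rewrite /= mulrBl.
Qed.

Lemma pairing_scale k f : Loo f -> pairing (fun x => k * f x) = k * pairing f.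
Proof.
move=> Lf; rewrite /pairing -RintegralZl//; last exact: integrable_pairing.
by apply: eq_Rintegral => x _; rewrite /= mulrA.
Qed.

Lemma pairing_comb n (a : 'I_n -> R) (f : 'I_n -> 'rV[R]_d -> R) :
  (forall k, Loo (f k)) ->
  pairing (fun x => \sum_k a k * f k x) = \sum_k a k * pairing (f k).
Proof.
move=> Lf; rewrite /pairing.
under eq_Rintegral do rewrite mulr_suml.
rewrite (Rintegral_sum mO); last first.
  by move=> k; apply: integrable_pairing; exact: Loo_scale.
by apply: eq_bigr => k _; rewrite -(pairing_scale _ (Lf k)).
Qed.

Lemma Loo_simple_eval (h : simple_Loo Omega) s : Loo (simple_eval h s).
Proof. by apply: Loo_comb => k; exact: simple_valP. Qed.

Lemma measurable_pairing_simple (h : simple_Loo Omega) (D : set R) :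
  measurable_fun D (fun s => pairing (simple_eval h s)).
Proof.
rewrite (_ : (fun _ => _) = fun s => \sum_k \1_(simple_set (s := h) k) s * pairing (simple_val k)).
  apply: measurable_sum => k; apply: measurable_funM => //.
  by apply: measurable_indic; exact: simple_setP.
by apply/funext => s; rewrite /simple_eval pairing_comb// => k; exact: simple_valP.
Qed.

Lemma Rintegral_pairing_simple p q (h : simple_Loo Omega) :
  leb.-integrable `]p, q[ (EFin \o (fun s => pairing (simple_eval h s))) /\
  \int[leb]_(s in `]p, q[) pairing (simple_eval h s) = pairing (simple_integral p q h).
Proof.
have E : (fun s => pairing (simple_eval h s)) =
    fun s => \sum_k \1_(simple_set (s := h) k) s * pairing (simple_val k).
  by apply/funext => s; rewrite /simple_eval pairing_comb// => k; exact: simple_valP.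
have mk (k : 'I_(simple_size h)) : measurable (simple_set k) by exact: simple_setP.
have ik (k : 'I_(simple_size h)) :
    leb.-integrable `]p, q[ (EFin \o (fun s => \1_(simple_set k) s * pairing (simple_val k))).
  apply: (@integrable_bounded_itv _ _ _ _ (`|pairing (simple_val k)|)).
    by apply: measurable_funM => //; exact: measurable_indic.
  by move=> s _; rewrite normrM ler_piMl// indicE; case: (_ \in _); rewrite ?normr0 ?normr1.
rewrite E; split; first exact: integrable_Rsum.
rewrite Rintegral_sum// /simple_integral pairing_comb; last by move=> k; exact: simple_valP.
apply: eq_bigr => k _; rewrite RintegralZr//; last first.
  apply: (@integrable_bounded_itv _ _ _ _ 1); first exact: measurable_indic.
  by move=> s _; rewrite indicE; case: (_ \in _); rewrite ?normr0 ?normr1.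
congr (_ * _); rewrite setIC -[RHS]mul1r -(Rintegral_cst leb); last by apply: measurableI => //; exact: mk.
rewrite Rintegral_mkcondr; apply: eq_Rintegral => s _.
by rewrite patchE indicE; case: (_ \in _).
Qed.

Lemma Loo_simple_integral p q (h : simple_Loo Omega) : Loo (simple_integral p q h).
Proof. by apply: Loo_comb => k; exact: simple_valP. Qed.

(** For simple functions both sides are the same finite sum.  The scalar error is
    dominated by the error in norm, whose integral tends to [0] although it need
    not be measurable ([le_integral_itv]). *)
Lemma pairing_bochner p q (f : R -> 'rV[R]_d -> R) F (g : R -> R) :
  is_bochner_integral Omega p q f F -> leb.-integrable `]p, q[ (EFin \o g) ->
  {ae leb, forall s, s \in `]p, q[ -> g s = pairing (f s)} ->
  pairing F = \int[leb]_(s in `]p, q[) g s.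
Proof.
move=> [LF [h [happ hint hF]]] gi gE.
have c0 : 0 < chi_mass + 1 by rewrite ltr_wpDl ?chi_mass_ge0.
move: hF; rewrite ge0_cvge0P; last by move=> n; exact: Loo_norm_ge0.
move=> hF; move: hint; rewrite ge0_cvge0P; last first.
  by move=> n; apply: integral_ge0 => s _; exact: Loo_norm_ge0.
move=> hint; apply/eqP; rewrite -subr_eq0 -normr_eq0 eq_le normr_ge0 andbT.
apply/ler_addgt0Pl => e e0; rewrite addr0.
pose e' := e / 2 / (chi_mass + 1).
have e'0 : 0 < e' by rewrite !divr_gt0.
have [n [hn1 hn2]] : exists n,
    (Loo_norm (simple_integral p q (h n) \- F)%R < e'%:E)%E /\
    (\int[leb]_(s in `]p, q[) Loo_norm (simple_eval (h n) s \- f s)%R < e'%:E)%E.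
  have [N1 _ H1] := hF _ e'0; have [N2 _ H2] := hint _ e'0.
  by exists (maxn N1 N2); split; [apply: H1; exact: leq_maxl|apply: H2; exact: leq_maxr].
have [gni gnE] := Rintegral_pairing_simple p q (h n).
have b1 : `|pairing (simple_integral p q (h n)) - pairing F| <= e / 2.
  rewrite -pairing_sub//; last exact: Loo_simple_integral.
  have := le_lt_trans (pairing_le (Loo_sub (Loo_simple_integral p q (h n)) LF)) hn1.
  by rewrite lte_fin ltr_pdivrMl// mulrC /e' divfK ?gt_eqF// => /ltW.
have b2 : `|\int[leb]_(s in `]p, q[) pairing (simple_eval (h n) s) - \int[leb]_(s in `]p, q[) g s| <= e / 2.
  rewrite -RintegralB//.
  have di := @Rintegrable_sub _ _ _ leb _ (measurable_itv `]p, q[) _ _ gni gi.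
  apply: le_trans (le_normr_Rintegral _ di) _ => //.
  have ni : leb.-integrable `]p, q[ (EFin \o (fun s => (chi_mass + 1)^-1 * `|pairing (simple_eval (h n) s) - g s|)).
    by apply: integrable_itv_scale; exact: (integrable_norm di).
  have : ((\int[leb]_(s in `]p, q[) ((chi_mass + 1)^-1 * `|pairing (simple_eval (h n) s) - g s|))%:E < e'%:E)%E.
    apply: le_lt_trans hn2; apply: le_integral_itv => //.
    - by move=> s; rewrite mulr_ge0// invr_ge0 ltW.
    - by move=> s; exact: Loo_norm_ge0.
    - apply: (ae_leb_imply2 happ gE) => s h1 h2 sp.
      have [Lf _] := h1 sp; rewrite h2// -pairing_sub//; last exact: Loo_simple_eval.
      exact: pairing_le (Loo_sub (Loo_simple_eval _ _) Lf).
  rewrite lte_fin.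
  rewrite RintegralZl//; last exact: (integrable_norm di).
  by rewrite ltr_pdivrMl// mulrC /e' divfK ?gt_eqF// => /ltW.
rewrite gnE in b2.
rewrite [leRHS]splitr; apply: le_trans (lerD b1 b2).
rewrite [X in _ <= X + _]distrC; exact: ler_distD.
Qed.

(** The superior limit of the pairings of the simple approximants, clipped so that
    the bound holds at every time. *)
Lemma pairing_representative p q (f : R -> 'rV[R]_d -> R) (M : R) :
  strongly_measurable Omega p q f ->
  {ae leb, forall s, s \in `]p, q[ -> (Loo_norm (f s) <= M%:E)%E} ->
  exists g : R -> R, [/\ measurable_fun `]p, q[ g, forall s, `|g s| <= `|M| * chi_mass &
    {ae leb, forall s, s \in `]p, q[ -> g s = pairing (f s)}].
Proof.
move=> [h happ] HM.
pose gn n s := pairing (simple_eval (h n) s).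
pose B := `|M| * chi_mass.
have B0 : 0 <= B by rewrite mulr_ge0// chi_mass_ge0.
pose g0 s := fine (limn_esup (fun n => (gn n s)%:E)).
exists (fun s => Num.max (- B) (Num.min (g0 s) B)); split.
- apply: measurable_maxr; first exact: measurable_cst.
  apply: measurable_minr; last exact: measurable_cst.
  apply: (@measurableT_comp _ _ _ _ _ _ fine); first exact: fine_measurable.
  apply: measurable_fun_limn_esup => n; apply/measurable_EFinP.
  exact: measurable_pairing_simple.
- by move=> s; rewrite -/B ler_norml le_max lexx/= ge_max ge_min lexx orbT andbT; lra.
- apply: (ae_leb_imply2 happ HM) => s h1 h2 sp; have [Lf +] := h1 sp.
  have {}h2 := h2 sp.
  rewrite ge0_cvge0P; last by move=> n; exact: Loo_norm_ge0.
  move=> H.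
  have c0 : 0 < chi_mass + 1 by rewrite ltr_wpDl ?chi_mass_ge0.
  have lim : gn n s @[n --> \oo] --> pairing (f s).
    apply/cvgrPdist_le => e e0; have e'0 : 0 < e / (chi_mass + 1) by rewrite divr_gt0.
    apply: filterS (H _ e'0) => n hn; rewrite distrC /gn -pairing_sub//; last exact: Loo_simple_eval.
    have := le_lt_trans (pairing_le (Loo_sub (Loo_simple_eval (h n) s) Lf)) hn.
    by rewrite lte_fin ltr_pdivrMl// mulrC divfK ?gt_eqF// => /ltW.
  have -> : g0 s = pairing (f s).
    have cE : (gn n s)%:E @[n --> \oo] --> (pairing (f s))%:E by apply: cvg_EFin => //; exact: nearW.
    rewrite /g0 is_cvg_limn_esupE; last by apply/cvg_ex; exists (pairing (f s))%:E.
    by rewrite (cvg_lim _ cE).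
  have : `|pairing (f s)| <= B.
    apply: pairing_norm_le => //; apply: filterS (Loo_norm_ae mu Omega (f s)) => x + Ox => /(_ Ox) h3.
    by have := le_trans h3 h2; rewrite lee_fin => /le_trans; apply; exact: ler_norm.
  by rewrite ler_norml => /andP[b1 b2]; rewrite min_l// max_r.
Qed.

(** Pairing both Bochner integrals in the definition of the weak time derivative
    with [chi] makes [V] a scalar weak derivative of the pairing of [u]. *)
Lemma W1oo_pairing p q (u v : R -> 'rV[R]_d -> R) (M : R) : p < q ->
  W1oo_derivative Omega p q u v ->
  {ae leb, forall s, s \in `]p, q[ -> (Loo_norm (v s) <= M%:E)%E} -> (forall s, p <= s <= q -> Loo (u s)) ->
  {within `[p, q], continuous (fun s => pairing (u s))} ->
  exists V : R -> R, [/\ measurable_fun `]p, q[ V, forall s, `|V s| <= `|M| * chi_mass,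
    {ae leb, forall s, s \in `]p, q[ -> V s = pairing (v s)} &
    forall s1 s2, p <= s1 -> s1 < s2 -> s2 <= q ->
      pairing (u s2) - pairing (u s1) = \int[leb]_(s in `]s1, s2[) V s].
Proof.
move=> pq [bu bv wk] HM Lu cU; have [V [mV VB VE]] := pairing_representative bv.1 HM.
exists V; split => //; pose B := `|M| * chi_mass.
apply: (@weak_derivative_increment _ _ _ (fun s => pairing (u s)) _ B) => //.
move=> phi cphi sphi; have [F [H1 H2]] := wk phi cphi sphi.
have cd n : continuous (derive1n n phi).
  by move=> x; apply/differentiable_continuous/derivable1_diffP; exact: sphi.
have c1 : {within `[p, q], continuous (derive1 phi)}.
  by apply: continuous_subspaceT; exact: (cd 1%N).
have c0 : {within `[p, q], continuous phi}.
  by apply: continuous_subspaceT; exact: (cd 0%N).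
have E1 : pairing F = \int[leb]_(s in `]p, q[) (derive1 phi s * pairing (u s)).
  apply: (pairing_bochner H1).
    by apply: integrable_oo_continuous => x; apply: cvgM; [exact: c1|exact: cU].
  apply: aeW => s; rewrite in_itv/= => /andP[ps sq]; rewrite pairing_scale//.
  by apply: Lu; rewrite !ltW.
have LF : Loo F by case: H1.
have mphi : measurable_fun `]p, q[ phi.
  by apply: (measurable_EFinP _ _).1; exact: (measurable_int _ (integrable_oo_continuous c0)).
have E2 : pairing (\- F) = \int[leb]_(s in `]p, q[) (phi s * V s).
  apply: (pairing_bochner H2).
    have ib := integrable_norm (integrable_oo_continuous c0).
    apply: (integrable_itv_le _ (integrable_itv_scale B ib)); first exact: measurable_funM.
    by move=> s _; rewrite normrM mulrC ler_wpM2r.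
  have Lv : {ae leb, forall s, s \in `]p, q[ -> Loo (v s)}.
    case: bv => [[h happ] _].
    by apply: (ae_leb_imply happ) => s + sp => /(_ sp)[].
  by apply: (ae_leb_imply2 VE Lv) => s h1 h2 sp; rewrite h1// pairing_scale//; exact: h2.
rewrite -E1 -E2 (_ : pairing (\- F) = - pairing F) ?opprK//.
rewrite -[RHS]mulN1r -pairing_scale//; congr pairing.
by apply/funext => x /=; rewrite mulN1r.
Qed.

Lemma pairing_lipschitz p q (u v : R -> 'rV[R]_d -> R) (M : R) :
  W1oo_derivative Omega p q u v ->
  {ae leb, forall s, s \in `]p, q[ -> (Loo_norm (v s) <= M%:E)%E} ->
  (forall s, p <= s <= q -> Loo (u s)) ->
  {within `[p, q], continuous (fun s => pairing (u s))} ->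
  forall r, p <= r < q -> - (`|M| * chi_mass * (q - r)) <= pairing (u q) - pairing (u r).
Proof.
move=> H HM Lu cU r /andP[pr rq].
have pq := le_lt_trans pr rq.
have [V [mV VB _ E]] := W1oo_pairing pq H HM Lu cU.
rewrite (E r q)//.
have <- : \int[leb]_(s in `]r, q[) (- (`|M| * chi_mass)) = - (`|M| * chi_mass * (q - r)).
  by rewrite Rintegral_cst//= fine_lebesgue_itv_oo max_r ?subr_ge0 ?mulNr// ltW.
apply: le_Rintegral => //.
- exact: integrable_cst_itv.
- have sub : `]r, q[%classic `<=` `]p, q[%classic.
    by move=> x; rewrite /= !in_itv/= => /andP[rx ->]; rewrite andbT (le_lt_trans pr).
  by apply: (@integrable_bounded_itv _ _ _ _ (`|M| * chi_mass)) => //; exact: measurable_funS mV.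
- by move=> s _; have := VB s; rewrite ler_norml => /andP[].
Qed.

(** The bound of [kernel_integral_ge] on [(e, t)] is the same for all small [e],
    hence passes to the limit that defines the Caputo derivative. *)
Lemma caputo_pairing_ge (alpha t h r0 delta A0 L : R) (u : R -> 'rV[R]_d -> R) w :
  0 < alpha < 1 -> is_caputo_derivative Omega alpha u t w ->
  (forall s, 0 <= s <= t -> Loo (u s)) ->
  (forall p, 0 < p -> {within `[p, t], continuous (fun s => pairing (u s))}) ->
  0 < r0 -> r0 <= t - delta -> 0 < delta -> t - r0 <= h -> 0 <= A0 -> 0 <= L ->
  (forall r, 0 < r <= r0 -> A0 <= pairing (u t) - pairing (u r)) ->
  (forall r, 0 < r < t -> - (L * delta) <= pairing (u t) - pairing (u r)) ->
  (forall r, t - delta <= r < t -> - (L * (t - r)) <= pairing (u t) - pairing (u r)) ->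
  (Gamma (1 - alpha))^-1 *
    ((2 * h) `^ (- alpha) * A0 - L * \int[leb]_(s in `]t - delta, t[) kernel alpha t s) <=
  pairing w.
Proof.
move=> al [Lw [J [HJ limJ]]] Lu cU r00 r0t d0 th A00 L0 H1 H2 H3.
set G := (Gamma (1 - alpha))^-1; set b := (_ * A0 - _).
have h0 : 0 < h by lra.
have G0 : 0 < G by rewrite invr_gt0 Gamma_gt0.
have c0 : 0 < chi_mass + 1 by rewrite ltr_wpDl ?chi_mass_ge0.
pose sg := Num.min h (r0 / 2).
have sg0 : 0 < sg by rewrite lt_min h0 divr_gt0.
have [sgh sgr] : sg <= h /\ sg <= r0 / 2 by split; rewrite ge_min lexx ?orbT.
have JE e : 0 < e < r0 / 2 -> Loo (J e) /\ b <= pairing (J e).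
  move=> /andP[e0 er].
  have et : e < t by lra.
  have [v [bu [sv [M HM]] wk] HB] := HJ e (ltac:(by rewrite e0) : 0 < e < t).
  have HW : W1oo_derivative Omega e t u v by split => //; split => //; exists M.
  have Lu' s : e <= s <= t -> Loo (u s) by move=> /andP[h1 h2]; apply: Lu; rewrite h2 andbT; lra.
  have [V [mV VB VE incr]] := W1oo_pairing et HW HM Lu' (cU e e0).
  split; first by case: HB.
  have -> : pairing (J e) = \int[leb]_(s in `]e, t[) (kernel alpha t s * V s).
    apply: (pairing_bochner HB).
      apply: (integrable_itv_le _ (integrable_itv_scale (`|M| * chi_mass) (integrable_kernel al et))).
        by apply: measurable_funM => //; exact: measurable_kernel.
      by move=> s _; rewrite normrM mulrC (ger0_norm (kernel_ge0 _ _ _)) ler_wpM2r// kernel_ge0.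
    have [hh happ] := sv.
    apply: (ae_leb_imply2 VE happ) => s h1 h2 sp; rewrite h1// pairing_scale//.
    by have [] := h2 sp.
  apply: (@kernel_integral_ge _ alpha e t h r0 sg delta A0 L (`|M| * chi_mass) V) => //.
  - by lra.
  - by lra.
  - move=> r /andP[er' rr0]; rewrite -incr//; last by lra.
    by apply: H1; rewrite rr0 andbT; lra.
  - move=> r /andP[er' rt]; rewrite -incr//.
    by apply: H2; rewrite rt andbT; lra.
  - move=> r /andP[er' rt]; rewrite -incr//; last by lra.
    by apply: H3; rewrite er'.
apply/ler_addgt0Pr => eta eta0.
have eta1 : 0 < eta / (chi_mass + 1) by rewrite divr_gt0.
move: limJ; rewrite ge0_cvge0P; last by move=> e; exact: Loo_norm_ge0.
move=> /(_ _ eta1) Hn.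
have [e [e0 er He]] : exists e, [/\ 0 < e, e < r0 / 2 &
   (Loo_norm (fun x => w x - G * J e x)%R < (eta / (chi_mass + 1))%:E)%E].
  have Hr : \forall e \near 0^'+, 0 < e < r0 / 2.
    near=> e; apply/andP; split; near: e; first exact: nbhs_right_gt.
    by apply: nbhs_right_lt; rewrite divr_gt0.
  have [e []] := @filter_ex _ _ (at_right_proper_filter (0 : R)) _ (filterI Hn Hr).
  by move=> He /andP[e1 e2]; exists e.
have [LJ bJ] := JE e (ltac:(by rewrite e0) : 0 < e < r0 / 2).
have LGJ := Loo_scale G LJ.
have := le_lt_trans (pairing_le (Loo_sub Lw LGJ)) He.
rewrite lte_fin ltr_pdivrMl// mulrC divfK ?gt_eqF// => H.
have E : pairing (fun x => w x - G * J e x) = pairing w - G * pairing (J e).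
  by rewrite -(pairing_scale G LJ) -pairing_sub.
have bG : G * b <= G * pairing (J e) by rewrite ler_wpM2l// ltW.
move: H; rewrite E ltr_norml => /andP[H _].
move: H bG; move: (G * b) (G * pairing (J e)) (pairing w) => x y z; clear => *; lra.
Unshelve. all: by end_near. Qed.

End pairing.

(** * The maximum principle *)

Lemma bounded_fin_measure (R : realType) (d : nat) (Omega : set 'rV[R]_d) :
  measurable Omega -> bounded_set Omega -> (lebesgue_rV R d Omega < +oo)%E.
Proof.
move=> mO [M [_ HM]].
have HM1 : forall x, Omega x -> `|x| <= `|M| + 1.
  by apply: HM; rewrite (le_lt_trans (ler_norm M))// ltrDl.
apply: le_lt_trans (obox_fin_measure (\row_i (- (`|M| + 2))) (\row_i (`|M| + 2))).
apply: le_measure; rewrite ?inE//; first exact: measurable_obox.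
move=> x /HM1 xM i; rewrite !mxE -ltr_norml.
apply: (@le_lt_trans _ _ (`|M| + 1)); last by rewrite ltrD2l ltr1n.
apply: le_trans xM; rewrite /Num.norm/= mx_normrE.
by apply: (@le_bigmax _ _ _ _ (fun ij : 'I_1 * 'I_d => `|x ij.1 ij.2|) (ord0, i)).
Qed.

(** At a maximum [t] of [N s / expR (s / h)] the function [N] dominates its past,
    and it is at least twice its values before [t - h] because [2 <= expR 1].
    The values near [0] are small since [N 0 = 0], which allows [0 < r0]. *)
Lemma weighted_maximum (R : realType) (T h t1 : R) (N : R -> R) : 0 < h ->
  {within `[0, T], continuous N} -> N 0 = 0 -> 0 <= t1 <= T -> 0 < N t1 ->
  exists t r0, [/\ 0 < r0, r0 < t, t <= T, t - r0 <= h & 0 < N t] /\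
    (forall r, 0 <= r <= t -> N r <= N t) /\
    (forall r, 0 <= r <= r0 -> N r <= N t / 2).
Proof.
move=> h0 cN N0 /andP[t10 t1T] Nt1.
have T0 : 0 <= T by exact: le_trans t10 t1T.
pose g s := expR (s / h).
have g0 s : 0 < g s by exact: expR_gt0.
have cG : continuous (fun s : R => expR (- (s / h))).
  move=> s; apply: continuous_comp; last exact: continuous_expR.
  by apply: cvgN; apply: cvgM; [exact: cvg_id|exact: cvg_cst].
have cP : {within `[0, T], continuous (fun s => N s * expR (- (s / h)))}.
  by move=> s; apply: cvgM; [exact: cN|exact: (continuous_subspaceT cG)].
have [t tT tmax] := EVT_max T0 cP.
have PE s : N s * expR (- (s / h)) = N s / g s by rewrite expRN.
have {}tmax s : 0 <= s <= T -> N s <= N t / g t * g s.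
  by move=> sT; rewrite -ler_pdivrMr// -!PE; apply: tmax; rewrite in_itv.
move: tT; rewrite in_itv/= => /andP[t0 tT].
have Nt : 0 < N t.
  have := tmax t1; rewrite t10 t1T => /(_ isT) H.
  have : 0 < N t / g t * g t1 by exact: lt_le_trans H.
  by rewrite pmulr_lgt0// pmulr_lgt0// invr_gt0.
have {}t0 : 0 < t.
  rewrite lt_neqAle t0 andbT; apply/eqP => t00; move: Nt; rewrite -t00 N0; exact: (elimF idP (ltxx _)).
have [r1 [r10 r1t Hr1]] : exists r1, [/\ 0 < r1, r1 < t & forall r, 0 <= r <= r1 -> N r <= N t / 2].
  have [||dl dl0 H] := @within_continuous_ball _ 0 T 0 N (N t / 2) cN.
  - by rewrite lexx.
  - by rewrite divr_gt0.
  exists (Num.min dl t / 2).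
  have mt : 0 < Num.min dl t by rewrite lt_min dl0.
  have [m1 m2] : Num.min dl t <= dl /\ Num.min dl t <= t by split; rewrite ge_min lexx ?orbT.
  split; [by lra|by lra|move=> r /andP[r0 rr]].
  apply: le_trans (ler_norm _) _; rewrite -[N r]subr0 -N0; apply: H; first by apply/andP; split; lra.
  by rewrite subr0 ger0_norm//; lra.
exists t, (Num.max r1 (t - h)); split; [split => //|split].
- by rewrite lt_max r10.
- by rewrite gt_max r1t; lra.
- by rewrite lerBlDr -lerBlDl le_max lexx orbT.
- move=> r /andP[r0 rt]; apply: le_trans (tmax r _) _; first by rewrite r0 (le_trans rt).
  rewrite -[leRHS](divfK (lt0r_neq0 (g0 t))) ler_wpM2l ?divr_ge0 ?(ltW Nt) ?(ltW (g0 t))//.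
  by rewrite ler_expR ler_wpM2r// invr_ge0 ltW.
- move=> r /andP[r0]; rewrite le_max => /orP[rr|rr]; first by apply: Hr1; rewrite r0.
  apply: le_trans (tmax r _) _; first by apply/andP; split; lra.
  rewrite -mulrA ler_wpM2l ?(ltW Nt)// mulrC ler_pdivrMr//.
  apply: (@le_trans _ _ (expR (t / h - 1))).
    by rewrite ler_expR ler_pdivrMr// mulrBl divfK ?gt_eqF// mul1r.
  rewrite expRD mulrC ler_wpM2r ?(ltW (g0 t))// expRN lef_pV2 ?posrE ?expR_gt0//.
  by have := expR_ge1Dx (1 : R); lra.
Qed.

Section positive_part_sup.
Context {R : realType} {d : nat}.
Local Notation mu := (lebesgue_rV R d).
Variable Omega : set 'rV[R]_d.
Hypothesis mO : measurable Omega.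
Local Notation Loo := (Lp_on mu +oo%E Omega).
Implicit Types (f g : 'rV[R]_d -> R).

(** The essential supremum of the positive part, as a real number. *)
Definition pos_sup f : R := fine (Lp_norm_on mu +oo%E Omega f^\+).

Lemma Loo_norm_fin f : Loo f -> Lp_norm_on mu +oo%E Omega f \is a fin_num.
Proof.
move=> /(Loo_onP _ mO _)[_ [M HM]]; rewrite ge0_fin_numE ?Loo_norm_ge0//.
apply: (@le_lt_trans _ _ (`|M|)%:E); last by rewrite ltry.
apply: Loo_norm_le => //; apply: filterS HM => x + Ox => /(_ Ox) /le_trans; apply.
exact: ler_norm.
Qed.

Lemma Loo_pos f : Loo f -> Loo f^\+.
Proof.
move=> /(Loo_onP _ mO _)[mf [M HM]]; apply/(Loo_onP _ mO _); split; first exact: measurable_funrpos.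
exists M; apply: filterS HM => x + Ox => /(_ Ox) h.
by rewrite funrposE ger0_norm ?le_max ?lexx ?orbT// ge_max (le_trans (ler_norm _) h)/= (le_trans _ h).
Qed.

Lemma pos_sup_ge0 f : 0 <= pos_sup f.
Proof. by rewrite fine_ge0// Loo_norm_ge0. Qed.

Lemma pos_sup_ub f : Loo f -> {ae mu, forall x, Omega x -> f x <= pos_sup f}.
Proof.
move=> Lf; apply: filterS (Loo_norm_ae mu Omega f^\+) => x + Ox => /(_ Ox).
rewrite -(fineK (Loo_norm_fin (Loo_pos Lf))) lee_fin => /(le_trans (ler_norm _)).
by apply: le_trans; rewrite funrposE le_max lexx.
Qed.

Lemma pos_sup_least f M : Loo f -> 0 <= M -> {ae mu, forall x, Omega x -> f x <= M} ->
  pos_sup f <= M.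
Proof.
move=> Lf M0 HM; rewrite -lee_fin fineK; last exact: Loo_norm_fin (Loo_pos Lf).
apply: Loo_norm_le => //; apply: filterS HM => x + Ox => /(_ Ox) h.
by rewrite funrposE ger0_norm ?le_max ?lexx ?orbT// ge_max h.
Qed.

Lemma pos_sup_dist f g : Loo f -> Loo g ->
  `|pos_sup f - pos_sup g| <= fine (Lp_norm_on mu +oo%E Omega (f \- g)%R).
Proof.
move=> Lf Lg; have Lfg := Loo_sub mO Lf Lg.
have N0 : 0 <= fine (Lp_norm_on mu +oo%E Omega (f \- g)%R) by rewrite fine_ge0// Loo_norm_ge0.
have Nae : {ae mu, forall x, Omega x -> `|f x - g x| <= fine (Lp_norm_on mu +oo%E Omega (f \- g)%R)}.
  apply: filterS (Loo_norm_ae mu Omega (f \- g)%R) => x + Ox => /(_ Ox).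
  by rewrite -(fineK (Loo_norm_fin Lfg)) lee_fin.
rewrite ler_distl; apply/andP; split.
  rewrite lerBlDr; apply: pos_sup_least => //; first by rewrite addr_ge0 ?pos_sup_ge0.
  apply: filterS2 (pos_sup_ub Lf) Nae => x + + Ox => /(_ Ox) h1 /(_ Ox).
  by rewrite ler_distl => /andP[h2 _]; rewrite (le_trans _ (lerD h1 (lexx _)))// -lerBlDr.
apply: pos_sup_least => //; first by rewrite addr_ge0 ?pos_sup_ge0.
apply: filterS2 (pos_sup_ub Lg) Nae => x + + Ox => /(_ Ox) h1 /(_ Ox).
by rewrite ler_distl => /andP[_ h2]; apply: (le_trans h2); rewrite lerD2r.
Qed.

Lemma continuous_Loo_lipschitz (T k : R) (u : R -> 'rV[R]_d -> R) (F : ('rV[R]_d -> R) -> R) :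
  continuous_Loo Omega T u -> 0 <= k ->
  (forall f g, Loo f -> Loo g -> `|F f - F g| <= k * fine (Lp_norm_on mu +oo%E Omega (f \- g)%R)) ->
  {within `[0, T], continuous (fun s => F (u s))}.
Proof.
move=> cu k0 HF; rewrite continuous_subspace_in => s; rewrite inE => sT.
have k1 : 0 < k + 1 by rewrite ltr_wpDl.
apply/cvgrPdist_lt => e e0.
rewrite -nbhs_subspace_in//; have [Ls] := cu s sT; rewrite ge0_cvge0P; last by move=> t; exact: Loo_norm_ge0.
move=> /(_ (e / (k + 1)) (divr_gt0 e0 k1)) H.
apply: filterS2 (withinT _ _) H => t tT H.
have [Lt _] := cu t tT.
rewrite distrC; apply: le_lt_trans (HF _ _ Lt Ls) _.
rewrite -(fineK (Loo_norm_fin (Loo_sub mO Lt Ls))) lte_fin ltr_pdivlMr// in H.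
apply: le_lt_trans H; rewrite mulrC ler_wpM2l ?lerDl//.
by rewrite fine_ge0// Loo_norm_ge0.
Qed.

End positive_part_sup.

Section truncation_facts.
Context {R : realType} {d : nat}.
Implicit Types (f : 'rV[R]_d -> R) (kappa : R).

Lemma truncation_ge0 kappa f x : 0 <= truncation kappa f x.
Proof. by rewrite /truncation /cutG mulr_ge0 ?flatn_ge0// funrposE le_max lexx orbT. Qed.

Lemma truncation_eq0 kappa f x : 0 <= kappa -> f x <= kappa -> truncation kappa f x = 0.
Proof.
move=> k0 fk; have h : f^\+ x - kappa <= 0 by rewrite funrposE subr_le0 ge_max fk.
by rewrite /truncation /cutG [X in _ * X](flat_le0 0 h) mulr0.
Qed.

Lemma truncation_gt0 kappa f x : 0 <= kappa -> kappa < f x -> 0 < truncation kappa f x.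
Proof.
move=> k0 kf; have fx : f^\+ x = f x by rewrite funrposE max_l// (le_trans k0)// ltW.
by rewrite /truncation /cutG fx mulr_gt0 ?flat_gt0 ?subr_gt0// (le_lt_trans k0).
Qed.

End truncation_facts.

(** At a time at which the supremum [M] of [u] is positive and dominates the past
    as produced by [weighted_maximum], the subsolution inequality fails for the
    truncation of [u] at a level [M - eps]. *)
Lemma positive_maximum_absurd (R : realType) (d : nat) (alpha lambda t r0 h M C : R)
    (Omega : set 'rV[R]_d) (A : 'rV[R]_d -> 'M[R]_d) (b : 'rV[R]_d -> 'rV[R]_d)
    (c : 'rV[R]_d -> R) (u : R -> 'rV[R]_d -> R) (w : 'rV[R]_d -> R) :
  open Omega -> (lebesgue_rV R d Omega < +oo)%E -> (0 < d)%N -> 0 < alpha < 1 ->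
  0 <= lambda ->
  (forall i j, Lp_on (lebesgue_rV R d) +oo%E Omega (fun x => A x i j)) ->
  (forall i, Lp_on (lebesgue_rV R d) +oo%E Omega (fun x => b x ord0 i)) ->
  {ae lebesgue_rV R d, forall x, Omega x -> sym_posdef (A x)} ->
  0 <= C -> {ae lebesgue_rV R d, forall x, Omega x ->
    \sum_i b x ord0 i ^+ 2 <= 4 * min_eigenvalue (A x) * C} ->
  {ae lebesgue_rV R d, forall x, Omega x -> - lambda <= c x} ->
  continuous_Loo Omega t u -> W1oo Omega (t / 2) t u ->
  H1 Omega (u t) -> H10 Omega (u t)^\+ ->
  0 < r0 -> r0 < t -> t - r0 <= h ->
  2 * (lambda + 2) * Gamma (1 - alpha) <= (2 * h) `^ (- alpha) ->
  0 < M -> pos_sup Omega (u t) = M ->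
  (forall r, 0 <= r <= t -> pos_sup Omega (u r) <= M) ->
  (forall r, 0 <= r <= r0 -> pos_sup Omega (u r) <= M / 2) ->
  is_caputo_derivative Omega alpha u t w ->
  (forall chi, H10 Omega chi -> {ae lebesgue_rV R d, forall x, Omega x -> 0 <= chi x} ->
    (lebesgue_rV R d).-integrable Omega (fun x => (c x * u t x * chi x)%:E) /\
    \int[lebesgue_rV R d]_(x in Omega) (w x * chi x)
    + elliptic_form Omega A b (u t) chi
    + \int[lebesgue_rV R d]_(x in Omega) (c x * u t x * chi x) <= 0) ->
  False.
Proof.
move=> oO fO d0 al l0 LA Lb pA C0 bC cl cu [v HW] H1u H10u r00 r0t th hG M0 Mt Mle Mle2 Hw Hsub.
have mO : measurable Omega by exact: open_measurable_rV.
have t0 : 0 < t by exact: lt_trans r0t.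
have [_ [_ [K HK]] _] := HW.
(* a Lipschitz constant of [u] on [t/2, t], increased so as to be positive *)
pose M1 := `|K| + 1.
have M10 : 0 < M1 by rewrite ltr_wpDl.
have KM1 : `|K| <= M1 by rewrite lerDl.
have Lu s : 0 <= s <= t -> Lp_on (lebesgue_rV R d) +oo%E Omega (u s).
  by move=> st; have [] := cu s (ltac:(by rewrite in_itv) : s \in `[0, t]).
have tt : 0 <= t <= t by rewrite lexx ltW.
pose G := Gamma (1 - alpha); have G0 : 0 < G by exact: Gamma_gt0.
have ute : {ae lebesgue_rV R d, forall x, Omega x -> u t x <= M}.
  by rewrite -Mt; exact: pos_sup_ub (Lu t tt).
have eta0 : 0 < G * M / (2 * M1) by rewrite divr_gt0 ?mulr_gt0.
have [D0 /andP[D00 D0t] tail] := @kernel_tail _ alpha al (t / 2) t _ (ltac:(lra) : t / 2 < t) eta0.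
pose delta0 := Num.min D0 (t - r0).
have delta00 : 0 < delta0 by rewrite lt_min D00 subr_gt0.
(* The Caputo term exceeds the zero-order term by [2 M X], up to three errors;
   [eps] makes each of them at most [M / 2 * X]. *)
pose eps := Num.min (Num.min (M / 2) (M / (4 * (lambda + 2)))) (Num.min (Num.min 1 (M / (2 * (C + 1)))) (delta0 * M1)).
have e0 : 0 < eps.
  have l2 : 0 < 4 * (lambda + 2) by lra.
  have c2 : 0 < 2 * (C + 1) by lra.
  by rewrite !lt_min ltr01 !divr_gt0//= mulr_gt0.
have [e1 e2 e3 e4 e5] : [/\ eps <= M / 2, eps <= M / (4 * (lambda + 2)), eps <= 1,
    eps <= M / (2 * (C + 1)) & eps <= delta0 * M1].
  by split; rewrite /eps !ge_min lexx ?orbT.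
have {}e2 : 2 * (lambda + 2) * eps <= M / 2.
  have l2 : 0 < 4 * (lambda + 2) by lra.
  by move: e2; rewrite ler_pdivlMr//; move: l0 e0; clear => *; lra.
have {}e4 : C * eps ^+ 2 <= M / 2.
  have c2 : 0 < 2 * (C + 1) by lra.
  have sq : eps ^+ 2 <= eps by rewrite expr2 ler_piMr// ltW.
  have := ler_wpM2l C0 sq; move: e4; rewrite ler_pdivlMr//.
  by move: e0; clear => *; lra.
(* closer to [t] than [delta], the Lipschitz bound on increments improves on [eps] *)
pose delta := eps / M1.
have dl0 : 0 < delta by rewrite divr_gt0.
have dlM : M1 * delta = eps by rewrite mulrC divfK// gt_eqF.
have [dlD dlr] : delta <= D0 /\ delta <= t - r0.
  have : delta <= delta0 by rewrite ler_pdivrMr.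
  by rewrite le_min => /andP[].
have {tail} tail := tail delta (ltac:(by rewrite dl0) : 0 < delta <= D0).
pose kappa := M - eps.
have k0 : 0 <= kappa by rewrite /kappa; move: e1 M0; clear => *; lra.
pose chi := truncation kappa (u t).
have [H10chi _] := truncation_H10 oO fO k0 H1u H10u.
have chi0 x : 0 <= chi x by exact: truncation_ge0.
have ichi : (lebesgue_rV R d).-integrable Omega (EFin \o chi).
  by apply: (L2_integrable oO fO); apply/(L2P _ mO _); case: H10chi => -[].
pose X := \int[lebesgue_rV R d]_(x in Omega) chi x.
have Xmass : chi_mass Omega chi = X.
  by apply: eq_Rintegral => x _; rewrite ger0_norm.
pose U s := pairing Omega chi (u s).
have iu s : 0 <= s <= t -> (lebesgue_rV R d).-integrable Omega (EFin \o (fun x => u s x * chi x)).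
  by move=> /Lu; exact: integrable_pairing.
have Uub s B : 0 <= s <= t -> pos_sup Omega (u s) <= B -> U s <= B * X.
  move=> st sB; rewrite /X -RintegralZl//; apply: (ae_le_Rintegral mO (iu s st)).
    exact: (Rintegrable_scale mO).
  apply: filterS (pos_sup_ub mO (Lu s st)) => x + Ox => /(_ Ox) ux.
  by rewrite ler_wpM2r// (le_trans ux).
have Ut : kappa * X <= U t.
  rewrite /X -RintegralZl//; apply: (ae_le_Rintegral mO _ (iu t tt)).
    exact: (Rintegrable_scale mO).
  apply: aeW => x Ox; have [h1|h1] := leP (u t x) kappa.
    by rewrite /chi truncation_eq0// !mulr0.
  by rewrite ler_wpM2r// ltW.
have X0 : 0 < X.
  have X00 : 0 <= X by exact: Rintegral_ge0.
  rewrite lt_neqAle X00 andbT; apply/eqP => XE.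
  have chi_ae : {ae lebesgue_rV R d, forall x, Omega x -> chi x = 0}.
    have E : (\int[lebesgue_rV R d]_(x in Omega) `|(EFin \o chi) x| = 0)%E.
      under eq_integral do rewrite /= ger0_norm//.
      by rewrite -(fineK (integrable_fin_num mO ichi)) -[fine _]/X -XE.
    have := (ae_eq_integral_abs _ mO (measurable_int _ ichi)).1 E.
    by apply: filterS => x + Ox => /(_ Ox)[].
  have : pos_sup Omega (u t) <= kappa.
    apply: (pos_sup_least mO (Lu t tt) k0); apply: filterS chi_ae => x + Ox => /(_ Ox) h1.
    rewrite leNgt; apply/negP => /(truncation_gt0 k0); rewrite -/chi h1.
    exact: (elimF idP (ltxx _)).
  by rewrite Mt /kappa; move: e0; clear => *; lra.
have cU : {within `[0, t], continuous U}.
  apply: (@continuous_Loo_lipschitz _ _ _ mO t (chi_mass Omega chi + 1) u (pairing Omega chi) cu).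
    by rewrite addr_ge0 ?chi_mass_ge0.
  move=> f g Lf Lg; have Lfg := Loo_sub mO Lf Lg.
  have c0 : 0 < chi_mass Omega chi + 1 by rewrite ltr_wpDl ?chi_mass_ge0.
  have := pairing_le mO ichi Lfg; rewrite -(fineK (Loo_norm_fin mO Lfg)) lee_fin ler_pdivrMl//.
  by rewrite -(pairing_sub mO ichi Lf Lg).
have cU' p : 0 <= p -> {within `[p, t], continuous U}.
  move=> p0; apply: continuous_subspaceW cU => x.
  by rewrite /= !in_itv/= => /andP[h1 ->]; rewrite andbT (le_trans p0).
have Lip : forall r, t / 2 <= r < t -> - (`|K| * X * (t - r)) <= U t - U r.
  rewrite -Xmass; apply: (pairing_lipschitz mO ichi HW HK).
    by move=> s /andP[h1 h2]; apply: Lu; rewrite h2 andbT; move: h1 t0; clear => *; lra.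
  by apply: cU'; move: t0; clear => *; lra.
have time : G^-1 * ((2 * h) `^ (- alpha) * ((M / 2 - eps) * X) -
    (M1 * X) * \int[lebesgue_measure]_(s in `]t - delta, t[) kernel alpha t s) <= pairing Omega chi w.
  apply: (caputo_pairing_ge mO ichi al Hw (r0 := r0)) => //.
  - by move=> p /ltW p0; exact: cU'.
  - by move: dlr; clear => *; lra.
  - by rewrite mulr_ge0 ?(ltW X0)// subr_ge0.
  - by rewrite mulr_ge0 ?(ltW X0)// ltW.
  - move=> r /andP[h1 h2]; rewrite -/(U t) -/(U r).
    have := Uub r (M / 2) _ (Mle2 r _); rewrite (ltW h1) (le_trans h2 (ltW r0t)) h2 => /(_ isT isT).
    by move: Ut; rewrite /kappa; move: (U t) (U r) => y z; clear => *; lra.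
  - move=> r /andP[h1 h2]; rewrite -/(U t) -/(U r) mulrAC dlM.
    have := Uub r M _ (Mle r _); rewrite (ltW h1) (ltW h2) => /(_ isT isT).
    by move: Ut; rewrite /kappa; move: (U t) (U r) => y z; clear => *; lra.
  - move=> r /andP[h1 h2].
    have h3 : t / 2 <= r by move: dlD D0t h1; clear => *; lra.
    apply: le_trans (Lip r _); last by rewrite h3.
    rewrite lerN2; apply: ler_wpM2r; first by rewrite subr_ge0 ltW.
    by apply: ler_wpM2r => //; exact: ltW.
have [icu Hle] := Hsub chi H10chi (aeW _ (fun x _ => chi0 x)).
have ell : - (C * eps ^+ 2 * X) <= elliptic_form Omega A b (u t) chi.
  apply: (elliptic_form_ge oO fO d0 LA Lb pA C0 bC k0 (ltW e0) H1u H10u).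
  by rewrite /kappa subrK.
have cterm : - (lambda * M * X) <= \int[lebesgue_rV R d]_(x in Omega) (c x * u t x * chi x).
  rewrite -mulNr /X -RintegralZl//; apply: (ae_le_Rintegral mO _ icu).
    exact: (Rintegrable_scale mO).
  apply: filterS2 ute cl => x + + Ox => /(_ Ox) h1 /(_ Ox) h2.
  have [h3|h3] := leP (u t x) kappa.
    by rewrite /chi truncation_eq0// !mulr0.
  rewrite ler_wpM2r//; have u0 : 0 < u t x by exact: le_lt_trans h3.
  move: l0 h1 h2 u0; move: (c x) (u t x) => y z; clear => *.
  by apply: (@le_trans _ _ (- lambda * z)); nra.
move: Hle; rewrite -/(pairing Omega chi w) => Hle.
pose I := \int[lebesgue_measure]_(s in `]t - delta, t[) kernel alpha t s.
have I1 : G^-1 * (M1 * I) <= M / 2.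
  rewrite ler_pdivrMl//; move: tail; rewrite -/I ltr_pdivlMr ?mulr_gt0//.
  by move: (I) => z; clear => *; lra.
have P1 : (lambda + 2) * M - 2 * (lambda + 2) * eps <= G^-1 * ((2 * h) `^ (- alpha) * (M / 2 - eps)).
  rewrite ler_pdivlMl//; have me : 0 <= M / 2 - eps by rewrite subr_ge0.
  have := ler_wpM2r me hG; rewrite -/G; move: (_ * (M / 2 - eps)) => z.
  by clear => *; lra.
have : 0 < M / 2 * X by rewrite mulr_gt0// divr_gt0.
have : G^-1 * ((2 * h) `^ (- alpha) * ((M / 2 - eps) * X) - (M1 * X) * I) =
   (G^-1 * ((2 * h) `^ (- alpha) * (M / 2 - eps)) - G^-1 * (M1 * I)) * X by ring.
move: time; rewrite -/I => time E.
rewrite E in time.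
move: time Hle ell cterm I1 P1 e2 e4 X0.
move: (G^-1 * _) (G^-1 * _) (pairing _ _ _) (elliptic_form _ _ _ _ _) (\int[_]_(_ in _) _) (C * _ ^+ 2).
clear => *; nra.
Qed.

Theorem theorem3p1 (R : realType) (d : nat) (alpha T lambda : R)
  (Omega : set 'rV[R]_d)
  (a : R -> 'rV[R]_d -> 'M[R]_d) (b : R -> 'rV[R]_d -> 'rV[R]_d)
  (c u : R -> 'rV[R]_d -> R)
  (hd : (1 <= d <= 3)%N) (halpha : 0 < alpha < 1) (hT : 0 < T)
  (hOmega : bounded_lipschitz_domain Omega)
  (ha : forall i j, bounded_coefficient Omega T (fun t x => a t x i j))
  (hb : forall i, bounded_coefficient Omega T (fun t x => b t x ord0 i))
  (hposdef : forall t, 0 < t <= T ->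
    {ae lebesgue_rV R d, forall x, Omega x -> sym_posdef (a t x)})
  (hCL : (drift_ratio_sup Omega T a b < +oo)%E)
  (hbCL : forall t, 0 < t <= T ->
    {ae lebesgue_rV R d, forall x, Omega x ->
      ((\sum_i b t x ord0 i ^+ 2)%:E <=
       (4 * min_eigenvalue (a t x))%:E * drift_ratio_sup Omega T a b)%E})
  (hlambda : 0 <= lambda)
  (hc : ((- lambda)%:E <= ess_inf_on (lebesgue_rV R d \x @lebesgue_measure R)%E
           (cylinder Omega T) (fun z => c z.2 z.1))%E)
  (hct : forall t, 0 < t <= T ->
    {ae lebesgue_rV R d, forall x, Omega x -> - lambda <= c t x})
  (hu0 : {ae lebesgue_rV R d, forall x, Omega x -> u 0 x <= 0})
  (hubd : forall t, 0 <= t <= T -> nonpos_on_boundary Omega (u t))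
  (huC : continuous_Loo Omega T u)
  (huW : forall eps t, 0 < eps -> eps < t -> t <= T -> W1oo Omega eps t u)
  (huH1 : forall t, 0 < t <= T -> H1 Omega (u t))
  (hsub : weak_subsolution Omega alpha T a b c u) :
  forall t, 0 <= t <= T -> (ess_sup_on (lebesgue_rV R d) Omega (u t) <= 0)%E.
Proof.
have [oO _ _ bO _] := hOmega.
have mO : measurable Omega by exact: open_measurable_rV.
have fO := bounded_fin_measure mO bO.
have d0 : (0 < d)%N by case/andP: hd.
have Lu s : 0 <= s <= T -> Lp_on (lebesgue_rV R d) +oo%E Omega (u s).
  by move=> sT; have [] := huC s (ltac:(by rewrite in_itv) : s \in `[0, T]).
pose N s := pos_sup Omega (u s).
suff N0 : forall t, 0 <= t <= T -> N t <= 0.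
  move=> t tT; apply: ereal_inf_lbound; rewrite /=.
  apply: filterS (pos_sup_ub mO (Lu t tT)) => x + Ox => /(_ Ox) h.
  by rewrite lee_fin (le_trans h)// N0.
move=> t1 t1T; rewrite leNgt; apply/negP => Nt1.
have cN : {within `[0, T], continuous N}.
  apply: (continuous_Loo_lipschitz mO huC ler01) => f g Lf Lg.
  by rewrite mul1r; exact: pos_sup_dist.
have N00 : N 0 = 0.
  apply/eqP; rewrite eq_le pos_sup_ge0 andbT; apply: (pos_sup_least mO) => //.
  by apply: Lu; rewrite lexx ltW.
have G0 : 0 < Gamma (1 - alpha) by exact: Gamma_gt0.
(* [h] solves [(2 h) `^ (- alpha) = k0] *)
pose k0 := 2 * (lambda + 2) * Gamma (1 - alpha).
have k00 : 0 < k0 by rewrite mulr_gt0// mulr_gt0//; lra.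
have /andP[al0 al1] := halpha.
pose h := k0 `^ (- alpha^-1) / 2.
have h0 : 0 < h by rewrite divr_gt0// powR_gt0.
have hk : k0 <= (2 * h) `^ (- alpha).
  rewrite /h mulrC divfK// -powRrM mulrNN mulVf ?gt_eqF// powRr1//.
  exact: ltW.
have [t [r0 [[r00 r0t tT tr Nt] [Nle Nle2]]]] := weighted_maximum h0 cN N00 t1T Nt1.
have t0 : 0 < t by exact: lt_trans r0t.
have tT' : 0 < t <= T by rewrite t0.
pose C := Num.max 0 (fine (drift_ratio_sup Omega T a b)).
have C0 : 0 <= C by rewrite le_max lexx.
have bC : {ae lebesgue_rV R d, forall x, Omega x ->
    \sum_i b t x ord0 i ^+ 2 <= 4 * min_eigenvalue (a t x) * C}.
  apply: filterS2 (hbCL t tT') (hposdef t tT') => x + + Ox => /(_ Ox) h1 /(_ Ox) h2.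
  have [m0 _] := min_eigenvalue_spec d0 h2.
  move: hCL h1; rewrite /C; case: (drift_ratio_sup Omega T a b) => [r _|//|_] /=.
    rewrite -EFinM lee_fin => /le_trans; apply; apply: ler_wpM2l; first by rewrite mulr_ge0.
    by rewrite le_max lexx orbT.
  rewrite maxxx mulr0; move: m0; rewrite le_eqVlt => /orP[/eqP <-|m0].
    by rewrite mulr0 mul0e lee_fin.
  by rewrite gt0_muleNy ?lte_fin ?mulr_gt0// leeNy_eq.
have [w Hw Hsub] := hsub t tT'.
have cut : continuous_Loo Omega t u.
  move=> s; rewrite in_itv/= => /andP[s0 st].
  have [Ls us] := huC s (ltac:(by rewrite in_itv/= s0 (le_trans st)) : s \in `[0, T]).
  split=> //; move: us.
  rewrite !ge0_cvge0P; [|by move=> r; exact: Loo_norm_ge0..].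
  move=> H e e0; have {}H := H e e0; rewrite near_withinE; rewrite near_withinE in H.
  near=> r => rt; have : `[0, t]%classic r by [].
  rewrite /= in_itv/= => /andP[r1 r2].
  have rT : `[0, T]%classic r by rewrite /= in_itv/= r1 (le_trans r2).
  by move: rT; near: r.
apply: (@positive_maximum_absurd R d alpha lambda t r0 h (N t) C Omega (a t) (b t) (c t) u w) => //.
- by move=> i j; have [_ H] := ha i j; exact: H.
- by move=> i; have [_ H] := hb i; exact: H.
- exact: hposdef.
- exact: hct.
- by apply: huW => //; lra.
- exact: huH1.
- by apply: hubd; rewrite (ltW t0).
Unshelve. all: by end_near. Qed.
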